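(* For any $1\le p\le2$, $\gamma=\gamma(n,m)\ge4$, and $\delta>0$, there is an $M\cdot\mathrm{poly}(m)$-time reduction from $\gamma$-$\mathsf{CVP}_p$ to $\delta$-$\mathsf{DSS}_p^M$, where $M=O(e^{m/(\gamma/4)^p+\delta})$. The reduction calls its $\mathsf{DSS}$ oracle on lattices with dimension $m+1$ and rank $n+1$, where $m,n$ are the dimension and rank of the input lattice.
   Context: A lattice of rank $n$ in $\mathbb{R}^m$ is the set of integer combinations of $n$ linearly independent vectors (a basis) in $\mathbb{R}^m$. $\|\cdot\|_p$ is the $\ell_p$ norm and $\mathcal{B}_p^m$ the closed unit $\ell_p$ ball in $\mathbb{R}^m$. $\mathrm{dist}_p(\mathbf{t},\mathcal{L})=\min_{\mathbf{x}\in\mathcal{L}}\|\mathbf{x}-\mathbf{t}\|_p$. $\gamma$-$\mathsf{CVP}_p$: given a basis of $\mathcal{L}\subset\mathbb{R}^m$ and $\mathbf{t}\in\mathbb{R}^m$, output $\mathbf{v}\in\mathcal{L}$ with $\|\mathbf{v}-\mathbf{t}\|_p\le\gamma\,\mathrm{dist}_p(\mathbf{t},\mathcal{L})$. Let $f_p(\mathbf{x})=\exp(-\|\mathbf{x}\|_p^p)$, $f_p(A)=\sum_{\mathbf{x}\in A}f_p(\mathbf{x})$ for discrete $A$, and $D_{\mathcal{L},p}$ the distribution on $\mathcal{L}$ with $\Pr[X=\mathbf{x}]=f_p(\mathbf{x})/f_p(\mathcal{L})$. For $\delta>0$ and $M\in\mathbb{N}$, $\delta$-$\mathsf{DSS}_p^M$: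 given a basis of a lattice $\mathcal{L}\subset\mathbb{R}^m$ of rank $n$, output $M$ i.i.d. samples from a distribution $\tilde D$ such that for every $\mathbf{y}\in\mathcal{L}\cap m^{1/p}\mathcal{B}_p^m$, $\Pr_{X\sim\tilde D}[X=\mathbf{y}]\ge e^{-\delta}\Pr_{X'\sim D_{\mathcal{L},p}}[X'=\mathbf{y}]$. A $T$-time reduction from A to B is a (randomized) algorithm running in time $T$ solving A using an oracle for B.
   Formalization: The input basis and target are rational, and poly(m) is read as a polynomial in m and the input bit length (no bound in m alone can hold); time counts steps of a real RAM with exact field operations, comparisons and |x|^p at unit cost; success probability is at least 2/3. *)

(* Defs.v *)
From HB Require Import structures.
From mathcomp Require Import all_boot all_order all_algebra.
From mathcomp Require Import all_classical all_reals all_analysis.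
Set Implicit Arguments.
Unset Strict Implicit.
Unset Printing Implicit Defensive.
Import Order.TTheory GRing.Theory Num.Theory.
Local Open Scope classical_set_scope.
Local Open Scope ring_scope.

(** * Lattices, CVP and DSS *)

Section Lattices.
Variables (R : realType) (p : R).

Definition lp_norm m (x : 'rV[R]_m) : R :=
  (\sum_(j < m) `|x 0 j| `^ p) `^ p^-1.

(* The rows of [B] are the generators; [B] is a basis, and the lattice has
   rank n, when [row_free B]. *)
Definition lattice n m (B : 'M[R]_(n, m)) : set 'rV[R]_m :=
  [set map_mx intr z *m B | z in [set: 'rV[int]_n]].

(* For a basis [B] the infimum is attained. *)
Definition lp_dist n m (t : 'rV[R]_m) (B : 'M[R]_(n, m)) : R :=
  inf [set lp_norm (x - t) | x in lattice B].

Definition cvp_solution (gamma : R) n m (B : 'M[R]_(n, m)) (t v : 'rV[R]_m) :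
  Prop := lattice B v /\ lp_norm (v - t) <= gamma * lp_dist t B.

Definition fp m (x : 'rV[R]_m) : R := expR (- (lp_norm x `^ p)).

(* For a basis [B] the sum is finite and positive, so [fine] loses nothing. *)
Definition super_gaussian n m (B : 'M[R]_(n, m)) (x : 'rV[R]_m) : R :=
  fp x / fine (\esum_(y in lattice B) (fp y)%:E).

Definition is_distribution m (D : 'rV[R]_m -> R) : Prop :=
  (forall y, 0 <= D y) /\ (\esum_(y in [set: 'rV[R]_m]) (D y)%:E = 1)%E.

(* The support of [D] is not required to lie in the lattice. *)
Definition dss_distribution (delta : R) n m (B : 'M[R]_(n, m))
    (D : 'rV[R]_m -> R) : Prop :=
  is_distribution D /\
  forall y, lattice B y -> lp_norm y <= m%:R `^ p^-1 ->
    expR (- delta) * super_gaussian B y <= D y.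

(* An oracle maps a basis to the law from which it draws its samples; the
   number of samples is fixed by the machine below. *)
Definition oracle := forall n m : nat, 'M[R]_(n, m) -> 'rV[R]_m -> R.

Definition dss_oracle (delta : R) (O : oracle) : Prop :=
  forall n m (B : 'M[R]_(n, m)), row_free B -> dss_distribution delta B (O n m B).

End Lattices.

(** * Randomized oracle machines

   A structured real RAM.  Counters (naturals, with addition and truncated
   subtraction only) serve for control and addressing; cells (reals) are
   arranged in two-dimensional arrays and admit field operations, order tests
   and x |-> |x|^p.  There are no real constants besides naturals and no
   rounding: unit-cost rounding, or unit-cost multiplication and division with
   remainder of counters, would make the model unreasonably powerful. *)

Inductive iexp :=
  | IConst of nat
  | IVar of nat
  | IAdd of iexp & iexp
  | ISub of iexp & iexp.

Inductive rexp :=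
  | RNat of iexp
  | RCell of nat & iexp & iexp
  | RAdd of rexp & rexp
  | RSub of rexp & rexp
  | RMul of rexp & rexp
  | RDiv of rexp & rexp
  | RPow of rexp.

Inductive test :=
  | TIle of iexp & iexp
  | TRle of rexp & rexp
  | TNot of test.

(* [CQuery cnt ans bas r d] queries the oracle on the matrix held by the first
   [r] rows and [d] columns of array [bas]; the samples become the rows of
   array [ans] and their number is stored in counter [cnt]. *)
Inductive cmd :=
  | CSkip
  | CISet of nat & iexp
  | CRSet of nat & iexp & iexp & rexp
  | CSeq of cmd & cmd
  | CIf of test & cmd & cmd
  | CWhile of test & cmd
  | CFlip of nat
  | CQuery of nat & nat & nat & iexp & iexp.

Section Machine.
Variables (R : realType) (p : R).

Record store := Store { ctr : nat -> nat; arr : nat -> nat -> nat -> R }.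

Fixpoint ieval (s : store) (e : iexp) : nat :=
  match e with
  | IConst k => k
  | IVar x => ctr s x
  | IAdd e1 e2 => (ieval s e1 + ieval s e2)%N
  | ISub e1 e2 => (ieval s e1 - ieval s e2)%N
  end.

Fixpoint reval (s : store) (e : rexp) : R :=
  match e with
  | RNat i => (ieval s i)%:R
  | RCell a i j => arr s a (ieval s i) (ieval s j)
  | RAdd e1 e2 => reval s e1 + reval s e2
  | RSub e1 e2 => reval s e1 - reval s e2
  | RMul e1 e2 => reval s e1 * reval s e2
  | RDiv e1 e2 => reval s e1 / reval s e2
  | RPow e1 => `|reval s e1| `^ p
  end.

Fixpoint teval (s : store) (b : test) : bool :=
  match b with
  | TIle e1 e2 => (ieval s e1 <= ieval s e2)%N
  | TRle e1 e2 => reval s e1 <= reval s e2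
  | TNot b1 => ~~ teval s b1
  end.

Definition set_ctr (s : store) (x k : nat) : store :=
  Store (fun y => if y == x then k else ctr s y) (arr s).

Definition set_cell (s : store) (a i j : nat) (v : R) : store :=
  Store (ctr s) (fun a' i' j' =>
    if [&& a' == a, i' == i & j' == j] then v else arr s a' i' j').

Definition read_mx (s : store) (a r d : nat) : 'M[R]_(r, d) :=
  \matrix_(i, j) arr s a i j.

Definition write_mx (s : store) (a r d : nat) (A : 'M[R]_(r, d)) : store :=
  Store (ctr s) (fun a' i j =>
    if a' == a then
      match insub i, insub j with
      | Some i', Some j' => A i' j'
      | _, _ => arr s a' i j
      end
    else arr s a' i j).

(* A configuration is a stack of pending commands and a store. *)
Definition config := (seq cmd * store)%type.

(* The parameter [M] of the following definitions is the number of samples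
   returned by one query; a query counts as one step. *)
Inductive outcome (M : nat) :=
  | Halt
  | Next of config
  | Coin of config & config
  | Query r d of 'M[R]_(r, d) & ({ffun 'I_M -> 'rV[R]_d} -> config).

Definition step M (c : config) : outcome M :=
  let s := c.2 in
  match c.1 with
  | [::] => Halt M
  | CSkip :: K => Next M (K, s)
  | CISet x e :: K => Next M (K, set_ctr s x (ieval s e))
  | CRSet a i j e :: K =>
      Next M (K, set_cell s a (ieval s i) (ieval s j) (reval s e))
  | CSeq c1 c2 :: K => Next M (c1 :: c2 :: K, s)
  | CIf b c1 c2 :: K => Next M ((if teval s b then c1 else c2) :: K, s)
  | CWhile b c1 :: K =>
      Next M (if teval s b then c1 :: CWhile b c1 :: K else K, s)
  | CFlip x :: K => Coin M (K, set_ctr s x 0) (K, set_ctr s x 1)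
  | CQuery cnt ans bas r d :: K =>
      Query (read_mx s bas (ieval s r) (ieval s d))
        (fun y => (K, set_ctr (write_mx s ans (\matrix_i y i)) cnt M))
  end.

(* Every run of positive probability halts within [k] steps, and queries the
   oracle only on bases of lattices of rank [r0] in dimension [d0]. *)
Fixpoint halts_within (O : oracle R) (M r0 d0 k : nat) (c : config) : Prop :=
  match step M c with
  | Halt => True
  | Next c' =>
      if k is k'.+1 then halts_within O M r0 d0 k' c' else False
  | Coin c1 c2 =>
      if k is k'.+1
      then halts_within O M r0 d0 k' c1 /\ halts_within O M r0 d0 k' c2
      else False
  | Query r d B next =>
      if k is k'.+1
      then [/\ r = r0, d = d0, row_free B &
             forall y : {ffun 'I_M -> 'rV[R]_d},
               (forall i, 0 < O r d B (y i)) ->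
               halts_within O M r0 d0 k' (next y)]
      else False
  end.

(* Probability that the run from [c] halts within [k] steps in a store
   satisfying [Q]; each query returns [M] fresh independent samples. *)
Fixpoint success_prob (O : oracle R) (M : nat) (Q : store -> Prop) (k : nat)
    (c : config) : \bar R :=
  match step M c with
  | Halt => (if `[< Q c.2 >] then 1 else 0)%E
  | Next c' =>
      if k is k'.+1 then success_prob O M Q k' c' else 0%E
  | Coin c1 c2 =>
      if k is k'.+1
      then ((2^-1)%:E * success_prob O M Q k' c1
            + (2^-1)%:E * success_prob O M Q k' c2)%E
      else 0%E
  | Query r d B next =>
      if k is k'.+1
      then (\esum_(y in [set: {ffun 'I_M -> 'rV[R]_d}])
              ((\prod_(i < M) O r d B (y i))%:E
               * success_prob O M Q k' (next y)))%E
      else 0%E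
  end.

End Machine.

(** * Reductions from CVP to DSS

   Inputs are rational, so that they have a finite size. *)

Definition int_bits (z : int) : nat := (trunc_log 2 `|z|%N).+1.

Definition rat_bits (x : rat) : nat := (int_bits (numq x) + int_bits (denq x))%N.

Definition input_bits n m (B : 'M[rat]_(n, m)) (t : 'rV[rat]_m) : nat :=
  (\sum_(i < n) \sum_(j < m) rat_bits (B i j) + \sum_(j < m) rat_bits (t ord0 j))%N.

(* Counters 0 and 1 hold the rank and the dimension; arrays 0 to 3 hold the
   numerators and the denominators of the basis, then those of the target. *)
Definition init_store (R : realType) n m (B : 'M[rat]_(n, m)) (t : 'rV[rat]_m) :
    store R :=
  let num (x : rat) : R := (numq x)%:~R in
  let den (x : rat) : R := (denq x)%:~R in
  let blank := Store (fun _ => 0%N) (fun _ _ _ => 0 : R) in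
  let s := write_mx (write_mx blank 0 (map_mx num B)) 1 (map_mx den B) in
  let s := write_mx (write_mx s 2 (map_mx num t)) 3 (map_mx den t) in
  set_ctr (set_ctr s 0 n) 1 m.

(* The answer is read from the first row of array 0. *)
Definition output (R : realType) m (s : store R) : 'rV[R]_m := read_mx s 0 1 m.

(* [prog] solves gamma-CVP_p with probability at least 2/3 in time [T n m l],
   where l is the bit length of the input, given any oracle for delta-DSS_p^M
   with M = [M n m], which it only calls in rank n + 1 and dimension m + 1. *)
Definition cvp_to_dss_reduction (R : realType) (p : R)
    (gamma : nat -> nat -> R) (delta : R) (M : nat -> nat -> nat)
    (T : nat -> nat -> nat -> nat) (prog : cmd) : Prop :=
  forall n m (B : 'M[rat]_(n, m)) (t : 'rV[rat]_m) (O : oracle R),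
    let BR : 'M[R]_(n, m) := map_mx ratr B in
    let tR : 'rV[R]_m := map_mx ratr t in
    let c0 := ([:: prog], init_store R B t) in
    let k := T n m (input_bits B t) in
    row_free BR -> dss_oracle p delta O ->
    halts_within p O (M n m) n.+1 m.+1 k c0 /\
    ((2 / 3)%:E <= success_prob p O (M n m)
       (fun s => cvp_solution p (gamma n m) BR tR (output m s)) k c0)%E.

(* Main.v *)
(** Let [v = a (x0 - t)], where [x0] is a lattice point closest to [t] and [a] a
scale, and query the lattice spanned by the rows [(a b_i, 0)] and [(a t, 1/2)].
For [1 <= p <= 2] the function [exp (- |x|_p^p)] is a limit of mixtures of
Gaussians, hence positive definite: no translate of the scaled lattice has more
mass than the lattice itself, whose mass we call F, so the queried lattice has
mass at most 10 F.  Positive definiteness of second derivatives likewise gives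
[p E |x|_p^p <= m], so that a fraction [exp (- m eps / (1 - eps)) / (2 m + 1)] of F
is carried by the points with [|x|_p^p <= (m + 1/2) (1 - eps)].  Each such [x] has the
neighbours [x - v] and [x + v] in the cosets of [a t] and [- a t]; by Clarkson's
inequality [|x - v|^p + |x + v|^p <= 2 |x|^p + 2 |v|^p] passing to the shorter one
costs a factor [exp (- |v|^p)].  When [|v|_p^p] is about [eps m], with
[eps] about [(3 / 8) (4 / gamma)^p], a sample thus reveals a lattice point within
[gamma dist (t, L)] of [t] with probability [exp (- delta - m (4 / gamma)^p) / O(m)].
The right scale is among the terms of a geometric progression of ratio 4/3.

The machine has no rounding: the nearest-plane algorithm, which recovers
the integer coordinates of a sample, rounds by a greedy binary expansion whose
length is bounded through Cramer's rule. *)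

Require Import Defs.
From mathcomp Require Import all_boot all_order all_algebra.
From mathcomp Require Import all_classical all_reals all_analysis.
From mathcomp Require Import perm ring lra zify.
Import Order.TTheory GRing.Theory Num.Theory numFieldNormedType.Exports.
Set Implicit Arguments.
Unset Strict Implicit.
Unset Printing Implicit Defensive.
Local Open Scope classical_set_scope.
Local Open Scope ring_scope.

(** * Positive definite functions *)

(** Positive definiteness is used only as an inequality between finite quadratic forms. Summed over
    the points of a large box of the lattice, it bounds the mass of a coset by that of the lattice
    up to boundary terms, so that neither Poisson summation nor a Fourier transform occurs. The
    oracle speaks for points whose norm has [p]-th power at most [m + 1]. The extra coordinate [1/2]
    takes at most [1/2] of this, [v] takes a share [eps] of the remaining [m + 1/2], and the
    truncated ball gets the share [1 - eps]. The factor [O(m)] lost in the probability of a good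
    sample does not enter [M], which is [exp (m / (gamma / 4)^p + delta)] rounded down: the query is
    repeated [2560 (m + 1)] times at every scale, at polynomial cost. The machine knows neither the
    distance nor the right scale, and it does not test its samples: decoding always produces a
    lattice point and only the closest one is kept, so that wrong scales do no harm. *)

Section Limits.
Variable R : realType.
Implicit Types (u v : nat -> R) (a b l : R).

Lemma cvg_sumr (I : Type) (r : seq I) (P : pred I) (u : I -> nat -> R)
    (l : I -> R) :
  (forall i, P i -> u i n @[n --> \oo] --> l i) ->
  (\sum_(i <- r | P i) u i n) @[n --> \oo] --> \sum_(i <- r | P i) l i.
Proof. by move=> h; apply: cvg_big => //; exact: add_continuous. Qed.

Lemma cvg_ge0 u l : u n @[n --> \oo] --> l -> (forall n, 0 <= u n) -> 0 <= l.
Proof. by move=> h h0; apply: (cvgr_to_ge h); apply: nearW. Qed.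

Lemma cvg_diffquot (f : R -> R) l (v : nat -> R) : is_derive (0 : R) (1 : R) f l ->
  (forall n, v n != 0) -> v n @[n --> \oo] --> 0 ->
  ((f (v n) - f 0) / v n) @[n --> \oo] --> l.
Proof.
move=> [df dfl] v0 cv.
have cvf : (h^-1 *: ((f \o shift 0) (h *: (1:R)) - f 0)) @[h --> 0^'] --> l.
  by rewrite -dfl; exact: df.
have /cvgr_dnbhsP/(_ v (conj v0 cv)) := cvf.
apply: cvg_trans; apply: near_eq_cvg; apply: nearW => n /=.
by rewrite /GRing.scale /= addr0 mulr1 mulrC.
Qed.

Lemma cvg_expR_series a : (\sum_(k < n) a ^+ k / k`!%:R) @[n --> \oo] --> expR a.
Proof.
have h : series (exp_coeff a) n @[n --> \oo] --> expR a.
  exact: is_cvg_series_exp_coeff.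
apply: cvg_trans h; apply: near_eq_cvg; apply: nearW => n /=.
by rewrite /series /= big_mkord.
Qed.

End Limits.

Section PositiveDefinite.
Variables (R : realType) (m : nat).
Implicit Types (g h : 'rV[R]_m -> R) (w : 'I_m -> R).

(** The points form a family over any finite type, repetitions allowed, so that two copies of a
    family can be joined over [I + I]. *)
Definition psd_kernel (T : Type) (K : T -> T -> R) := forall (I : finType)
  (x : I -> T) (c : I -> R), 0 <= \sum_i \sum_j c i * c j * K (x i) (x j).

Definition pos_def g := psd_kernel (fun x y => g (x - y)).

Lemma psd_kernelD T (K L : T -> T -> R) : psd_kernel K -> psd_kernel L ->
  psd_kernel (fun x y => K x y + L x y).
Proof.
move=> hK hL I x c; rewrite (_ : (\sum_i _) =
  \sum_i \sum_j c i * c j * K (x i) (x j) + \sum_i \sum_j c i * c j * L (x i) (x j)).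
  by rewrite addr_ge0.
rewrite -big_split; apply: eq_bigr => i _ /=; rewrite -big_split.
by apply: eq_bigr => j _ /=; rewrite mulrDr.
Qed.

Lemma psd_kernelZ T (a : R) (K : T -> T -> R) : 0 <= a -> psd_kernel K ->
  psd_kernel (fun x y => a * K x y).
Proof.
move=> a0 hK I x c; rewrite (_ : (\sum_i _) =
  a * \sum_i \sum_j c i * c j * K (x i) (x j)); first by rewrite mulr_ge0.
rewrite big_distrr; apply: eq_bigr => i _ /=; rewrite big_distrr.
by apply: eq_bigr => j _ /=; rewrite mulrCA.
Qed.

Lemma psd_kernel_sum T (J : Type) (r : seq J) (P : pred J)
    (K : J -> T -> T -> R) : (forall k, P k -> psd_kernel (K k)) ->
  psd_kernel (fun x y => \sum_(k <- r | P k) K k x y).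
Proof.
move=> hK; elim: r => [|k r IH].
  by move=> I x c; rewrite big1// => i _; rewrite big1// => j _; rewrite big_nil mulr0.
rewrite (_ : (fun x y => _) = (fun x y => if P k then
  K k x y + \sum_(k <- r | P k) K k x y else \sum_(k <- r | P k) K k x y)); last first.
  by apply/funext => x; apply/funext => y; rewrite big_cons.
case Pk: (P k); last exact: IH.
exact: (psd_kernelD (hK k Pk) IH).
Qed.

Lemma psd_kernel_lim T (K : nat -> T -> T -> R) (L : T -> T -> R) :
  (forall x y, K n x y @[n --> \oo] --> L x y) -> (forall n, psd_kernel (K n)) ->
  psd_kernel L.
Proof.
move=> cK hK I x c.
apply: (@cvg_ge0 R (fun n => \sum_i \sum_j c i * c j * K n (x i) (x j))); last first.
  by move=> n; exact: hK.
apply: cvg_sumr => i _; apply: cvg_sumr => j _.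
by apply: cvgMl_tmp; exact: cK.
Qed.

Lemma psd_kernel_conj T (a : T -> R) (K : T -> T -> R) : psd_kernel K ->
  psd_kernel (fun x y => a x * a y * K x y).
Proof.
move=> hK I x c; have := hK I x (fun i => c i * a (x i)).
congr (_ <= _); apply: eq_bigr => i _; apply: eq_bigr => j _; ring.
Qed.

(** Powers of a weighted inner product are handled by induction: multiplication by the inner product
    is a nonnegative combination of rescalings by [x 0 k], which replaces Schur's product theorem.
    The exponential is a limit of nonnegative combinations of powers. *)
Lemma psd_kernel_exp (w : 'I_m -> R) : (forall k, 0 <= w k) ->
  psd_kernel (fun x y : 'rV[R]_m => expR (\sum_k w k * (x 0 k * y 0 k))).
Proof.
move=> w0.
have pw N : psd_kernel (fun x y : 'rV[R]_m => (\sum_k w k * (x 0 k * y 0 k)) ^+ N).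
  elim: N => [|N IH].
    move=> I x c; rewrite (_ : (\sum_i _) = (\sum_i c i) ^+ 2) ?sqr_ge0//.
    rewrite expr2 big_distrl; apply: eq_bigr => i _ /=.
    by rewrite big_distrr; apply: eq_bigr => j _; rewrite /= expr0 mulr1.
  have h := @psd_kernel_sum _ _ (index_enum 'I_m) xpredT _ (fun k _ =>
    psd_kernelZ (w0 k) (psd_kernel_conj (fun x : 'rV[R]_m => x 0 k) IH)).
  move=> I x c; have := h I x c; congr (_ <= _).
  apply: eq_bigr => i _; apply: eq_bigr => j _; congr (_ * _).
  rewrite exprS big_distrl; apply: eq_bigr => k _ /=; ring.
apply: (psd_kernel_lim (K := fun n (x y : 'rV[R]_m) => \sum_(k < n)
   (\sum_l w l * (x 0 l * y 0 l)) ^+ k / k`!%:R)).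
  by move=> x y; exact: cvg_expR_series.
move=> n; apply: psd_kernel_sum => k _ I x c.
have kf : 0 <= (k`!%:R : R)^-1 by rewrite invr_ge0 ler0n.
have := psd_kernelZ kf (pw k) x c; congr (_ <= _).
by apply: eq_bigr => i _; apply: eq_bigr => j _; congr (_ * _); rewrite mulrC.
Qed.

Definition diag_gauss w (x : 'rV[R]_m) : R := expR (- \sum_k w k * x 0 k ^+ 2).

(** In each coordinate [exp (- w (x - y)^2) = exp (- w x^2) exp (- w y^2) exp (2 w x y)], a
    rescaling of the exponential kernel. *)
Lemma diag_gauss_pos_def w : (forall k, 0 <= w k) -> pos_def (diag_gauss w).
Proof.
move=> w0 I x c.
have w2 k : 0 <= 2 * w k by rewrite mulr_ge0.
have := psd_kernel_conj (fun x => diag_gauss w x) (psd_kernel_exp w2) x c.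
congr (_ <= _); apply: eq_bigr => i _; apply: eq_bigr => j _; congr (_ * _).
rewrite /diag_gauss -!expRD -!sumrN -!big_split /=; congr expR.
apply: eq_bigr => k _; rewrite !mxE; ring.
Qed.

(** The quadratic form is evaluated on the points [x i] with weights [c i] together with the points
    [x i + v] with weights [- c i]. *)
Lemma pos_def_diff g v : pos_def g ->
  pos_def (fun x => 2 * g x - g (x - v) - g (x + v)).
Proof.
move=> hg I x c.
have := hg (I + I)%type (fun s => match s with inl i => x i | inr i => x i + v end)
  (fun s => match s with inl i => c i | inr i => - c i end).
rewrite big_sumType /=.
under eq_bigr do rewrite big_sumType /=.
under [X in _ + X]eq_bigr do rewrite big_sumType /=.
rewrite -big_split; congr (_ <= _); apply: eq_bigr => i _ /=.
rewrite -!big_split; apply: eq_bigr => j _ /=.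
rewrite (_ : x i + v - (x j + v) = x i - x j); last by rewrite opprD addrACA subrr addr0.
rewrite (_ : x i - (x j + v) = x i - x j - v); last by rewrite opprD addrA.
rewrite (_ : x i + v - x j = x i - x j + v); last by rewrite addrAC.
ring.
Qed.

(* Minus the second partial derivative of a positive definite function is
   positive definite; for a Gaussian it is computed through
   [cosh u - 1 = 2 sinh^2 (u/2)]. *)
Lemma diag_gauss_diff2_pos_def w k : (forall k, 0 <= w k) ->
  pos_def (fun x => (1 - 2 * w k * x 0 k ^+ 2) * diag_gauss w x).
Proof.
move=> w0; have := w0 k; rewrite le_eqVlt => /predU1P[wk|wk].
  move=> I x c; have := diag_gauss_pos_def w0 x c; congr (_ <= _).
  apply: eq_bigr => i _; apply: eq_bigr => j _.
  by rewrite -wk mulr0 mul0r subr0 mul1r.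
pose e : nat -> R := harmonic.
have e0 n : e n != 0 by rewrite gt_eqF// harmonic_gt0.
have ce : e n @[n --> \oo] --> 0 by exact: cvg_harmonic.
pose K n (x : 'rV[R]_m) := (2 * w k * e n ^+ 2)^-1 *
  (2 * diag_gauss w x - diag_gauss w (x - e n *: delta_mx 0 k)
   - diag_gauss w (x + e n *: delta_mx 0 k)).
apply: (psd_kernel_lim (K := fun n (x y : 'rV[R]_m) => K n (x - y))); last first.
  move=> n; have e2 : 0 <= (2 * w k * e n ^+ 2)^-1.
    by rewrite invr_ge0 mulr_ge0 ?sqr_ge0// mulr_ge0.
  exact: (psd_kernelZ e2 (@pos_def_diff _ (e n *: delta_mx 0 k)
    (diag_gauss_pos_def w0))).
move=> x' y'; move: (x' - y') => x {x' y'}.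
have sh (s : R) : diag_gauss w (x + s *: delta_mx 0 k) =
    diag_gauss w x * expR (- (w k * s ^+ 2)) * expR (- (2 * w k * s * x 0 k)).
  rewrite /diag_gauss -!expRD (bigD1 k)// [in RHS](bigD1 k)//=; congr expR.
  rewrite !mxE !eqxx mulr1 (eq_bigr (fun i => w i * x 0 i ^+ 2)); last first.
    by move=> i /negbTE ik; rewrite !mxE ik mulr0 addr0.
  ring.
(* The second difference splits into a difference quotient of [exp] at [0], with increment of order
   [e n ^+ 2], and the square of one of [2 sinh]. The vanishing terms at [0] are written out to
   match [cvg_diffquot]. *)
have KE n : K n x = diag_gauss w x *
   ((expR (- (w k * e n ^+ 2)) - expR 0) / (e n ^+ 2) * (- (w k)^-1)
   - (expR (- (w k * e n ^+ 2))) / (2 * w k) * (((expR (w k * x 0 k * e n) -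
      expR (- (w k * x 0 k * e n))) - (expR (w k * x 0 k * 0) - expR (- (w k * x 0 k * 0))))
      / e n) ^+ 2).
  rewrite /K sh -scaleNr sh sqrrN mulr0 oppr0 expR0 subrr subr0.
  have -> : expR (- (2 * w k * - e n * x 0 k)) = expR (w k * x 0 k * e n) ^+ 2.
    by rewrite -expRM_natl; congr expR; ring.
  have -> : expR (- (2 * w k * e n * x 0 k)) = expR (- (w k * x 0 k * e n)) ^+ 2.
    by rewrite -expRM_natl; congr expR; ring.
  have : expR (w k * x 0 k * e n) * expR (- (w k * x 0 k * e n)) = 1.
    by rewrite -expRD subrr expR0.
  move: (expR (w k * x 0 k * e n)) (expR (- (w k * x 0 k * e n))) => A B AB.
  have AB2 : A ^+ 2 + B ^+ 2 = (A - B) ^+ 2 + 2.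
    have -> : (A - B) ^+ 2 = A ^+ 2 + B ^+ 2 - 2 * (A * B) by ring.
    by rewrite AB; ring.
  move: (expR _) (diag_gauss w x) => C G.
  have -> : 2 * G - G * C * A ^+ 2 - G * C * B ^+ 2 =
     2 * G - G * C * ((A - B) ^+ 2 + 2) by rewrite -AB2; ring.
  by field; rewrite ?e0 ?gt_eqF.
have cG (f : R -> R) (l : R) (v : nat -> R) : is_derive (0 : R) (1 : R) f l ->
  (forall n, v n != 0) -> v n @[n --> \oo] --> 0 ->
  ((f (v n) - f 0) / v n) @[n --> \oo] --> l by exact: cvg_diffquot.
rewrite (funext KE).
rewrite [X in _ --> X]mulrC; apply: cvgMl_tmp.
have ce2 : (e n ^+ 2) @[n --> \oo] --> 0.
  by rewrite -[X in _ --> X](mul0r 0); apply: cvgM.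
have c1 : ((expR (- (w k * e n ^+ 2)) - expR 0) / e n ^+ 2) @[n --> \oo] --> - w k.
  have := @cG (fun s => expR (- (w k * s))) (- w k) (fun n => e n ^+ 2).
  rewrite mulr0 oppr0; apply => //; last by move=> n; rewrite sqrf_eq0.
  by apply: is_derive_eq; rewrite mulr0 oppr0 expR0 /GRing.scale /= !mulr1 mul1r.
have c2 : ((expR (w k * x 0 k * e n) - expR (- (w k * x 0 k * e n)) -
     (expR (w k * x 0 k * 0) - expR (- (w k * x 0 k * 0)))) / e n)
     @[n --> \oo] --> 2 * (w k * x 0 k).
  have := @cG (fun s => expR (w k * x 0 k * s) - expR (- (w k * x 0 k * s)))
     (2 * (w k * x 0 k)) e.
  apply => //.
  by apply: is_derive_eq; rewrite mulr0 oppr0 expR0 /GRing.scale /= !mulr1 !mul1r; ring.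
have c3 : expR (- (w k * e n ^+ 2)) @[n --> \oo] --> (1 : R).
  rewrite -(expR0 R); apply: (@cvg_comp _ _ _ (fun n => - (w k * e n ^+ 2)) expR
    _ (nbhs (0 : R))); last exact: continuous_expR.
  rewrite -oppr0; apply: cvgN; rewrite -(mulr0 (w k)); exact: cvgMl_tmp.
rewrite (_ : 1 - _ = - w k * - (w k)^-1 - 1 / (2 * w k) * (2 * (w k * x 0 k)) ^+ 2); last first.
  by field; rewrite ?gt_eqF.
apply: cvgB; first exact: cvgMr_tmp.
apply: cvgM; first exact: cvgMr_tmp.
by rewrite expr2; apply: cvgM.
Qed.

End PositiveDefinite.

(** * Mixtures of Gaussians *)

Section GaussianMixtures.
Variables (R : realType) (m : nat).
Implicit Types (g h : 'rV[R]_m -> R).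

(* [h] is [- x . grad g]: recording it along the construction spares us from
   differentiating limits. *)
Inductive gmix : ('rV[R]_m -> R) -> ('rV[R]_m -> R) -> Prop :=
| gmix_gauss w : (forall k, 0 <= w k) ->
    gmix (diag_gauss w) (fun x => (\sum_k 2 * w k * x 0 k ^+ 2) * diag_gauss w x)
| gmixD g1 h1 g2 h2 : gmix g1 h1 -> gmix g2 h2 ->
    gmix (fun x => g1 x + g2 x) (fun x => h1 x + h2 x)
| gmixZ a g h : 0 <= a -> gmix g h -> gmix (fun x => a * g x) (fun x => a * h x)
| gmix_lim (g h : nat -> 'rV[R]_m -> R) g' h' : (forall n, gmix (g n) (h n)) ->
    (forall x, g n x @[n --> \oo] --> g' x) ->
    (forall x, h n x @[n --> \oo] --> h' x) -> gmix g' h'.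

(** [m g - h] stands for the divergence of [x g (x)]. For a Gaussian it is the sum over [k] of the
    functions of [diag_gauss_diff2_pos_def], and sums, multiples and limits preserve positive
    definiteness. Over a lattice it becomes the moment bound. *)
Lemma gmix_pos_def g h : gmix g h ->
  pos_def g /\ pos_def (fun x => m%:R * g x - h x).
Proof.
elim=> {g h}.
- move=> w w0; split; first exact: diag_gauss_pos_def.
  have := @psd_kernel_sum R _ _ (index_enum 'I_m) xpredT
    (fun k (x y : 'rV[R]_m) => (1 - 2 * w k * (x - y) 0 k ^+ 2) * diag_gauss w (x - y))
    (fun k _ => diag_gauss_diff2_pos_def k w0).
  move=> H I x c; have := H I x c; congr (_ <= _).
  apply: eq_bigr => i _; apply: eq_bigr => j _; congr (_ * _).
  rewrite -big_distrl /= -mulrBl; congr (_ * _).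
  by rewrite big_split /= sumrN sumr_const card_ord.
- move=> g1 h1 g2 h2 _ [p1 q1] _ [p2 q2]; split; first exact: psd_kernelD p1 p2.
  move=> I x c; have := psd_kernelD q1 q2 x c; congr (_ <= _).
  by apply: eq_bigr => i _; apply: eq_bigr => j _; congr (_ * _); ring.
- move=> a g h a0 _ [p q]; split; first exact: psd_kernelZ a0 p.
  move=> I x c; have := psd_kernelZ a0 q x c; congr (_ <= _).
  by apply: eq_bigr => i _; apply: eq_bigr => j _; congr (_ * _); ring.
- move=> g h g' h' _ IH cg ch; split.
    apply: (psd_kernel_lim (K := fun n (x y : 'rV[R]_m) => g n (x - y))) => //.
    by move=> n; case: (IH n).
  apply: (psd_kernel_lim (K := fun n (x y : 'rV[R]_m) =>
    m%:R * g n (x - y) - h n (x - y))).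
    by move=> x y; apply: cvgB => //; exact: cvgMl_tmp.
  by move=> n; case: (IH n).
Qed.

Lemma gmix_eq g h g' h' : gmix g h -> g =1 g' -> h =1 h' -> gmix g' h'.
Proof. by move=> H /funext <- /funext <-. Qed.

Lemma gmix1 : gmix (fun=> 1) (fun=> 0).
Proof.
apply: (gmix_eq (@gmix_gauss (fun=> 0) _)) => // x; rewrite /diag_gauss.
  by rewrite big1 ?oppr0 ?expR0// => i _; rewrite mul0r.
by rewrite big1 ?mul0r// => i _; rewrite mulr0 mul0r.
Qed.

Lemma gmix0 : gmix (fun=> 0) (fun=> 0).
Proof.
by apply: (gmix_eq (gmixZ (lexx 0) gmix1)) => x; rewrite mul0r.
Qed.

(** Product rule for the pairs [(g, h)], by a double induction: two Gaussians multiply by adding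
    their weights, and the other constructors are compatible with multiplication by a fixed
    factor. *)
Lemma gmixM g1 h1 g2 h2 : gmix g1 h1 -> gmix g2 h2 ->
  gmix (fun x => g1 x * g2 x) (fun x => g1 x * h2 x + h1 x * g2 x).
Proof.
move=> H1 H2; elim: H1 => {g1 h1}.
- move=> w w0; elim: H2 => {g2 h2}.
  + move=> v v0; apply: (gmix_eq (@gmix_gauss (fun k => w k + v k) _)).
    * by move=> k; rewrite addr_ge0.
    * move=> x; rewrite /diag_gauss -expRD -opprD -big_split /=; congr (expR (- _)).
      by apply: eq_bigr => k _; ring.
    * move=> x; have -> : diag_gauss (fun k => w k + v k) x = diag_gauss w x * diag_gauss v x.
        rewrite /diag_gauss -expRD -opprD -big_split /=; congr (expR (- _)).
        by apply: eq_bigr => k _; ring.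
      have -> : \sum_k 2 * (w k + v k) * x 0 k ^+ 2 =
          \sum_k 2 * w k * x 0 k ^+ 2 + \sum_k 2 * v k * x 0 k ^+ 2.
        by rewrite -big_split; apply: eq_bigr => k _ /=; ring.
      ring.
  + move=> g1 h1 g2 h2 _ I1 _ I2; apply: (gmix_eq (gmixD I1 I2)) => x; ring.
  + move=> a g h a0 _ I1; apply: (gmix_eq (gmixZ a0 I1)) => x; ring.
  + move=> g h g' h' _ IH cg ch; apply: (gmix_lim IH) => x.
      exact: cvgMl_tmp.
    by apply: cvgD; exact: cvgMl_tmp.
- move=> g3 h3 g4 h4 _ I1 _ I2; apply: (gmix_eq (gmixD I1 I2)) => x; ring.
- move=> a g h a0 _ I1; apply: (gmix_eq (gmixZ a0 I1)) => x; ring.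
- move=> g h g' h' _ IH cg ch; apply: (gmix_lim IH) => x.
    exact: cvgMr_tmp.
  by apply: cvgD; exact: cvgMr_tmp.
Qed.

Lemma gmix_sum (J : Type) (r : seq J) (g h : J -> 'rV[R]_m -> R) :
  (forall j, gmix (g j) (h j)) ->
  gmix (fun x => \sum_(j <- r) g j x) (fun x => \sum_(j <- r) h j x).
Proof.
move=> H; elim: r => [|j r IH].
  by apply: (gmix_eq gmix0) => x; rewrite big_nil.
by apply: (gmix_eq (gmixD (H j) IH)) => x; rewrite big_cons.
Qed.

Lemma gmixX g h k : gmix g h ->
  gmix (fun x => g x ^+ k.+1) (fun x => k.+1%:R * g x ^+ k * h x).
Proof.
move=> H; elim: k => [|k IH].
  by apply: (gmix_eq H) => x; rewrite ?expr1// expr0 !mul1r.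
apply: (gmix_eq (gmixM H IH)) => x; first by rewrite -exprS.
by rewrite exprS -[k.+2%:R]natr1; ring.
Qed.

(** The partial sums have [n + 1] terms for [g] and [n] for [h], since differentiating a truncated
    exponential series drops one term. *)
Lemma gmix_exp g h : gmix g h ->
  gmix (fun x => expR (g x)) (fun x => expR (g x) * h x).
Proof.
move=> H; pose S n x := \sum_(k < n) g x ^+ k / k`!%:R.
apply: (gmix_lim (g := fun n => S n.+1) (h := fun n x => S n x * h x)).
- move=> n; have fk k : 0 <= (k.+1`!%:R : R)^-1 by rewrite invr_ge0 ler0n.
  apply: (gmix_eq (gmixD gmix1 (gmix_sum (index_enum 'I_n)
    (fun k : 'I_n => gmixZ (fk k) (gmixX k H))))) => x.
    rewrite /S big_ord_recl expr0 fact0 divr1; congr (_ + _).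
    by apply: eq_bigr => k _; rewrite mulrC.
  rewrite add0r /S big_distrl; apply: eq_bigr => k _ /=.
  have k1 : (k.+1%:R : R) != 0 by rewrite pnatr_eq0.
  have k2 : (k`!%:R : R) != 0 by rewrite pnatr_eq0 -lt0n fact_gt0.
  rewrite factS natrM; move: k1 k2; move: (k.+1%:R : R) (k`!%:R : R) => a b a0 b0.
  by field; rewrite a0 b0.
- by move=> x; rewrite (@cvg_shiftS _ (fun n => S n x)); exact: cvg_expR_series.
- by move=> x; apply: cvgMr_tmp; exact: cvg_expR_series.
Qed.

End GaussianMixtures.

(** * The binomial series of (1 - z)^q *)

Section BinomialSeries.
Variables (R : realType) (q : R).
Hypotheses (q0 : 0 < q) (q1 : q <= 1).

(** The coefficient of [z^k] in [q (1 - z)^(q - 1)]; hence [binom_d k / (k + 1)] is that of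
    [z^(k + 1)] in [1 - (1 - z)^q]. For [0 < q <= 1] all of them are nonnegative, so that
    substituting a Gaussian for [z] yields a mixture. *)
Fixpoint binom_d (k : nat) : R :=
  if k is k'.+1 then binom_d k' * (1 - q / k'.+1%:R) else q.

Lemma binom_d_ge0_le1 k : 0 <= binom_d k <= 1.
Proof.
elim: k => [|k /andP[IH1 IH2]] /=; first by rewrite q1 ltW.
have h : 0 <= 1 - q / k.+1%:R <= 1.
  have k1 : 1 <= k.+1%:R :> R by rewrite ler1n.
  rewrite subr_ge0 ler_pdivrMr ?mul1r ?(lt_le_trans ltr01)// (le_trans q1)//=.
  by rewrite gerBl divr_ge0 ?(ltW q0)// (le_trans ler01).
by case/andP: h => h1 h2; rewrite mulr_ge0//=; exact: mulr_ile1.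
Qed.

Definition binom_S K (z : R) := \sum_(k < K) binom_d k / k.+1%:R * z ^+ k.+1.
Definition binom_D K (z : R) := \sum_(k < K) binom_d k * z ^+ k.

(** The function [y = (1 - z)^q] satisfies [q y + (1 - z) y' = 0]; the truncated series satisfies it
    up to the single term on the right. *)
Lemma binom_ode K z :
  q * (1 - binom_S K z) - (1 - z) * binom_D K z = binom_d K * z ^+ K.
Proof.
elim: K => [|K IH].
  by rewrite /binom_S /binom_D !big_ord0 subr0 mulr0 subr0.
rewrite /binom_S /binom_D !big_ord_recr -/(binom_S K z) -/(binom_D K z) /=.
have -> : q * (1 - (binom_S K z + binom_d K / K.+1%:R * z ^+ K.+1)) -
  (1 - z) * (binom_D K z + binom_d K * z ^+ K) =
  (q * (1 - binom_S K z) - (1 - z) * binom_D K z) -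
   (q * (binom_d K / K.+1%:R * z ^+ K.+1) + (1 - z) * (binom_d K * z ^+ K)) by ring.
have : (K.+1%:R : R) != 0 by rewrite pnatr_eq0.
by rewrite IH exprS; move: (K.+1%:R : R) => N N0; field.
Qed.

Lemma is_derive_binom_S K z : is_derive z (1 : R) (binom_S K) (binom_D K z).
Proof.
have -> : binom_S K = \sum_(k < K) (binom_d k / k.+1%:R \*: (@idfun R ^+ k.+1)).
  by apply/funext => x; rewrite /binom_S fct_sumE; apply: eq_bigr => k _; rewrite !fctE.
rewrite /binom_D; apply: is_derive_sum => k.
have := is_deriveZ (binom_d k / k.+1%:R) (is_deriveX k.+1 (is_derive_id z (1 : R))).
move=> /is_derive_eq; apply; rewrite /GRing.scale /= mulr1 mulrA.
by rewrite divfK// pnatr_eq0.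
Qed.

(** Variation of constants: the quotient of the truncated series by [(1 - z)^q] has as derivative
    the defect of [binom_ode] divided by [(1 - z)^(q + 1)], and the mean value theorem bounds its
    distance to [1]. *)
Lemma binom_S_err K z : 0 <= z < 1 ->
  `|(1 - binom_S K z) * expR (- q * ln (1 - z)) - 1| <=
  z ^+ K * expR (- (q + 1) * ln (1 - z)).
Proof.
case/andP => z0 z1.
pose G (x : R) : R := (1 - binom_S K x) * expR (- q * ln (1 - x)).
have G0 : G 0 = 1.
  rewrite /G /binom_S big1 => [|k _]; last by rewrite expr0n mulr0.
  by rewrite !subr0 ln1 mulr0 expR0 mulr1.
pose dG (x : R) : R := binom_d K * x ^+ K * expR (- (q + 1) * ln (1 - x)).
have dGP (x : R) : x < 1 -> is_derive x (1 : R) G (dG x).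
  move=> x1; have x1' : 0 < 1 - x by rewrite subr_gt0.
  have dS := is_derive_binom_S K x.
  have dl : is_derive x (1 : R) (fun x : R => ln (1 - x)) (- (1 - x)^-1).
    have d1 : is_derive (1 - x) (1 : R) (@ln R) (1 - x)^-1 by exact: is_derive1_ln.
    have d2 : is_derive x (1 : R) (fun x : R => 1 - x) (-1).
      by apply: is_derive_eq; rewrite add0r mul1r.
    have := @is_derive1_comp R (@ln R) (fun x : R => 1 - x) x _ _ d1 d2.
    by rewrite mulrN1.
  have dE : is_derive x (1 : R) (fun x : R => expR (- q * ln (1 - x)))
     (expR (- q * ln (1 - x)) * (q / (1 - x))).
    have d3 : is_derive x (1 : R) (fun x : R => - q * ln (1 - x)) (q / (1 - x)).
      by apply: is_derive_eq; rewrite /GRing.scale /= mulrNN.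
    exact: (@is_derive1_comp R expR (fun x : R => - q * ln (1 - x)) x _ _ _ d3).
  apply: is_derive_eq; rewrite /GRing.scale /= /dG.
  have -> : - (q + 1) * ln (1 - x) = - q * ln (1 - x) - ln (1 - x) by ring.
  rewrite expRB lnK ?posrE// -(binom_ode K x).
  by field; rewrite gt_eqF.
have [z0'|z0'] := eqVneq z 0.
  rewrite z0' -[X in `|X - 1|]/(G 0) G0 subrr normr0.
  by rewrite mulr_ge0 ?exprn_ge0 ?expR_ge0.
have zp : 0 < z by rewrite lt_def z0'.
have [||c] := @MVT R G dG 0 z zp.
- by move=> x; rewrite in_itv /= => /andP[_ xz]; apply: dGP; exact: lt_trans xz z1.
- apply: derivable_within_continuous => x; rewrite in_itv /= => /andP[_ xz].
  by case: (dGP x (le_lt_trans xz z1)).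
rewrite in_itv /= => /andP[c0 cz].
rewrite G0 -[X in `|X - 1|]/(G z) => ->.
have /andP[d0 d1] := binom_d_ge0_le1 K.
rewrite subr0 ger0_norm; last first.
  by rewrite !mulr_ge0 ?exprn_ge0 ?expR_ge0// ltW.
have cK : binom_d K * c ^+ K <= z ^+ K.
  rewrite -[leRHS]mul1r ler_pM ?exprn_ge0// ?(ltW c0)//.
  by rewrite lerXn2r ?nnegrE// ltW.
have l : expR (- (q + 1) * ln (1 - c)) <= expR (- (q + 1) * ln (1 - z)).
  rewrite ler_expR ler_nM2l ?oppr_lt0 ?addr_gt0//.
  rewrite ler_ln ?posrE ?subr_gt0// ?(lt_trans cz)//.
  by rewrite lerD2l lerN2 ltW.
rewrite -[leRHS]mulr1 /dG ler_pM ?mulr_ge0 ?exprn_ge0 ?expR_ge0// ?(ltW c0) ?(ltW z1)//.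
by rewrite ler_pM ?mulr_ge0 ?exprn_ge0 ?expR_ge0// ltW.
Qed.

Lemma cvg_binom_S z : 0 <= z < 1 ->
  (1 - binom_S K z) @[K --> \oo] --> (1 - z) `^ q.
Proof.
move=> zz; have /andP[z0 z1] := zz.
have zp : 0 < 1 - z by rewrite subr_gt0.
have -> : (1 - z) `^ q = 1 * expR (q * ln (1 - z)) by rewrite mul1r /powR gt_eqF.
set E := expR (q * ln (1 - z)).
have EE x : x = x * expR (- q * ln (1 - z)) * E.
  by rewrite -mulrA -expRD mulNr addNr expR0 mulr1.
rewrite (funext (fun K => EE (1 - binom_S K z))).
apply: cvgMr_tmp.
set C := expR (- (q + 1) * ln (1 - z)).
have c0 : (z ^+ K * C) @[K --> \oo] --> 0.
  by rewrite -(mul0r C); apply: cvgMr_tmp; apply: cvg_expr; rewrite ger0_norm.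
apply/cvgrPdist_le => e e0.
move/cvgrPdist_le : c0 => /(_ e e0); apply: filterS => K.
rewrite sub0r normrN; apply: le_trans.
rewrite distrC; apply: (le_trans (binom_S_err K zz)).
by rewrite ger0_norm// mulr_ge0 ?exprn_ge0 ?expR_ge0.
Qed.

(** The differential equation gives the limit of the derivative from that of the series, without a
    second error estimate. *)
Lemma cvg_binom_D z : 0 <= z < 1 ->
  (binom_D K z) @[K --> \oo] --> q * (1 - z) `^ q / (1 - z).
Proof.
move=> zz; have /andP[z0 z1] := zz.
have zp : 1 - z != 0 by rewrite gt_eqF// subr_gt0.
have E K : binom_D K z = (q * (1 - binom_S K z) - binom_d K * z ^+ K) / (1 - z).
  by rewrite -binom_ode; field.
rewrite (funext E); apply: cvgMr_tmp.
rewrite -[X in _ --> X]subr0; apply: cvgB; first by apply: cvgMl_tmp; exact: cvg_binom_S.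
have c0 : z ^+ K @[K --> \oo] --> 0 by apply: cvg_expr; rewrite ger0_norm.
apply: (squeeze_cvgr _ (cvg_cst 0) c0); apply: nearW => K.
have /andP[d0 d1] := binom_d_ge0_le1 K.
by rewrite mulr_ge0 ?exprn_ge0//= -[leRHS]mul1r ler_pM ?exprn_ge0.
Qed.

End BinomialSeries.

(** * The function exp (- |x|_p^p) as a limit of mixtures *)

Section SuperGaussianMixture.
Variables (R : realType) (p : R).
Hypotheses (p1 : 1 <= p) (p2 : p <= 2).

Local Notation q := (p / 2).
Let q0 : 0 < q. Proof. by move: p1 p2 => ? ?; lra. Qed.
Let q1 : q <= 1. Proof. by move: p1 p2 => ? ?; lra. Qed.

Lemma cvg_powR (u : nat -> R) (s : R) : 0 <= s -> (forall n, 0 < u n) ->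
  u n @[n --> \oo] --> s -> u n `^ q @[n --> \oo] --> s `^ q.
Proof.
rewrite le_eqVlt => /predU1P[<-|s0] u0 cu.
  have /cvg_at_rightP := powR_cvg0 q0.
  by rewrite powR0 ?gt_eqF//; apply; split.
apply: (@cvg_comp _ _ _ u (fun a => a `^ q) _ (nbhs s)) => //.
have /derivable1_diffP : derivable (fun a : R => a `^ q) s 1.
  by apply: derivable_powR; rewrite in_itv /= s0.
exact: differentiable_continuous.
Qed.

Variable m : nat.

Definition pnorm_pow (x : 'rV[R]_m) : R := \sum_(j < m) `|x 0 j| `^ p.

(** Subordination: [|s|^p = (s^2)^q] with [q = p / 2 <= 1]. For fixed [w], [s^2] is replaced by
    [u = (1 - Z) / w], where [Z] is a multiple of a Gaussian; [u^q] is a constant minus a power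
    series in [Z] with nonnegative coefficients, so that [exp (- u^q)] is a limit of mixtures. Then
    [w] tends to [0] and [u] to [s^2]. *)
Lemma pnorm_pow_gmix : gmix (fun x : 'rV[R]_m => expR (- pnorm_pow x))
  (fun x => p * pnorm_pow x * expR (- pnorm_pow x)).
Proof.
pose e : nat -> R := harmonic.
have e0 n : 0 < e n by exact: harmonic_gt0.
have ce : e n @[n --> \oo] --> 0 by exact: cvg_harmonic.
(* The second [w] in the exponent keeps [Z] below [1] and [u] positive even where the coordinate
   vanishes; the series is controlled for [z < 1] only. *)
pose Z w (x : 'rV[R]_m) (i : 'I_m) := expR (- (w * (x 0 i ^+ 2 + w))).
have Z01 w x i : 0 < w -> 0 <= Z w x i < 1.
  move=> w0; rewrite /Z expR_ge0/= expR_lt1 oppr_lt0 mulr_gt0//.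
  by rewrite ltr_wpDl// sqr_ge0.
have gZ w i : 0 < w ->
    gmix (fun x => Z w x i) (fun x => 2 * w * x 0 i ^+ 2 * Z w x i).
  move=> w0; pose v (k : 'I_m) : R := if k == i then w else 0.
  have v0 k : 0 <= v k by rewrite /v; case: ifP => // _; exact: ltW.
  have vx (x : 'rV[R]_m) : \sum_k v k * x 0 k ^+ 2 = w * x 0 i ^+ 2.
    rewrite (bigD1 i)//= /v eqxx big1 ?addr0// => k /negbTE ->.
    by rewrite mul0r.
  have dZ x : expR (- w ^+ 2) * diag_gauss v x = Z w x i.
    by rewrite /diag_gauss vx -expRD; congr expR; ring.
  apply: (gmix_eq (gmixZ (expR_ge0 (- w ^+ 2)) (gmix_gauss v0))) => x //.
  rewrite mulrCA dZ; congr (_ * _); rewrite -mulrA -vx big_distrr.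
  by apply: eq_bigr => k _; rewrite -mulrA.
have gS K w i : 0 < w -> gmix (fun x => binom_S q K (Z w x i))
    (fun x => binom_D q K (Z w x i) * (2 * w * x 0 i ^+ 2 * Z w x i)).
  move=> w0; have dk k : 0 <= binom_d q k / k.+1%:R.
    by have /andP[? _] := binom_d_ge0_le1 q0 q1 k; rewrite divr_ge0.
  apply: (gmix_eq (gmix_sum (index_enum 'I_K)
    (fun k : 'I_K => gmixZ (dk k) (gmixX k (gZ w i w0))))) => x //.
  rewrite /binom_D big_distrl; apply: eq_bigr => k _ /=.
  have : (k.+1%:R : R) != 0 by rewrite pnatr_eq0.
  by move: (k.+1%:R : R) => N N0; field.
pose c w : R := (w `^ q)^-1.
have c0 w : 0 <= c w by rewrite invr_ge0 powR_ge0.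
pose u w x i := (1 - Z w x i) / w.
have stage1 w : 0 < w -> gmix (fun x => expR (- \sum_i u w x i `^ q))
  (fun x => expR (- \sum_i u w x i `^ q) *
     \sum_i (2 * q * x 0 i ^+ 2 * Z w x i * (u w x i `^ q / u w x i))).
  move=> w0.
  have cu x i : c w * (1 - Z w x i) `^ q = u w x i `^ q.
    have /andP[z0 z1] := Z01 w x i w0.
    have -> : 1 - Z w x i = u w x i * w by rewrite /u divfK// gt_eqF.
    rewrite powRM ?(ltW w0)//; last by rewrite divr_ge0 ?(ltW w0)// subr_ge0 ltW.
    by rewrite /c mulrCA mulVf ?mulr1// gt_eqF// powR_gt0.
  (* [gmix_exp] exponentiates the mixture [c S] with a positive sign; the constant factor
     [exp (- m c)] restores the negative exponent [- c (1 - S)], summed over the coordinates. *)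
  have gK K := gmixZ (expR_ge0 (- (m%:R * c w))) (gmix_exp
    (gmixZ (c0 w) (gmix_sum (index_enum 'I_m) (fun i => gS K w i w0)))).
  have EK K x : expR (- (m%:R * c w)) * expR (c w * \sum_i binom_S q K (Z w x i)) =
      expR (- (c w * \sum_i (1 - binom_S q K (Z w x i)))).
    rewrite -expRD; congr expR; rewrite sumrB sumr_const card_ord; ring.
  have cE x : expR (- (c w * \sum_i (1 - binom_S q K (Z w x i)))) @[K --> \oo]
      --> expR (- \sum_i u w x i `^ q).
    apply: (@cvg_comp _ _ _ (fun K => - (c w * \sum_i (1 - binom_S q K (Z w x i))))
      expR _ (nbhs (- \sum_i u w x i `^ q))); last exact: continuous_expR.
    have -> : \sum_i u w x i `^ q = c w * \sum_i (1 - Z w x i) `^ q.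
      by rewrite big_distrr; apply: eq_bigr => i _; rewrite /= cu.
    apply: cvgN; apply: cvgMl_tmp; apply: cvg_sumr => i _.
    exact: (cvg_binom_S q0 q1 (Z01 w x i w0)).
  apply: (gmix_lim gK) => x; first by under eq_fun do rewrite EK; exact: cE.
  under eq_fun do rewrite mulrA EK.
  apply: cvgM; first exact: cE.
  have -> : \sum_i 2 * q * x 0 i ^+ 2 * Z w x i * (u w x i `^ q / u w x i) =
     c w * \sum_i (q * (1 - Z w x i) `^ q / (1 - Z w x i)) * (2 * w * x 0 i ^+ 2 * Z w x i).
    rewrite big_distrr; apply: eq_bigr => i _ /=.
    rewrite -cu /u; have /andP[z0 z1] := Z01 w x i w0.
    have zz : 1 - Z w x i != 0 by rewrite gt_eqF// subr_gt0.
    by field; rewrite zz gt_eqF.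
  apply: cvgMl_tmp; apply: cvg_sumr => i _; apply: cvgMr_tmp.
  exact: (cvg_binom_D q0 q1 (Z01 w x i w0)).
have cwx (x : 'rV[R]_m) i : (e n * (x 0 i ^+ 2 + e n)) @[n --> \oo] --> 0.
  rewrite -(mul0r (x 0 i ^+ 2 + 0)); apply: cvgM => //.
  by apply: cvgD => //; exact: cvg_cst.
have cZ x i : Z (e n) x i @[n --> \oo] --> (1 : R).
  rewrite -(expR0 R); apply: (@cvg_comp _ _ _ (fun n => - (e n * (x 0 i ^+ 2 + e n)))
    expR _ (nbhs (0 : R))); last exact: continuous_expR.
  by have H := cvgN (cwx x i); rewrite oppr0 in H; exact: H.
have cu x i : u (e n) x i @[n --> \oo] --> x 0 i ^+ 2.
  have xp n : 0 < x 0 i ^+ 2 + e n by rewrite ltr_wpDl// sqr_ge0.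
  have dE : is_derive (0 : R) (1 : R) (fun t : R => expR (- t)) (-1).
    by apply: is_derive_eq; rewrite oppr0 expR0 mul1r.
  have := @cvg_diffquot _ _ _ (fun n => e n * (x 0 i ^+ 2 + e n)) dE.
  rewrite oppr0 expR0 => /(_ _ (cwx x i)) H.
  have {}H : ((expR (- (e n * (x 0 i ^+ 2 + e n))) - 1) / (e n * (x 0 i ^+ 2 + e n)))
     @[n --> \oo] --> (-1 : R) by apply: H => n; rewrite gt_eqF// mulr_gt0.
  have -> : (fun n => u (e n) x i) = (fun n =>
     (expR (- (e n * (x 0 i ^+ 2 + e n))) - 1) / (e n * (x 0 i ^+ 2 + e n)) *
     - (x 0 i ^+ 2 + e n)).
    apply/funext => n; rewrite /u /Z.
    have := xp n; have := e0 n.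
    move: (expR (- (e n * (x 0 i ^+ 2 + e n)))) => E; move: (e n) (x 0 i ^+ 2) => a b h1 h2.
    by field; rewrite !gt_eqF.
  rewrite [X in _ --> X](_ : _ = (-1) * (- (x 0 i ^+ 2 + 0))); last by ring.
  apply: cvgM => //; apply: cvgN; apply: cvgD => //.
  exact: cvg_cst.
have u0 n x i : 0 < u (e n) x i.
  by have /andP[_ z1] := Z01 (e n) x i (e0 n); rewrite divr_gt0// subr_gt0.
have cuq x i : u (e n) x i `^ q @[n --> \oo] --> `|x 0 i| `^ p.
  have -> : `|x 0 i| `^ p = (x 0 i ^+ 2) `^ q.
    rewrite -[x 0 i ^+ 2]ger0_norm ?sqr_ge0// normrX -powR_mulrn// -powRrM.
    by congr powR; field.
  by apply: cvg_powR => //; exact: sqr_ge0.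
have cE x : expR (- \sum_i u (e n) x i `^ q) @[n --> \oo] --> expR (- pnorm_pow x).
  apply: (@cvg_comp _ _ _ (fun n => - \sum_i u (e n) x i `^ q)
    expR _ (nbhs (- pnorm_pow x))); last exact: continuous_expR.
  by apply: cvgN; apply: cvg_sumr => i _.
apply: (gmix_lim (fun n => stage1 (e n) (e0 n))) => x //.
rewrite [X in _ --> X]mulrC; apply: cvgM => //.
rewrite /pnorm_pow big_distrr; apply: cvg_sumr => i _ /=.
(* At a zero coordinate [u] tends to [0] and the limit of [u^q / u] cannot be taken termwise; the
   factor [x 0 i ^+ 2] makes the whole term zero there. *)
have [x0|x0] := eqVneq (x 0 i) 0.
  rewrite x0 normr0 powR0 ?mulr0; last by rewrite gt_eqF// (lt_le_trans ltr01).
  under eq_fun do rewrite expr0n mulr0 !mul0r; exact: cvg_cst.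
have x20 : x 0 i ^+ 2 != 0 by rewrite sqrf_eq0.
have -> : p * `|x 0 i| `^ p = 2 * q * x 0 i ^+ 2 * 1 * (`|x 0 i| `^ p / x 0 i ^+ 2).
  by field.
apply: cvgM; first by apply: cvgMl_tmp.
by apply: cvgM => //; apply: cvgV.
Qed.

End SuperGaussianMixture.

(** * Sums over a lattice *)

Section EsumSeq.
Variables (R : realType) (T : choiceType).
Implicit Types (D : set T) (a : T -> R) (s : seq T).

Lemma le_esum_seq D a (M : \bar R) : 
  (forall s, uniq s -> (forall x, x \in s -> D x) -> (\sum_(x <- s) a x)%:E <= M)%E ->
  (\esum_(x in D) (a x)%:E <= M)%E.
Proof.
move=> h; apply: ge_ereal_sup => _ [A [fA AD] <-].
rewrite fsbig_finite//= sumEFin; apply: h; first exact: finmap.fset_uniq.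
by move=> x; rewrite in_fset_set// inE; exact: AD.
Qed.

Lemma seq_le_esum D a s : uniq s -> (forall x, x \in s -> D x) ->
  ((\sum_(x <- s) a x)%:E <= \esum_(x in D) (a x)%:E)%E.
Proof.
move=> us sD; apply: esum_ge; exists [set` s]; first by split => // x /= /sD.
rewrite fsbig_finite//= sumEFin lee_fin le_eqVlt; apply/orP; left; apply/eqP.
apply: perm_big; apply: uniq_perm => //.
by move=> x; rewrite in_fset_set//; apply/idP/idP => [?|]; rewrite inE.
Qed.

Lemma sum_inj_le (I : finType) (phi : T -> I) (b : I -> R) s : uniq s ->
  {in s &, injective phi} -> (forall i, 0 <= b i) ->
  \sum_(x <- s) b (phi x) <= \sum_i b i.
Proof.
move=> us inj b0; rewrite -(big_map phi xpredT b) big_uniq ?map_inj_in_uniq//=.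
by rewrite [leRHS](bigID (mem (map phi s)))/= lerDl sumr_ge0.
Qed.

End EsumSeq.

Lemma sum_injT_le (R : realType) (W I : finType) (phi : W -> I) (b : I -> R) :
  injective phi -> (forall i, 0 <= b i) -> \sum_w b (phi w) <= \sum_i b i.
Proof.
move=> inj b0; rewrite -[leLHS]big_enum /=.
by apply: sum_inj_le => //; [exact: enum_uniq | move=> ? ? _ _; exact: inj].
Qed.

Section Folner.
Variables (R : realType) (n : nat).
Implicit Types (g h : 'rV[int]_n -> R).

Let box N (i : {ffun 'I_n -> 'I_N}) : 'rV[int]_n := \row_k (i k)%:Z.

Let box_inj N : injective (@box N).
Proof.
move=> i j /rowP ij; apply/ffunP => k; apply/val_inj.
by have := ij k; rewrite !mxE => -[].
Qed.

(* Averaging over a box whose side is large with respect to the support. *)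
Lemma folner_le g h : (forall z, 0 <= g z) -> (forall z, 0 <= h z) ->
  (forall (I : finType) (x : I -> 'rV[int]_n),
    \sum_i \sum_j h (x i - x j) <= \sum_i \sum_j g (x i - x j)) ->
  (\esum_(z in [set: 'rV[int]_n]) (h z)%:E <=
   \esum_(z in [set: 'rV[int]_n]) (g z)%:E)%E.
Proof.
move=> g0 h0 hg; set G := (X in (_ <= X)%E).
have [->|] := eqVneq G +oo%E; first exact: leey.
have G0 : (0 <= G)%E by apply: esum_ge0 => z _; rewrite lee_fin.
have sG s : uniq s -> ((\sum_(z <- s) g z)%:E <= G)%E.
  by move=> us; apply: seq_le_esum.
case: G G0 sG => // G G0 sG _.
apply: le_esum_seq => s us _; rewrite lee_fin.
pose K := (\max_(z <- s) \max_(k < n) `|z ord0 k|%N).+1.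
have zK z k : z \in s -> (`|z ord0 k| < K)%N.
  move=> zs; rewrite ltnS; apply: (@leq_trans (\max_(k < n) `|z ord0 k|%N)).
    exact: (@leq_bigmax _ (fun k => `|z ord0 k|%N) k).
  exact: (@leq_bigmax_seq _ s xpredT (fun z => \max_(k < n) `|z ord0 k|%N) z zs).
set S := \sum_(z <- s) h z.
have sumc (M : nat) (c : R) : c * M%:R ^+ n = \sum_(i : {ffun 'I_n -> 'I_M}) c.
  by rewrite sumr_const card_ffun !card_ord -natrX mulr_natr.
(* A box of side [L + 2 K] contains, around each of its [L^n] inner points, the translates by all
   [z] in [s]. Each inner point thus contributes at least [S] to the double sum of [h], and each of
   the [(L + 2 K)^n] points at most [G] to that of [g]. *)
have key L : S * (L%:R) ^+ n <= G * ((L + K + K)%:R) ^+ n.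
  pose N := (L + K + K)%N.
  have upper : \sum_(i : {ffun 'I_n -> 'I_N}) \sum_(j : {ffun 'I_n -> 'I_N}) g (box i - box j) <= G * N%:R ^+ n.
    rewrite sumc; apply: ler_sum => i _.
    rewrite -big_enum -(big_map (fun j => box i - box j) xpredT g) -lee_fin.
    apply: sG => //; rewrite map_inj_uniq ?enum_uniq// => j j'.
    by move=> /addrI /oppr_inj /box_inj.
  apply: le_trans upper; apply: le_trans (hg _ _).
  rewrite sumc [leRHS]exchange_big /=.
  have jP (w : {ffun 'I_n -> 'I_L}) k : (w k + K < N)%N.
    by rewrite /N ltn_add2r ltn_addr// ltn_ord.
  pose J (w : {ffun 'I_n -> 'I_L}) : {ffun 'I_n -> 'I_N} := [ffun k => Ordinal (jP w k)].
  have J_inj : injective J.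
    move=> w w' /ffunP E; apply/ffunP => k; apply: val_inj.
    by have := E k; rewrite !ffunE => /(congr1 val) /= /addIn.
  apply: (@le_trans _ _ (\sum_(w : {ffun 'I_n -> 'I_L}) \sum_i h (box i - box (J w)))); last first.
    by apply: (sum_injT_le (b := fun j => \sum_i h (box i - box j)) J_inj) => j; rewrite sumr_ge0.
  apply: ler_sum => w _; rewrite /S.
  have N0 : (0 < N)%N by rewrite /N addnS.
  pose phi (z : 'rV[int]_n) : {ffun 'I_n -> 'I_N} :=
    [ffun k => insubd (Ordinal N0) `|((w k + K)%N%:Z + z ord0 k)%R|%N].
  have phiE z : z \in s -> box (phi z) - box (J w) = z.
    move=> zs; apply/rowP => k; rewrite !mxE !ffunE /= insubdK.
      by have := zK z k zs; rewrite (ord1 ord0); move: (z 0 k) => y; lia.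
    suff : (`|((w k + K)%N%:Z + z ord0 k)%R| < N)%N by [].
    by have := zK z k zs; have := ltn_ord (w k); rewrite /N; move: (z ord0 k) => y; lia.
  rewrite (eq_big_seq (fun z => h (box (phi z) - box (J w)))); last first.
    by move=> z zs; rewrite phiE.
  apply: (sum_inj_le (phi := phi) (b := fun i => h (box i - box (J w)))) => //.
  by move=> z z' zs zs' E; rewrite -(phiE z)// -(phiE z')// E.
have cvg1 : (S * (1 - harmonic k) ^+ n) @[k --> \oo] --> S * (1 - 0) ^+ n.
  apply: cvgMl_tmp; apply: (@cvg_comp _ _ _ (fun k => 1 - harmonic k)
    (fun x : R => x ^+ n) _ (nbhs (1 - 0 : R))); last exact: exprn_continuous.
  by apply: cvgB; [exact: cvg_cst | exact: cvg_harmonic].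
rewrite subr0 expr1n mulr1 in cvg1.
apply: (cvgr_to_le cvg1); apply: nearW => k.
(* For [L = 2 K k] the ratio of the two sides is [k / (k + 1)]. *)
have := key (2 * K * k)%N.
have -> : (2 * K * k + K + K)%N = (2 * K * k.+1)%N by lia.
rewrite !natrM !exprMn; set A := (_ ^+ n * _ ^+ n : R).
have A0 : 0 < A by rewrite mulr_gt0// exprn_gt0// ltr0n.
rewrite mulrCA [leRHS]mulrCA (ler_pM2l A0) => h1.
have k1 : 0 < (k.+1%:R : R) by rewrite ltr0n.
rewrite -(ler_pM2r (exprn_gt0 n k1)) -mulrA -exprMn.
have -> : (1 - harmonic k) * k.+1%:R = k%:R :> R.
  rewrite mulrBl mul1r mulVf ?gt_eqF// -natr1; ring.
exact: h1.
Qed.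

End Folner.

(** [pos_def_diff] with all weights equal to [1]; by evenness the sums shifted by [u] and by [- u]
    coincide. *)
Lemma pos_def_shift_sum_le (R : realType) m (g : 'rV[R]_m -> R) (u : 'rV[R]_m) :
  pos_def g -> (forall v, g (- v) = g v) -> forall (I : finType) (x : I -> 'rV[R]_m),
  \sum_i \sum_j g (x i - x j + u) <= \sum_i \sum_j g (x i - x j).
Proof.
move=> pd even I x; have := pos_def_diff u pd x (fun=> 1).
have SE : \sum_i \sum_j g (x i - x j - u) = \sum_i \sum_j g (x i - x j + u).
  rewrite exchange_big; apply: eq_bigr => i _; apply: eq_bigr => j _.
  by rewrite -even !opprD !opprK (addrC (- x j)).
have -> : \sum_i \sum_j 1 * 1 * (2 * g (x i - x j) - g (x i - x j - u) - g (x i - x j + u)) =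
  2 * (\sum_i \sum_j g (x i - x j)) - \sum_i \sum_j g (x i - x j - u)
   - \sum_i \sum_j g (x i - x j + u).
  rewrite big_distrr /= -!sumrB; apply: eq_bigr => i _.
  by rewrite big_distrr /= -!sumrB; apply: eq_bigr => j _; rewrite !mul1r.
rewrite SE; move: (\sum_i _) (\sum_i _) => a b; lra.
Qed.

Section LatticeTheta.
Variables (R : realType) (p : R).
Hypotheses (p1 : 1 <= p) (p2 : p <= 2).

Let p0 : 0 < p. Proof. exact: lt_le_trans p1. Qed.

Lemma pnorm_pow_ge0 m (x : 'rV[R]_m) : 0 <= pnorm_pow p x.
Proof. by rewrite sumr_ge0// => j _; exact: powR_ge0. Qed.

Lemma pnorm_powN m (x : 'rV[R]_m) : pnorm_pow p (- x) = pnorm_pow p x.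
Proof. by apply: eq_bigr => j _; rewrite mxE normrN. Qed.

Lemma pnorm_powZ m (a : R) (x : 'rV[R]_m) : 0 <= a ->
  pnorm_pow p (a *: x) = a `^ p * pnorm_pow p x.
Proof.
move=> a0; rewrite /pnorm_pow big_distrr; apply: eq_bigr => j _ /=.
by rewrite mxE normrM ger0_norm// powRM.
Qed.

Section FixedBasis.
Variables (n m : nat) (B : 'M[R]_(n, m)).
Implicit Type z : 'rV[int]_n.

(** Lattice sums are indexed by coefficient vectors, so that they can be averaged over boxes of
    [Z^n]. *)
Definition lat_pt z : 'rV[R]_m := map_mx intr z *m B.

Lemma lat_ptB z z' : lat_pt (z - z') = lat_pt z - lat_pt z'.
Proof. by rewrite /lat_pt map_mxB mulmxBl. Qed.

Lemma lat_ptD z z' : lat_pt (z + z') = lat_pt z + lat_pt z'.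
Proof. by rewrite /lat_pt map_mxD mulmxDl. Qed.

Lemma theta_shift_le (u : 'rV[R]_m) :
  (\esum_(z in [set: 'rV[int]_n]) (expR (- pnorm_pow p (lat_pt z + u)))%:E <=
   \esum_(z in [set: 'rV[int]_n]) (expR (- pnorm_pow p (lat_pt z)))%:E)%E.
Proof.
apply: folner_le => [z|z|I x]; [exact: expR_ge0 | exact: expR_ge0 |].
have [pd _] := gmix_pos_def (pnorm_pow_gmix p1 p2 m).
have even (v : 'rV[R]_m) : expR (- pnorm_pow p (- v)) = expR (- pnorm_pow p v).
  by rewrite pnorm_powN.
have eqle (a b : R) : a = b -> a <= b by move=> ->.
have E v : \sum_i \sum_j expR (- pnorm_pow p (lat_pt (x i - x j) + v)) =
    \sum_i \sum_j expR (- pnorm_pow p (lat_pt (x i) - lat_pt (x j) + v)).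
  by apply: eq_bigr => i _; apply: eq_bigr => j _; rewrite lat_ptB.
have E0 : \sum_i \sum_j expR (- pnorm_pow p (lat_pt (x i) - lat_pt (x j))) =
    \sum_i \sum_j expR (- pnorm_pow p (lat_pt (x i - x j))).
  by apply: eq_bigr => i _; apply: eq_bigr => j _; rewrite lat_ptB.
apply: le_trans (eqle _ _ (E u)) _; apply: (le_trans _ (eqle _ _ E0)).
exact: (pos_def_shift_sum_le u pd even (fun i => lat_pt (x i))).
Qed.

Lemma theta_moment_le :
  (\esum_(z in [set: 'rV[int]_n])
     (p * pnorm_pow p (lat_pt z) * expR (- pnorm_pow p (lat_pt z)))%:E <=
   \esum_(z in [set: 'rV[int]_n]) (m%:R * expR (- pnorm_pow p (lat_pt z)))%:E)%E.
Proof.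
apply: folner_le => [z|z|I x].
- by rewrite mulr_ge0 ?expR_ge0.
- by rewrite !mulr_ge0 ?expR_ge0 ?pnorm_pow_ge0 ?(ltW p0).
have [_ pd] := gmix_pos_def (pnorm_pow_gmix p1 p2 m).
have eqle (a b : R) : a = b -> a <= b by move=> ->.
have E1 : \sum_i \sum_j m%:R * expR (- pnorm_pow p (lat_pt (x i - x j))) -
  \sum_i \sum_j p * pnorm_pow p (lat_pt (x i - x j)) *
     expR (- pnorm_pow p (lat_pt (x i - x j))) =
  \sum_i \sum_j 1 * 1 * (m%:R * expR (- pnorm_pow p (lat_pt (x i) - lat_pt (x j))) -
    p * pnorm_pow p (lat_pt (x i) - lat_pt (x j)) *
     expR (- pnorm_pow p (lat_pt (x i) - lat_pt (x j)))).
  rewrite -sumrB; apply: eq_bigr => i _.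
  by rewrite -sumrB; apply: eq_bigr => j _; rewrite !mul1r lat_ptB.
rewrite -subr_ge0; apply: (le_trans _ (eqle _ _ (esym E1))).
exact: (pd I (fun i => lat_pt (x i)) (fun=> 1)).
Qed.

End FixedBasis.

Lemma lat_ptZ n m (B : 'M[R]_(n, m)) a z : lat_pt (a *: B) z = a *: lat_pt B z.
Proof. by rewrite /lat_pt -scalemxAr. Qed.

Lemma int_geometric_le (c : R) (s : seq int) : 0 < c -> uniq s ->
  \sum_(k <- s) expR (- (c * `|k|%:~R)) <= 2 / (1 - expR (- c)).
Proof.
move=> c0 us; pose r := expR (- c).
have r1 : r < 1 by rewrite /r expR_lt1 oppr_lt0.
have r0 : 0 <= r by exact: expR_ge0.
pose N := (\max_(k <- s) `|k|%N).+1.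
have kN k : k \in s -> (`|k|%N < N)%N.
  by move=> ks; rewrite ltnS; exact: (@leq_bigmax_seq _ s xpredT absz k ks).
pose phi (k : int) : (bool * 'I_N)%type := (k < 0, inord `|k|%N).
have E k : k \in s -> expR (- (c * `|k|%:~R)) = r ^+ (phi k).2.
  move=> ks; rewrite /phi /= inordK ?kN// /r -expRM_natl; congr expR.
  by rewrite -abszE -pmulrn mulrN mulrC.
rewrite (eq_big_seq _ E); apply: le_trans (@sum_inj_le R _ _ phi (fun i => r ^+ i.2) s us _ _) _.
- move=> k k' ks ks' [] e /(congr1 val) /=; rewrite !inordK ?kN//; move: e; clear; lia.
- by move=> i; exact: exprn_ge0.
rewrite -(pair_bigA _ (fun (_ : bool) (j : 'I_N) => r ^+ j))/= sumr_const card_bool.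
have r1' : 0 < 1 - r by rewrite subr_gt0.
rewrite -[leLHS]mulr_natl ler_pM2l// -[leRHS]mul1r ler_pdivlMr// mulrC -opprB mulNr -subrX1.
by rewrite opprB gerBl exprn_ge0.
Qed.

(** The pseudo-inverse bounds the coordinates of [z] linearly by those of the lattice point, and
    [|y| <= 1 + |y|^p]. Hence the sum is dominated by [e^m] times a product of [n] geometric series
    in the [|z_i|]. *)
Lemma theta_summable n m (B : 'M[R]_(n, m)) : row_free B ->
  (\esum_(z in [set: 'rV[int]_n]) (expR (- pnorm_pow p (lat_pt B z)))%:E < +oo)%E.
Proof.
move=> fB; pose P := pinvmx B.
pose K : R := 1 + \sum_j \sum_i `|P j i|.
have S0 : 0 <= \sum_j \sum_i `|P j i| by rewrite sumr_ge0// => j _; rewrite sumr_ge0.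
have K0 : 0 < K by rewrite ltr_pwDl.
pose c : R := (n.+1%:R * K)^-1.
have n0 : 0 < n.+1%:R :> R by rewrite ltr0n.
have c0 : 0 < c by rewrite invr_gt0 mulr_gt0.
have zX (z : 'rV[int]_n) : c * (\sum_i `|z ord0 i|%:~R) - m%:R <= pnorm_pow p (lat_pt B z).
  have zi i : `|z ord0 i|%:~R <= K * (m%:R + pnorm_pow p (lat_pt B z)).
    have -> : (`|z ord0 i|%:~R : R) = `|\sum_j lat_pt B z ord0 j * P j i|.
      have : map_mx intr z = lat_pt B z *m P :> 'rV[R]_n.
        by rewrite /lat_pt /P mulmxKp.
      by move=> /rowP/(_ i); rewrite !mxE intr_norm => ->.
    apply: (le_trans (ler_norm_sum _ _ _)).
    have -> : m%:R + pnorm_pow p (lat_pt B z) = \sum_(j < m) (1 + `|lat_pt B z ord0 j| `^ p).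
      by rewrite big_split /= sumr_const card_ord.
    rewrite big_distrr; apply: ler_sum => j _ /=.
    rewrite normrM mulrC ler_pM//.
      rewrite /K (bigD1 j)//= (bigD1 i)//= ler_wpDl// -addrA lerDl addr_ge0//.
        by rewrite sumr_ge0.
      by rewrite sumr_ge0// => ? _; rewrite sumr_ge0.
    have [y1|y1] := leP `|lat_pt B z ord0 j| 1; first by rewrite ler_wpDr ?powR_ge0.
    by rewrite ler_wpDl// le1r_powR// ltW.
  have : \sum_i `|z ord0 i|%:~R <= n.+1%:R * (K * (m%:R + pnorm_pow p (lat_pt B z))).
    apply: (@le_trans _ _ (\sum_(i < n) K * (m%:R + pnorm_pow p (lat_pt B z)))).
      exact: ler_sum.
    rewrite sumr_const card_ord -[leLHS]mulr_natl ler_wpM2r// ?ler_nat//.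
    by rewrite mulr_ge0 ?(ltW K0)// addr_ge0// pnorm_pow_ge0.
  rewrite mulrA -ler_pdivrMl ?mulr_gt0// -/c lerBlDl; exact.
pose U : R := expR m%:R * (2 / (1 - expR (- c))) ^+ n.
apply: (@le_lt_trans _ _ U%:E); last exact: ltry.
apply: le_esum_seq => s us _; rewrite lee_fin.
have [N [Np zN]] : exists N, (0 < N)%N /\ forall z k, z \in s -> (`|z ord0 k| < N)%N.
  exists (\max_(z <- s) \max_(k < n) `|z ord0 k|%N).+1; split=> // z k zs.
  rewrite ltnS; apply: (@leq_trans (\max_(k < n) `|z ord0 k|%N)).
    exact: (@leq_bigmax _ (fun k => `|z ord0 k|%N) k).
  exact: (@leq_bigmax_seq _ s xpredT (fun z => \max_(k < n) `|z ord0 k|%N) z zs).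
pose b (w : {ffun 'I_n -> 'I_(N + N)}) : R :=
  \prod_i expR (- (c * `|(w i)%:Z - N%:Z|%:~R)).
have N0 : (0 < N + N)%N by rewrite addn_gt0 Np.
pose phi (z : 'rV[int]_n) : {ffun 'I_n -> 'I_(N + N)} :=
  [ffun k => insubd (Ordinal N0) `|(N%:Z + z ord0 k)%R|%N].
have phiE z k : z \in s -> ((phi z k : nat)%:Z - N%:Z)%R = z ord0 k.
  move=> zs; rewrite ffunE /= insubdK; first by move: (zN z k zs); move: (z ord0 k) => y; clear; lia.
  suff : (`|(N%:Z + z ord0 k)%R|%N < N + N)%N by [].
  by move: (zN z k zs); move: (z ord0 k) => y; clear; lia.
apply: (@le_trans _ _ (\sum_(z <- s) expR m%:R * b (phi z))).
  rewrite big_seq [leRHS]big_seq; apply: ler_sum => z zs.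
  rewrite /b -expR_sum -expRD ler_expR.
  rewrite (eq_bigr (fun i => - (c * `|z ord0 i|%:~R))); last by move=> i _; rewrite phiE.
  by rewrite sumrN -big_distrr /= lerNl opprD opprK addrC; exact: zX.
rewrite -big_distrr/= /U ler_wpM2l ?expR_ge0//.
apply: le_trans (sum_inj_le us _ _) _.
- move=> z z' zs zs' E; apply/rowP => k; have := phiE z k zs.
  by rewrite E phiE// (ord1 ord0) => ->.
- by move=> w; rewrite prodr_ge0// => i _; exact: expR_ge0.
rewrite /b -(bigA_distr_bigA (fun (_ : 'I_n) (j : 'I_(N + N)) =>
  expR (- (c * `|j%:Z - N%:Z|%:~R)))) /=.
rewrite prodr_const card_ord lerXn2r ?nnegrE//.
- by rewrite sumr_ge0// => j _; exact: expR_ge0.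
- by rewrite divr_ge0// subr_ge0 ltW// expR_lt1 oppr_lt0.
rewrite -(big_mkord xpredT (fun j => expR (- (c * `|j%:Z - N%:Z|%:~R)))).
rewrite -(big_map (fun j => j%:Z - N%:Z) xpredT (fun k => expR (- (c * `|k|%:~R)))).
apply: int_geometric_le => //; rewrite map_inj_uniq ?iota_uniq//.
by move=> j j' /addIr [].
Qed.

End LatticeTheta.

(** * Clarkson's inequality for 1 <= p <= 2 *)

Section Clarkson.
Variable R : realType.
Implicit Types (x u v a b q p : R).

(** Tangent at [1] of the concave power. It is the average, with weights [q] and [1 - q], of two
    instances of [1 + y <= exp y], at [(1 - q) ln x] and at [- q ln x]. *)
Lemma powR_le_affine x q : 0 <= x -> 0 < q -> q <= 1 -> x `^ q <= q * x + (1 - q).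
Proof.
move=> x0 q0 q1; move: x0; rewrite le_eqVlt => /predU1P[<-|x0].
  by rewrite powR0 ?gt_eqF// mulr0 add0r subr_ge0.
rewrite /powR gt_eqF//; set l := ln x.
have -> : x = expR l by rewrite lnK.
set E := expR (q * l).
have h1 : E * (1 + (1 - q) * l) <= expR l.
  have -> : expR l = E * expR ((1 - q) * l) by rewrite -expRD; congr expR; ring.
  by rewrite ler_wpM2l ?expR_ge0// expR_ge1Dx.
have h2 : E * (1 - q * l) <= 1.
  have e1 : E * expR (- (q * l)) = 1 by rewrite -expRD subrr expR0.
  by rewrite -[leRHS]e1 ler_wpM2l ?expR_ge0// expR_ge1Dx.
have -> : E = q * (E * (1 + (1 - q) * l)) + (1 - q) * (E * (1 - q * l)) by ring.
have q2 : 0 <= 1 - q by rewrite subr_ge0.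
apply: lerD; first by rewrite ler_wpM2l// ltW.
by rewrite -[leRHS]mulr1 ler_wpM2l.
Qed.

Lemma powR_midpoint u v q : 0 <= u -> 0 <= v -> 0 < q -> q <= 1 ->
  u `^ q + v `^ q <= 2 * ((u + v) / 2) `^ q.
Proof.
move=> u0 v0 q0 q1; have [w0|w0] := eqVneq (u + v) 0.
  move/eqP: w0; rewrite paddr_eq0// => /andP[/eqP-> /eqP->].
  by rewrite addr0 mul0r powR0 ?gt_eqF// mulr0 addr0.
have w1 : 0 < (u + v) / 2 by rewrite divr_gt0// lt_def w0 addr_ge0.
have uv : u + v = 2 * ((u + v) / 2) by field.
move: ((u + v) / 2) w1 uv => w wp uv.
have E y : 0 <= y -> y `^ q = (y / w) `^ q * w `^ q.
  by move=> y0; rewrite -powRM ?divr_ge0 ?(ltW wp)// divfK// gt_eqF.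
rewrite (E u)// (E v)// -mulrDl ler_wpM2r ?powR_ge0//.
apply: (le_trans (lerD (powR_le_affine _ q0 q1) (powR_le_affine _ q0 q1))).
- by rewrite divr_ge0// ltW.
- by rewrite divr_ge0// ltW.
rewrite addrACA -mulrDr -mulrDl uv mulfK ?gt_eqF//; lra.
Qed.

Lemma powR_subadd u v q : 0 <= u -> 0 <= v -> 0 < q -> q <= 1 ->
  (u + v) `^ q <= u `^ q + v `^ q.
Proof.
move=> u0 v0 q0 q1; have [w0|w0] := eqVneq (u + v) 0.
  by rewrite w0 powR0 ?gt_eqF// addr_ge0// powR_ge0.
have wp : 0 < u + v by rewrite lt_def w0 addr_ge0.
have E y : 0 <= y -> y <= u + v -> y / (u + v) * (u + v) `^ q <= y `^ q.
  move=> y0 yw; have -> : y `^ q = (y / (u + v)) `^ q * (u + v) `^ q.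
    by rewrite -powRM ?divr_ge0 ?(ltW wp)// divfK.
  rewrite ler_wpM2r ?powR_ge0//; move: y0; rewrite le_eqVlt => /predU1P[<-|y0].
    by rewrite mul0r powR_ge0.
  by rewrite ger1_powR// divr_gt0//= ler_pdivrMr// mul1r.
have -> : (u + v) `^ q = u / (u + v) * (u + v) `^ q + v / (u + v) * (u + v) `^ q.
  by rewrite -mulrDl -mulrDl mulfV// mul1r.
by rewrite lerD// E// ?lerDl ?lerDr.
Qed.

(** With [q = p / 2] and squares as arguments: concavity of the power, the parallelogram law, then
    subadditivity of the power. *)
Lemma clarkson a b p : 1 <= p -> p <= 2 ->
  `|a + b| `^ p + `|a - b| `^ p <= 2 * (`|a| `^ p + `|b| `^ p).
Proof.
move=> p1 p2; have E x : `|x| `^ p = (x ^+ 2) `^ (p / 2).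
  rewrite -[x ^+ 2]ger0_norm ?sqr_ge0// normrX -powR_mulrn// -powRrM.
  by congr powR; field.
have q0 : 0 < p / 2 by lra.
have q1 : p / 2 <= 1 by lra.
rewrite !E; apply: (le_trans (powR_midpoint _ _ q0 q1)); rewrite ?sqr_ge0//.
have -> : ((a + b) ^+ 2 + (a - b) ^+ 2) / 2 = a ^+ 2 + b ^+ 2 by field.
by rewrite ler_pM2l// powR_subadd// sqr_ge0.
Qed.

End Clarkson.

Section EsumReal.
Variables (R : realType) (T : choiceType).

Lemma esum_realZ (D : set T) (c : R) (a : T -> R) : 0 <= c -> (forall x, 0 <= a x) ->
  (\esum_(x in D) (c * a x)%:E = c%:E * \esum_(x in D) (a x)%:E)%E.
Proof.
have le (k : R) (b : T -> R) : 0 <= k -> (forall x, 0 <= b x) ->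
  (\esum_(x in D) (k * b x)%:E <= k%:E * \esum_(x in D) (b x)%:E)%E.
  move=> k0 b0; apply: le_esum_seq => s us sD.
  rewrite -big_distrr /= EFinM lee_wpmul2l ?lee_fin//.
  exact: seq_le_esum.
move=> c0 a0; apply/eqP; rewrite eq_le le//=.
have [->|cn] := eqVneq c 0.
  by rewrite mul0e esum_ge0// => x _; rewrite lee_fin mul0r.
have {}c0 : 0 < c by rewrite lt_def cn.
have -> : \esum_(x in D) (a x)%:E = \esum_(x in D) (c^-1 * (c * a x))%:E.
  by apply: eq_esum => x _; rewrite mulKf// gt_eqF.
have ca x : 0 <= c * a x by rewrite mulr_ge0// ltW.
have ci : 0 <= c^-1 by rewrite invr_ge0 ltW.
have c0' : (0 <= c%:E)%E by rewrite lee_fin ltW.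
apply: (le_trans (lee_wpmul2l c0' (le _ _ ci ca))).
by rewrite muleA -EFinM mulfV ?gt_eqF// mul1e.
Qed.

Lemma le_esum_real (D : set T) (a b : T -> R) : (forall x, a x <= b x) ->
  (\esum_(x in D) (a x)%:E <= \esum_(x in D) (b x)%:E)%E.
Proof. by move=> ab; apply: le_esum => x _; rewrite lee_fin. Qed.

Lemma esum_realD (D : set T) (a b : T -> R) : (forall x, 0 <= a x) ->
  (forall x, 0 <= b x) -> (\esum_(x in D) (a x + b x)%:E =
  \esum_(x in D) (a x)%:E + \esum_(x in D) (b x)%:E)%E.
Proof.
move=> a0 b0; by rewrite -esumD// => x _; rewrite lee_fin.
Qed.

End EsumReal.

(** * The mass inside a ball *)

Section TruncatedMass.
Variables (R : realType) (p : R).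
Hypotheses (p1 : 1 <= p) (p2 : p <= 2).
Variables (n m : nat) (B : 'M[R]_(n, m)) (eps F : R).
Hypotheses (eps0 : 0 <= eps) (eps1 : eps < 1).
Hypothesis FE :
  \esum_(z in [set: 'rV[int]_n]) (expR (- pnorm_pow p (lat_pt B z)))%:E = F%:E.

Local Notation LX z := (pnorm_pow p (lat_pt B z)).

(* The mass is compared with that of the narrower function [exp (- s X)],
   [s = 1 / (1 - eps)]: Jensen's inequality bounds the total of the latter from
   below, Markov's inequality its part outside the ball. *)
Lemma truncated_mass :
  ((expR (- (m%:R * eps / (1 - eps))) / (2 * m%:R + 1) * F)%:E <=
   \esum_(z in [set z : 'rV[int]_n | (LX z <= (m%:R + 2^-1) * (1 - eps))%R])
     (expR (- LX z))%:E)%E.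
Proof.
have p0 : 0 < p by exact: lt_le_trans p1.
have e1 : 0 < 1 - eps by rewrite subr_gt0.
pose s := (1 - eps)^-1; have s0 : 0 < s by rewrite invr_gt0.
have s1 : 1 <= s by rewrite /s invf_ge1//; move: eps0; lra.
have X0 z : 0 <= LX z by exact: pnorm_pow_ge0.
pose f z := expR (- LX z); pose fs z := expR (- (s * LX z)).
have f0 z : 0 <= f z by exact: expR_ge0.
have fs0 z : 0 <= fs z by exact: expR_ge0.
have Xf0 z : 0 <= LX z * f z by rewrite mulr_ge0.
have Xfs0 z : 0 <= LX z * fs z by rewrite mulr_ge0.
(* Rescaling the basis by [s^(1/p)] multiplies [LX] by [s], so that the moment bound also covers the
   narrower function. *)
have Xs z : pnorm_pow p (lat_pt (s `^ p^-1 *: B) z) = s * LX z.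
  by rewrite lat_ptZ pnorm_powZ ?powR_ge0// -powRrM mulVf ?gt_eqF// powRr1// ltW.
have F0 : 0 <= F.
  by rewrite -lee_fin -FE esum_ge0// => z _; rewrite lee_fin.
have [Fs [Fs0 FsE]] : exists Fs, 0 <= Fs /\ \esum_(z in [set: 'rV[int]_n]) (fs z)%:E = Fs%:E.
  have : (\esum_(z in [set: 'rV[int]_n]) (fs z)%:E <= F%:E)%E.
    rewrite -FE; apply: le_esum_real => z; rewrite ler_expR lerN2.
    by rewrite -[leLHS]mul1r ler_wpM2r.
  have : (0 <= \esum_(z in [set: 'rV[int]_n]) (fs z)%:E)%E.
    by apply: esum_ge0 => z _; rewrite lee_fin.
  by case: (\esum_(z in _) _) => // r r0 _; exists r; split.
have mom1 : (\esum_(z in [set: 'rV[int]_n]) (LX z * f z)%:E <= (m%:R * F)%:E)%E.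
  rewrite EFinM -FE -esum_realZ ?ler0n//.
  apply: le_trans (theta_moment_le p1 p2 B); apply: le_esum_real => z.
  by rewrite -mulrA ler_peMl.
have moms : (\esum_(z in [set: 'rV[int]_n]) (s * (LX z * fs z))%:E <= (m%:R * Fs)%:E)%E.
  have Efs : \esum_(z in [set: 'rV[int]_n]) (m%:R * expR (- pnorm_pow p (lat_pt (s `^ p^-1 *: B) z)))%:E
     = (m%:R * Fs)%:E.
    rewrite EFinM -FsE -esum_realZ ?ler0n//; apply: eq_esum => z _; by rewrite Xs.
  rewrite -Efs.
  apply: le_trans (theta_moment_le p1 p2 _); apply: le_esum_real => z.
  have sX : 0 <= s * LX z * fs z by apply: mulr_ge0 => //; apply: mulr_ge0 => //; exact: ltW.
  by rewrite Xs -/(fs z) mulrA -[leRHS]mulrA ler_peMl.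
pose c := m%:R * eps / (1 - eps).
have cE : c = (s - 1) * m%:R by rewrite /c /s; field; rewrite gt_eqF.
(* [1 + y <= exp y] is used at [y = c - (s - 1) LX], where [c = (s - 1) m] corresponds to the bound
   [m] on the mean of [LX]. *)
have jensen : expR (- c) * F <= Fs.
  pose k := expR (- c) * (s - 1).
  have k0 : 0 <= k by rewrite mulr_ge0 ?expR_ge0 ?subr_ge0.
  have c0 : 0 <= c by rewrite cE mulr_ge0 ?ler0n// subr_ge0.
  have h z : expR (- c) * (1 + c) * f z <= fs z + k * (LX z * f z).
    have -> : fs z = f z * expR (- c) * expR (c - (s - 1) * LX z).
      by rewrite /fs /f -!expRD; congr expR; ring.
    have -> : f z * expR (- c) * expR (c - (s - 1) * LX z) + k * (LX z * f z) =
       expR (- c) * (expR (c - (s - 1) * LX z) + (s - 1) * LX z) * f z by rewrite /k; ring.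
    rewrite ler_wpM2r// ler_wpM2l ?expR_ge0// -lerBlDr.
    by rewrite -addrA expR_ge1Dx.
  have := @le_esum_real R _ [set: 'rV[int]_n] _ _ h.
  rewrite esum_realD//; last by move=> z; rewrite mulr_ge0.
  rewrite !esum_realZ// ?mulr_ge0 ?expR_ge0 ?addr_ge0//.
  have k0' : (0 <= k%:E)%E by rewrite lee_fin.
  rewrite FE FsE => /le_trans/(_ (leeD2l _ (lee_wpmul2l k0' mom1))).
  rewrite -!EFinM -EFinD lee_fin /k => h2.
  have : expR (- c) * (1 + c) * F <= Fs + expR (- c) * c * F.
    by apply: (le_trans h2); rewrite cE lerD2l -!mulrA.
  by move: (expR _) => E; lra.
set D := [set z | _].
have thr0 : 0 < (m%:R + 2^-1) * (1 - eps).
  by rewrite mulr_gt0// ltr_wpDl ?ler0n// invr_gt0.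
pose thr := (m%:R + 2^-1) * (1 - eps).
(* Outside the ball [s LX] exceeds [s thr = m + 1/2], while its mean for [fs] is at most [m]: at
   most the fraction [m / (m + 1/2)] lies there, and [1 / (2 m + 1)] remains inside. *)
have markov : (Fs%:E <= \esum_(z in D) (f z)%:E + (m%:R / (m%:R + 2^-1) * Fs)%:E)%E.
  pose g z : R := if LX z <= thr then f z else 0.
  have g0 z : 0 <= g z by rewrite /g; case: ifP.
  have h z : fs z <= g z + (s * thr)^-1 * (s * (LX z * fs z)).
    rewrite /g; case: ifPn => [_|].
      apply: ler_wpDr; first by rewrite !mulr_ge0// ?invr_ge0 ?mulr_ge0// ltW.
      by rewrite ler_expR lerN2 -[leLHS]mul1r ler_wpM2r.
    rewrite -ltNge add0r => xt; rewrite mulrA -[leLHS]mul1r mulrA ler_wpM2r//.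
    rewrite -mulrA mulrC ler_pdivlMr ?mulr_gt0// mul1r ler_wpM2l// ltW//.
  have := @le_esum_real R _ [set: 'rV[int]_n] _ _ h.
  have st : 0 <= (s * thr)^-1 by rewrite invr_ge0 mulr_ge0// ltW.
  have sX z : 0 <= s * (LX z * fs z) by rewrite mulr_ge0// ltW.
  rewrite esum_realD//; last by move=> z; rewrite mulr_ge0.
  rewrite [X in (_ <= _ + X)%E]esum_realZ// FsE.
  have st' : (0 <= ((s * thr)^-1)%:E)%E by rewrite lee_fin.
  move=> /le_trans/(_ (leeD2l _ (lee_wpmul2l st' moms))) /le_trans; apply.
  apply: leeD.
    rewrite [leRHS]esum_mkcond; apply: le_esum => z _; rewrite /g.
    case: ifPn => zt; last by case: ifP => // _; rewrite lee_fin.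
    by rewrite ifT// inE.
  rewrite -EFinM lee_fin mulrA ler_wpM2r// /s /thr le_eqVlt; apply/orP; left.
  by apply/eqP; field; rewrite (gt_eqF e1) /= gt_eqF// ltr_wpDl ?ler0n.
have m0 : 0 <= m%:R :> R by exact: ler0n.
have Dfin : \esum_(z in D) (f z)%:E \is a fin_num.
  rewrite ge0_fin_numE; last by apply: esum_ge0 => z _; rewrite lee_fin.
  apply: le_lt_trans (ltry F); rewrite -FE.
  rewrite esum_mkcond; apply: le_esum => z _.
  by case: ifP => // _; rewrite lee_fin f0.
move: markov; rewrite -(fineK Dfin) -EFinD !lee_fin => mk.
have : Fs / (2 * m%:R + 1) <= fine (\esum_(z in D) (f z)%:E).
  move: mk; rewrite addrC -lerBlDl; congr (_ <= _).
  by move: m0; move: (m%:R : R) => y y0; field; rewrite gt_eqF//; lra.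
apply: le_trans; rewrite mulrAC ler_wpM2r// invr_ge0; move: m0; lra.
Qed.

End TruncatedMass.

(** * The embedded lattice *)

Section Embedding.
Variables (R : realType) (p : R).
Hypotheses (p1 : 1 <= p) (p2 : p <= 2).
Variables (n m : nat) (B : 'M[R]_(n, m)) (t : 'rV[R]_m) (a : R).
Hypotheses (fB : row_free B) (a0 : 0 < a).

Let p0 : 0 < p. Proof. exact: lt_le_trans p1. Qed.

Lemma lat_pt_inj k l (A : 'M[R]_(k, l)) : row_free A -> injective (lat_pt A).
Proof.
move=> fA z z' /(row_free_inj fA) /rowP E; apply/rowP => i.
by have := E i; rewrite !mxE => /intr_inj.
Qed.

Definition snoc_row (T : Type) (k : nat) (x : 'rV[T]_k) (c : T) : 'rV[T]_k.+1 :=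
  \row_j oapp (x 0) c (unlift ord_max j).

Lemma snoc_row_lift (T : Type) k (x : 'rV[T]_k) c j : snoc_row x c 0 (lift ord_max j) = x 0 j.
Proof. by rewrite mxE liftK. Qed.

Lemma snoc_row_max (T : Type) k (x : 'rV[T]_k) c : snoc_row x c 0 ord_max = c.
Proof. by rewrite mxE unlift_none. Qed.

Lemma snoc_row_inj (T : Type) k (x x' : 'rV[T]_k) c c' :
  snoc_row x c = snoc_row x' c' -> x = x' /\ c = c'.
Proof.
move=> /rowP E; split; last by rewrite -(snoc_row_max x c) E snoc_row_max.
by apply/rowP => j; rewrite -(snoc_row_lift x c) E snoc_row_lift.
Qed.

Lemma snoc_rowP (T : Type) k (y : 'rV[T]_k.+1) :
  y = snoc_row (\row_j y 0 (lift ord_max j)) (y 0 ord_max).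
Proof.
by apply/rowP => j; rewrite mxE; case: unliftP => [j'|] ->; rewrite /= ?mxE.
Qed.

Lemma pnorm_pow_snoc k (x : 'rV[R]_k) c :
  pnorm_pow p (snoc_row x c) = pnorm_pow p x + `|c| `^ p.
Proof.
rewrite /pnorm_pow big_ord_recr /= snoc_row_max; congr (_ + _).
apply: eq_bigr => j _; rewrite (_ : widen_ord _ _ = lift ord_max j) ?snoc_row_lift//.
by apply/val_inj; rewrite /= /bump leqNgt ltn_ord.
Qed.

Definition embed_mx : 'M[R]_(n.+1, m.+1) :=
  \matrix_(i, j) match unlift ord_max i with
  | Some i' => snoc_row (a *: row i' B) 0 0 j
  | None => snoc_row (a *: t) 2^-1 0 j
  end.

Lemma mul_embed_mx (v : 'rV[R]_n) (c : R) :
  snoc_row v c *m embed_mx = snoc_row (a *: (v *m B + c *: t)) (c / 2).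
Proof.
apply/rowP => j; rewrite mxE big_ord_recr /= snoc_row_max mxE unlift_none.
under eq_bigr => i _.
  rewrite (_ : widen_ord _ _ = lift ord_max i); last first.
    by apply/val_inj; rewrite /= /bump leqNgt ltn_ord.
  rewrite snoc_row_lift mxE liftK; over.
case: (unliftP ord_max j) => [j'|] ->.
  rewrite !snoc_row_lift !mxE mulrDr big_distrr /=; congr (_ + _); last first.
    by rewrite mulrCA.
  by apply: eq_bigr => i _; rewrite !snoc_row_lift !mxE mulrCA.
rewrite !snoc_row_max big1 ?add0r// => i _.
by rewrite snoc_row_max mulr0.
Qed.

Lemma embed_mx_free : row_free embed_mx.
Proof.
apply: inj_row_free => v; rewrite {1}(snoc_rowP v) mul_embed_mx => /rowP E.
have c0 : v 0 ord_max = 0.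
  have := E ord_max; rewrite snoc_row_max !mxE => /eqP.
  by rewrite mulf_eq0 invr_eq0 pnatr_eq0 orbF => /eqP.
set w := \row_j _ in E.
have w0 : w = 0.
  apply: (row_free_inj fB); rewrite mul0mx; apply/rowP => j.
  have := E (lift ord_max j); rewrite snoc_row_lift c0 scale0r addr0 !mxE => /eqP.
  by rewrite mulf_eq0 gt_eqF//= => /eqP.
rewrite (snoc_rowP v) -/w w0 c0; apply/rowP => j; rewrite !mxE.
by case: unliftP => [j'|] _ /=; rewrite ?mxE.
Qed.

Definition embed_pt (k : int) (z : 'rV[int]_n) : 'rV[R]_m.+1 :=
  snoc_row (lat_pt (a *: B) z + (k%:~R * a) *: t) (k%:~R / 2).

Lemma embed_ptE k z : embed_pt k z = lat_pt embed_mx (snoc_row z k).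
Proof.
rewrite /lat_pt (_ : map_mx _ _ = snoc_row (map_mx intr z) k%:~R).
  rewrite mul_embed_mx /embed_pt lat_ptZ scalerDr scalerA; congr (snoc_row (_ + _ *: _) _).
  by rewrite mulrC.
by apply/rowP => j; rewrite !mxE; case: unliftP => [j'|] _ /=; rewrite ?mxE.
Qed.

Lemma lattice_embedP y : lattice embed_mx y -> exists kz, y = embed_pt kz.1 kz.2.
Proof.
move=> [z _ <-]; exists (z 0 ord_max, \row_j z 0 (lift ord_max j)) => /=.
by rewrite embed_ptE -snoc_rowP.
Qed.

Lemma lattice_embed_pt k z : lattice embed_mx (embed_pt k z).
Proof. by rewrite embed_ptE; exists (snoc_row z k). Qed.

Lemma fpE k (x : 'rV[R]_k) : fp p x = expR (- pnorm_pow p x).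
Proof.
rewrite /fp /lp_norm -/(pnorm_pow p x) -powRrM mulVf ?gt_eqF// powRr1//.
exact: pnorm_pow_ge0.
Qed.

Lemma lp_norm_le k (x : 'rV[R]_k) (r : R) : 0 <= r ->
  (lp_norm p x <= r `^ p^-1) = (pnorm_pow p x <= r).
Proof.
move=> r0; rewrite /lp_norm -/(pnorm_pow p x).
have x0 := pnorm_pow_ge0 p x.
have [h|h] := leP (pnorm_pow p x) r.
  by rewrite ge0_ler_powR ?nnegrE// invr_ge0 ltW.
apply/negbTE; rewrite -ltNge; apply: gt0_ltr_powR => //.
by rewrite invr_gt0.
Qed.

Variable F : R.
Hypothesis FE : \esum_(z in [set: 'rV[int]_n])
  (expR (- pnorm_pow p (lat_pt (a *: B) z)))%:E = F%:E.

Let F0 : 0 <= F.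
Proof.
by rewrite -lee_fin -FE; apply: esum_ge0 => z _; rewrite lee_fin expR_ge0.
Qed.

(** [|k|^p >= |k|] for integers, and [2^(-p) >= 1/4] as [p <= 2]. A bound linear in [|k|] makes the
    weights of the cosets geometric. *)
Lemma half_int_powR_ge (k : int) : 4^-1 * `|k|%:~R <= `|k%:~R / 2 : R| `^ p.
Proof.
have [->|k0] := eqVneq k 0; first by rewrite normr0 mulr0 powR_ge0.
have k1 : 1 <= `|k%:~R : R|.
  by rewrite -intr_norm -[1]/(1%:~R) ler_int; move: k0; lia.
have -> : `|k%:~R / 2 : R| = `|k%:~R| * 2^-1.
  by rewrite normrM [X in _ * X]ger0_norm// invr_ge0.
rewrite powRM ?invr_ge0// intr_norm.
rewrite mulrC ler_pM//; first by rewrite le1r_powR.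
have -> : 4^-1 = 2^-1 `^ 2 :> R.
  by rewrite (powR_mulrn 2)// expr2 -invfM; congr (_^-1); ring.
by apply: ger_powR => //; rewrite invr_gt0 ltr0n invf_le1// ler1n.
Qed.

(** By [theta_shift_le] the coset of [k] times the target weighs at most [F exp (- |k| / 4)]. As
    [exp (1/4) >= 5/4], the sum over [k] is at most [2 / (1 - 4/5) = 10] times [F]. *)
Lemma theta_embed_le :
  (\esum_(y in lattice embed_mx) (fp p y)%:E <= (10 * F)%:E)%E.
Proof.
pose g k z : R := expR (- (4^-1 * `|k|%:~R)) *
  expR (- pnorm_pow p (lat_pt (a *: B) z + (k%:~R * a) *: t)).
have g0 k z : 0 <= g k z by rewrite mulr_ge0 ?expR_ge0.
have gle : (\esum_(k in [set: int]) \esum_(z in [set: 'rV[int]_n]) (g k z)%:E <= (10 * F)%:E)%E.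
  have h k : (\esum_(z in [set: 'rV[int]_n]) (g k z)%:E <= (F * expR (- (4^-1 * `|k|%:~R)))%:E)%E.
    rewrite esum_realZ ?expR_ge0//.
    rewrite (mulrC F) EFinM lee_wpmul2l ?lee_fin ?expR_ge0// -FE.
    exact: theta_shift_le.
  apply: (@le_trans _ _ (\esum_(k in [set: int]) (F * expR (- (4^-1 * `|k|%:~R)))%:E)%E).
    by apply: le_esum => k _; exact: h.
  apply: le_esum_seq => s us _; rewrite lee_fin -big_distrr /= mulrC ler_wpM2r//.
  apply: le_trans (int_geometric_le _ us) _; first by rewrite invr_gt0.
  have : expR (- 4^-1) <= 4 / 5 :> R.
    have e := expR_ge1Dx (4^-1 : R).
    rewrite expRN -[4 / 5]invrK lef_pV2 ?posrE ?expR_gt0//.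
    by apply: le_trans e; rewrite invf_div; lra.
  move=> h4; rewrite ler_pdivrMr; lra.
rewrite esum_esum in gle; last by move=> *; rewrite lee_fin.
apply: le_trans gle; apply: le_esum_seq => s us sL.
have /choice [q qE] : forall y, exists kz, y \in s -> y = embed_pt kz.1 kz.2.
  move=> y; have [ys|] := boolP (y \in s); last by exists (0, 0).
  by have [kz E] := lattice_embedP (sL _ ys); exists kz.
apply: (@le_trans _ _ (\sum_(kz <- map q s) g kz.1 kz.2)%:E).
  rewrite lee_fin big_map [leLHS]big_seq [leRHS]big_seq; apply: ler_sum => y ys.
  rewrite {1}(qE y ys) fpE /embed_pt pnorm_pow_snoc /g -expRD ler_expR.
  by rewrite opprD addrC lerD2r lerN2 half_int_powR_ge.
apply: (@seq_le_esum _ _ _ (fun kz : int * 'rV[int]_n => g kz.1 kz.2)).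
  rewrite map_inj_in_uniq// => y y' ys ys' E.
  by rewrite (qE y)// (qE y')// E.
by move=> [k z] _; split.
Qed.

(** For a sample in the coset of [a t] or of [- a t] the last coordinate is [1/2] or [- 1/2], so
    twice this coordinate is the sign that cancels [t] and leaves a lattice point. *)
Definition decode_target (y : 'rV[R]_m.+1) : 'rV[R]_m :=
  \row_j (t 0 j - 2 * y 0 ord_max * y 0 (lift ord_max j) / a).

Definition good_sample (y : 'rV[R]_m.+1) : Prop :=
  exists2 z, decode_target y = lat_pt B z &
    pnorm_pow p (a *: (lat_pt B z - t)) <= m%:R + 2^-1.

Variables (delta eps : R) (D : 'rV[R]_m.+1 -> R) (z0 : 'rV[int]_n).
Hypotheses (eps0 : 0 <= eps) (eps1 : eps < 1).
Hypothesis hD : dss_distribution p delta embed_mx D.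
Hypothesis near : pnorm_pow p (a *: (lat_pt B z0 - t)) <= (m%:R + 2^-1) * eps.

Let v := a *: (lat_pt B z0 - t).
Let X (z : 'rV[int]_n) := lat_pt (a *: B) z.

Let sg (z : 'rV[int]_n) := pnorm_pow p (X z - v) <= pnorm_pow p (X z + v).

(* Of the two reflections of a lattice point through the displacement [v] the
   shorter one is taken; it lies in the coset of [t] or of [- t]. *)
Let refl (z : 'rV[int]_n) : 'rV[R]_m.+1 :=
  if sg z then embed_pt 1 (z - z0) else embed_pt (-1) (z + z0).

Let w (z : 'rV[int]_n) := if sg z then X z - v else X z + v.

Let reflE z : refl z = snoc_row (w z) (if sg z then 2^-1 else - 2^-1).
Proof.
rewrite /refl /w; case: (sg z); rewrite /embed_pt.
  rewrite mul1r lat_ptB mulr1z mul1r /X /v; congr snoc_row.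
  by rewrite (lat_ptZ B a z0) scalerBr opprB addrA addrAC.
rewrite lat_ptD /X /v mulrN1z mulNr mul1r mulN1r; congr snoc_row.
by rewrite (lat_ptZ B a z0) scalerBr scaleNr addrA.
Qed.

(** The coset tells which reflection was taken; undoing the translation by [z0] then recovers
    [z]. *)
Let refl_inj : injective refl.
Proof.
have inj k k' z z' : embed_pt k z = embed_pt k' z' -> k = k' /\ z = z'.
  rewrite !embed_ptE => h.
  by have [-> ->] := snoc_row_inj (lat_pt_inj embed_mx_free h).
move=> z z'; rewrite /refl.
by case: (sg z); case: (sg z') => /inj [] // _ /addIr.
Qed.

Let halfp : `|2^-1 : R| `^ p <= 2^-1.
Proof.
rewrite ger0_norm ?invr_ge0//; have {2}<- : 2^-1 `^ 1 = 2^-1 :> R.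
  by rewrite powRr1// invr_ge0.
by apply: ger_powR => //; rewrite invr_gt0 ltr0n invf_le1// ler1n.
Qed.

Let pnorm_w z : pnorm_pow p (w z) <= pnorm_pow p (X z) + pnorm_pow p v.
Proof.
have par : pnorm_pow p (X z - v) + pnorm_pow p (X z + v) <=
    2 * (pnorm_pow p (X z) + pnorm_pow p v).
  rewrite /pnorm_pow -!big_split big_distrr; apply: ler_sum => j _ /=.
  by rewrite !mxE addrC clarkson.
have : sg z = (pnorm_pow p (X z - v) <= pnorm_pow p (X z + v)) by [].
rewrite /w (fun_if (@pnorm_pow R p m)); move: par; move: (pnorm_pow p (X z - v)).
move: (pnorm_pow p (X z + v)) (pnorm_pow p (X z)) (pnorm_pow p v) => b c d e par.
by case: (sg z) => /esym; [|move=> /negbT; rewrite -ltNge]; move: par; lra.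
Qed.

Let pnorm_refl z : pnorm_pow p (refl z) <= pnorm_pow p (X z) + pnorm_pow p v + 2^-1.
Proof.
rewrite reflE pnorm_pow_snoc lerD ?pnorm_w//.
by case: (sg z); rewrite ?normrN.
Qed.

Let an0 : a != 0. Proof. by rewrite gt_eqF. Qed.

Let refl_good z : pnorm_pow p (X z) <= (m%:R + 2^-1) * (1 - eps) ->
  good_sample (refl z).
Proof.
move=> Xz; exists (if sg z then z0 - z else z + z0).
  rewrite reflE; apply/rowP => j; rewrite mxE snoc_row_max snoc_row_lift /w /X lat_ptZ /v.
  by case: (sg z); rewrite ?lat_ptB ?lat_ptD !mxE; field.
have -> : pnorm_pow p (a *: (lat_pt B (if sg z then z0 - z else z + z0) - t)) =
    pnorm_pow p (w z).
  rewrite /w /X lat_ptZ /v; case: (sg z); rewrite ?lat_ptB ?lat_ptD.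
    by rewrite -pnorm_powN -scalerN -scalerBr; congr (pnorm_pow p (a *: _));
       apply/rowP => j; rewrite !mxE; ring.
  by rewrite -scalerDr addrA.
apply: (le_trans (pnorm_w z)); move: near Xz; rewrite -/v; lra.
Qed.

(** Each point of the truncated ball sends its mass, times [exp (- delta - V - 1/2) / (10 F)],
    injectively to a good sample. The total [F] cancels against the one in [truncated_mass]. *)
Lemma hit_prob :
  ((expR (- delta - (m%:R + 2^-1) * eps - m%:R * eps / (1 - eps)) /
     (20 * (2 * m%:R + 1)))%:E <= \esum_(y in good_sample) (D y)%:E)%E.
Proof.
have [[D0 _] dss] := hD.
set Zs := (\esum_(y in lattice embed_mx) (fp p y)%:E)%E.
have ZleF : (Zs <= (10 * F)%:E)%E by exact: theta_embed_le.
have Zgt0 : (0 < Zs)%E.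
  have h : ((\sum_(y <- [:: embed_pt 0 0]) fp p y)%:E <= Zs)%E.
    by apply: seq_le_esum => // y; rewrite inE => /eqP ->; exact: lattice_embed_pt.
  by apply: lt_le_trans h; rewrite lte_fin big_seq1 expR_gt0.
have [Z [Z0 ZF ZE]] : exists Z, [/\ 0 < Z, Z <= 10 * F & Zs = Z%:E].
  by case: Zs Zgt0 ZleF => // r; rewrite lte_fin lee_fin => *; exists r.
have Fp : 0 < F by move: Z0 ZF; lra.
pose V := pnorm_pow p v; pose K := expR (- delta - V - 2^-1) / (10 * F).
have K0 : 0 <= K by rewrite divr_ge0 ?expR_ge0// mulr_ge0.
pose S := [set z : 'rV[int]_n | pnorm_pow p (X z) <= (m%:R + 2^-1) * (1 - eps)].
have reflD z : S z -> K * expR (- pnorm_pow p (X z)) <= D (refl z).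
  move=> Sz; have pr := pnorm_refl z.
  have := dss (refl z); rewrite /super_gaussian -/Zs ZE /= fpE => dssz.
  have L : lattice embed_mx (refl z).
    by rewrite /refl; case: (sg z); exact: lattice_embed_pt.
  have H := dssz L.
  have N : lp_norm p (refl z) <= m.+1%:R `^ p^-1.
    rewrite lp_norm_le// (le_trans pr)// -[m.+1%:R]natr1.
    have n1 : pnorm_pow p v <= (m%:R + 2^-1) * eps := near.
    have s1 : pnorm_pow p (X z) <= (m%:R + 2^-1) * (1 - eps) := Sz.
    move: n1 s1; move: (pnorm_pow p v) (pnorm_pow p (X z)) => b c.
    move: (m%:R : R) eps => y e; lra.
  apply: le_trans (H N); rewrite /K mulrA -expRD mulrAC -expRD.
  rewrite ler_pM ?expR_ge0 ?invr_ge0 ?mulr_ge0// ?ler_expR ?lef_pV2 ?posrE ?mulr_gt0//.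
  by move: pr; rewrite -/V; lra.
have h : (\esum_(z in S) (K * expR (- pnorm_pow p (X z)))%:E <=
    \esum_(y in good_sample) (D y)%:E)%E.
  apply: le_esum_seq => s us sS.
  apply: (@le_trans _ _ (\sum_(y <- map refl s) D y)%:E).
    rewrite lee_fin big_map [leLHS]big_seq [leRHS]big_seq; apply: ler_sum => z zs.
    exact/reflD/sS.
  apply: seq_le_esum; first by rewrite map_inj_uniq.
  by move=> _ /mapP[z zs ->]; apply: refl_good; exact: sS.
apply: le_trans h; rewrite esum_realZ//.
have K0' : (0 <= K%:E)%E by rewrite lee_fin.
have tm := truncated_mass p1 p2 eps0 eps1 FE.
apply: (le_trans _ (lee_wpmul2l K0' tm)); rewrite -EFinM lee_fin /K.
have m0 : 0 <= m%:R :> R by exact: ler0n.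
have -> : expR (- delta - V - 2^-1) / (10 * F) *
    (expR (- (m%:R * eps / (1 - eps))) / (2 * m%:R + 1) * F) =
    expR (- delta - V - m%:R * eps / (1 - eps)) * expR (- 2^-1) * 2 / (20 * (2 * m%:R + 1)).
  have -> : expR (- delta - V - m%:R * eps / (1 - eps)) * expR (- 2^-1) =
     expR (- delta - V - 2^-1) * expR (- (m%:R * eps / (1 - eps))).
    by rewrite -!expRD; congr expR; ring.
  move: (expR _) (expR _) => A C; field.
  by rewrite (gt_eqF Fp)/= gt_eqF//; move: m0; lra.
have d0 : 0 <= (20 * (2 * m%:R + 1))^-1 :> R by rewrite invr_ge0; move: m0; lra.
rewrite (ler_wpM2r d0)//.
(* The [1/2] in the exponent comes from the last coordinate; [exp (- 1/2) >= 1/2] turns the factor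
   [10] into [20]. *)
have e2 : 1 <= expR (- 2^-1) * 2 :> R.
  by have := expR_ge1Dx (- 2^-1 : R); move: (expR _) => E; lra.
rewrite -[leRHS]mulrA -[leLHS]mulr1; apply: ler_pM; rewrite ?expR_ge0//.
rewrite ler_expR; by move: near; rewrite -/v -/V; lra.
Qed.

End Embedding.

(** * Repetition *)

Section SampleTuples.
Variables (R : realType) (T : choiceType) (M : nat).

Let prod_sum (a : T -> R) (A : seq T) (x0 : T) :
  \sum_(w : {ffun 'I_M -> 'I_(size A)}) \prod_i a (nth x0 A (w i)) =
  (\sum_(x <- A) a x) ^+ M.
Proof.
rewrite -(bigA_distr_bigA (fun (_ : 'I_M) (j : 'I_(size A)) => a (nth x0 A j))) /=.
by rewrite prodr_const card_ord (big_nth x0) big_mkord.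
Qed.

(** A finite set of tuples involves a finite alphabet [A] only, and the products over all of [A^M]
    sum to the [M]-th power of the mass of [A]. *)
Lemma esum_tuple_le (a : T -> R) (S : R) : (forall x, 0 <= a x) ->
  (\esum_(x in [set: T]) (a x)%:E <= S%:E)%E ->
  (\esum_(y in [set: {ffun 'I_M -> T}]) (\prod_i a (y i))%:E <= (S ^+ M)%:E)%E.
Proof.
move=> a0 aS; apply: le_esum_seq => s us _; rewrite lee_fin.
have S0 : 0 <= S.
  by rewrite -lee_fin; apply: le_trans aS; apply: esum_ge0 => x _; rewrite lee_fin.
case: s us => [_|y0 s us]; first by rewrite big_nil exprn_ge0.
move: (y0 :: s) us => {s} s us.
have [M0|M0] := posnP M.
  subst M; rewrite (eq_bigr (fun=> 1)) => [|y _]; last by rewrite big_ord0.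
  rewrite expr0; case: s us => [|y [|y' s]] /=; rewrite ?big_nil ?big_seq1//.
  by rewrite inE (_ : y = y') ?eqxx//; apply/ffunP => -[].
pose x0 := y0 (Ordinal M0).
pose A := undup (flatten [seq codom y | y : {ffun 'I_M -> T} <- s]).
have yA (y : {ffun 'I_M -> T}) i : y \in s -> y i \in A.
  move=> ys; rewrite mem_undup; apply/flattenP; exists (codom y); last exact: codom_f.
  exact: (map_f (fun y : {ffun 'I_M -> T} => codom y)).
have [A0|A0] := posnP (size A).
  rewrite big_seq big1 ?exprn_ge0// => y ys.
  by have := yA y (Ordinal M0) ys; rewrite (size0nil A0).
pose phi (y : {ffun 'I_M -> T}) : {ffun 'I_M -> 'I_(size A)} :=
  [ffun i => insubd (Ordinal A0) (index (y i) A)].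
have phiE y i : y \in s -> nth x0 A (phi y i) = y i.
  move=> ys; rewrite ffunE insubdK ?nth_index ?yA//.
  by suff : (index (y i) A < size A)%N by []; rewrite index_mem yA.
apply: (@le_trans _ _ (\sum_(y <- s) \prod_i a (nth x0 A (phi y i)))).
  rewrite [leLHS]big_seq [leRHS]big_seq; apply: ler_sum => y ys.
  by rewrite le_eqVlt; apply/orP; left; apply/eqP/eq_bigr => i _; rewrite phiE.
have h := @sum_inj_le R _ _ phi (fun w => \prod_i a (nth x0 A (w i))) s us.
apply: (le_trans (h _ _)) => {h}.
- by move=> y y' ys ys' E; apply/ffunP => i; rewrite -(phiE y)// -(phiE y')// E.
- by move=> w; exact: prodr_ge0.
rewrite prod_sum lerXn2r ?nnegrE ?sumr_ge0// -lee_fin; apply: le_trans aS.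
by apply: seq_le_esum => //; exact: undup_uniq.
Qed.

(** Finite alphabets of mass at least [1 - 1 / (k + 1)] give the lower bounds [(1 - 1 / (k + 1))^M],
    which tend to [1]. *)
Lemma esum_tuple_ge1 (a : T -> R) : (forall x, 0 <= a x) ->
  \esum_(x in [set: T]) (a x)%:E = 1%E ->
  (1 <= \esum_(y in [set: {ffun 'I_M -> T}]) (\prod_i a (y i))%:E)%E.
Proof.
move=> a0 a1; set E := (X in (_ <= X)%E).
have fin (A : seq T) : uniq A -> A != [::] -> (((\sum_(x <- A) a x) ^+ M)%:E <= E)%E.
  case: A => // x0 A; move: (x0 :: A) => {}A uA _.
  rewrite -(prod_sum a A x0).
  pose psi (w : {ffun 'I_M -> 'I_(size A)}) : {ffun 'I_M -> T} := [ffun i => nth x0 A (w i)].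
  have psi_inj : injective psi.
    move=> w w' /ffunP h; apply/ffunP => i; apply/val_inj/eqP.
    by have := h i; rewrite !ffunE => /eqP; rewrite nth_uniq.
  rewrite -big_enum (eq_bigr (fun w => \prod_i a (psi w i))) /=; last first.
    by move=> w _; apply: eq_bigr => i _; rewrite ffunE.
  rewrite -(big_map psi xpredT (fun y => \prod_i a (y i))).
  by apply: seq_le_esum => //; rewrite map_inj_uniq ?enum_uniq.
have appr k : exists A : seq T, [/\ uniq A, A != [::] & 1 - harmonic k <= \sum_(x <- A) a x].
  apply: contrapT => no.
  have : (\esum_(x in [set: T]) (a x)%:E <= (1 - harmonic k)%:E)%E.
    apply: le_esum_seq => s us _; rewrite lee_fin leNgt; apply/negP => h.
    have [s0|s0] := eqVneq s [::].
      move: h; rewrite s0 big_nil subr_lt0 ltNge => /negP; apply.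
      by rewrite invf_le1 ?ler1n ?ltr0n.
    by apply: no; exists s; split => //; exact: ltW.
  by rewrite a1 lee_fin lerDl oppr_ge0 leNgt harmonic_gt0.
have h k : (((1 - harmonic k) ^+ M)%:E <= E)%E.
  have [A [uA A0 h]] := appr k; apply: le_trans (fin _ uA A0).
  rewrite lee_fin lerXn2r ?nnegrE//; first by rewrite subr_ge0 invf_le1 ?ler1n ?ltr0n.
  by rewrite sumr_ge0.
case: E h fin => [r h _|h _|/(_ 0%N)]; [|exact: leey|by rewrite leeNy_eq].
have cvg1 : (1 - harmonic k) ^+ M @[k --> \oo] --> (1 - 0 : R) ^+ M.
  apply: (@cvg_comp _ _ _ (fun k => 1 - harmonic k)
    (fun x : R => x ^+ M) _ (nbhs (1 - 0 : R))); last exact: exprn_continuous.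
  by apply: cvgB; [exact: cvg_cst | exact: cvg_harmonic].
rewrite subr0 expr1n in cvg1; rewrite lee_fin.
by apply: (cvgr_to_le cvg1); apply: nearW => k; rewrite -lee_fin.
Qed.

(* [v] is the value when no sample is good, and [1] the value otherwise. *)
Lemma esum_tuple_success (D : T -> R) (good : set T) (rho v : R)
    (V : {ffun 'I_M -> T} -> R) :
  (forall x, 0 <= D x) -> \esum_(x in [set: T]) (D x)%:E = 1%E ->
  (rho%:E <= \esum_(x in good) (D x)%:E)%E -> 0 <= v -> v <= 1 ->
  (forall y, v <= V y) -> (forall (y : {ffun 'I_M -> T}) i, good (y i) -> 1 <= V y) ->
  ((1 - (1 - v) * (1 - rho) ^+ M)%:E <=
   \esum_(y in [set: {ffun 'I_M -> T}]) (\prod_i D (y i) * V y)%:E)%E.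
Proof.
move=> D0 D1 hr v0 v1 Vv V1.
(* The law restricted to bad samples: its products weigh the tuples without a good sample, whose
   total is at most [(1 - rho)^M]. *)
pose D' x := D x * (if `[< good x >] then 0 else 1).
have D'0 x : 0 <= D' x by rewrite mulr_ge0//; case: ifP.
have V0 y : 0 <= V y by exact: le_trans (Vv y).
have D'le : (\esum_(x in [set: T]) (D' x)%:E <= (1 - rho)%:E)%E.
  have : (\esum_(x in [set: T]) (D' x)%:E + \esum_(x in good) (D x)%:E <= 1)%E.
    rewrite -D1 [X in (_ + X)%E]esum_mkcond -esumD//; last first.
    - by move=> x _; case: ifP => // _; rewrite lee_fin.
    - by move=> x _; rewrite lee_fin.
    apply: le_esum => x _; rewrite /D'; case: asboolP => gx.
      by rewrite mulr0 add0e; case: ifP => // _; rewrite lee_fin.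
    rewrite mulr1 ifF ?adde0//; apply/negbTE; apply/negP; by rewrite inE.
  have : (0 <= \esum_(x in [set: T]) (D' x)%:E)%E.
    by apply: esum_ge0 => x _; rewrite lee_fin.
  move: hr; case: (\esum_(x in good) _) => [g||] //; case: (\esum_(x in _) _) => [r||] //=.
  by rewrite -EFinD !lee_fin; lra.
have rho1 : 0 <= 1 - rho.
  by rewrite -lee_fin; apply: le_trans D'le; apply: esum_ge0 => x _; rewrite lee_fin.
have h1 := esum_tuple_le D'0 D'le.
have h2 := esum_tuple_ge1 D0 D1.
have h3 (y : {ffun 'I_M -> T}) : \prod_i D (y i) <= \prod_i D (y i) * V y + (1 - v) * \prod_i D' (y i).
  have P0 : 0 <= \prod_i D (y i) by exact: prodr_ge0.
  have P'0 : 0 <= (1 - v) * \prod_i D' (y i).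
    by rewrite mulr_ge0 ?subr_ge0//; exact: prodr_ge0.
  have [[i gi]|no] := pselect (exists i, good (y i)).
    by rewrite ler_wpDr// ler_peMr// (V1 y i).
  have -> : \prod_i D' (y i) = \prod_i D (y i).
    apply: eq_bigr => i _; rewrite /D'; case: asboolP => [gi|]; last by rewrite mulr1.
    by exfalso; apply: no; exists i.
  rewrite mulrC -mulrDl -[leLHS]mul1r ler_wpM2r//.
  by have := Vv y; lra.
have := @le_esum_real R _ [set: {ffun 'I_M -> T}] _ _ h3.
rewrite esum_realD; last 2 first.
- by move=> y; rewrite mulr_ge0//; exact: prodr_ge0.
- by move=> y; rewrite mulr_ge0 ?subr_ge0//; exact: prodr_ge0.
rewrite [X in (_ <= _ + X)%E]esum_realZ ?subr_ge0//; last first.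
  by move=> y; exact: prodr_ge0.
move=> /(le_trans h2) {h2 h3}.
have v1' : (0 <= (1 - v)%:E)%E by rewrite lee_fin subr_ge0.
move=> /le_trans/(_ (leeD2l _ (lee_wpmul2l v1' h1))).
case: (\esum_(y in _) _) => [r||] //=; last by move=> _; exact: leey.
by rewrite -EFinM -EFinD !lee_fin; lra.
Qed.

End SampleTuples.

(** * The choice of the scale *)

Section ScaleChoice.
Variables (R : realType) (p : R).
Hypotheses (p1 : 1 <= p) (p2 : p <= 2).
Variables (n m : nat) (B : 'M[R]_(n, m)) (t : 'rV[R]_m) (P H Delta : R).
Variables (Bz : 'M[int]_(n, m)) (tz : 'rV[int]_m).
Hypotheses (D1 : 1 <= Delta) (DP : Delta <= P).
Hypotheses (tP : forall j, `|t 0 j| <= P) (BP : forall i j, `|B i j| <= P).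
Hypotheses (DB : map_mx intr Bz = Delta *: B) (Dt : map_mx intr tz = Delta *: t).
Hypothesis HP : 2 * m.+1%:R ^+ 2 * P <= H.

Let p0 : 0 < p. Proof. exact: lt_le_trans p1. Qed.
Let D0 : 0 < Delta. Proof. exact: lt_le_trans D1. Qed.
Let P1 : 1 <= P. Proof. exact: le_trans DP. Qed.
Let P0 : 0 < P. Proof. exact: lt_le_trans P1. Qed.
Let m1 : 1 <= m.+1%:R :> R. Proof. by rewrite ler1n. Qed.

Lemma lp_normE k (x : 'rV[R]_k) : lp_norm p x = pnorm_pow p x `^ p^-1.
Proof. by []. Qed.

Lemma lp_norm_ge0 k (x : 'rV[R]_k) : 0 <= lp_norm p x.
Proof. exact: powR_ge0. Qed.

Lemma lp_norm_powR k (x : 'rV[R]_k) : lp_norm p x `^ p = pnorm_pow p x.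
Proof.
rewrite lp_normE -powRrM mulVf ?gt_eqF// powRr1//; exact: pnorm_pow_ge0.
Qed.

Lemma le_pnorm_pow k (x : 'rV[R]_k) j : `|x 0 j| `^ p <= pnorm_pow p x.
Proof.
by rewrite /pnorm_pow (bigD1 j)//= lerDl sumr_ge0// => i _; exact: powR_ge0.
Qed.

Lemma le_lp_norm k (x : 'rV[R]_k) j : `|x 0 j| <= lp_norm p x.
Proof.
have -> : `|x 0 j| = (`|x 0 j| `^ p) `^ p^-1.
  by rewrite -powRrM mulfV ?gt_eqF// powRr1.
rewrite lp_normE ge0_ler_powR ?nnegrE ?invr_ge0 ?(ltW p0) ?powR_ge0 ?pnorm_pow_ge0//.
exact: le_pnorm_pow.
Qed.

Lemma lp_norm0 k : lp_norm p (0 : 'rV[R]_k) = 0.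
Proof.
rewrite lp_normE /pnorm_pow big1 => [|j _]; last first.
  by rewrite mxE normr0 powR0// gt_eqF.
by rewrite powR0// gt_eqF// invr_gt0.
Qed.

Lemma row_subE k (x y : 'rV[R]_k) j : (x - y) 0 j = x 0 j - y 0 j.
Proof. by rewrite [LHS]mxE; congr (_ + _); rewrite mxE. Qed.

(** Multiplied by the common denominator [Delta <= P], the difference is a nonzero integer. This
    separates distance zero from positive distances and bounds the latter from below. *)
Lemma lattice_target_sep z j : lat_pt B z 0 j != t 0 j ->
  P^-1 <= `|lat_pt B z 0 j - t 0 j|.
Proof.
move=> ne; pose u : int := (z *m Bz - tz) 0 j.
have uE : u%:~R = Delta * (lat_pt B z 0 j - t 0 j) :> R.
  have : map_mx intr (z *m Bz - tz) = Delta *: (lat_pt B z - t).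
    by rewrite map_mxB map_mxM DB Dt -scalemxAr scalerBr.
  move=> /rowP/(_ j); rewrite [LHS]mxE -/u => ->.
  by rewrite [LHS]mxE; congr (_ * _); rewrite [LHS]mxE; congr (_ + _); rewrite mxE.
have u0 : u != 0.
  apply: contraNneq ne => u0; move: uE; rewrite u0 mulr0z => /esym/eqP.
  by rewrite mulf_eq0 gt_eqF//= subr_eq0.
have : 1 <= `|u%:~R : R| by rewrite -intr_norm -[1]/(1%:~R) ler_int -gtz0_ge1 normr_gt0.
rewrite uE normrM gtr0_norm// => h.
rewrite -[leLHS]mul1r ler_pdivrMr// (le_trans h)// mulrC ler_wpM2l//.
Qed.

Lemma lp_dist_ge0 : 0 <= lp_dist p t B.
Proof.
apply: lb_le_inf => [|_ [x _ <-]]; last exact: lp_norm_ge0.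
by exists (lp_norm p (lat_pt B 0 - t)); exists (lat_pt B 0) => //; exists 0.
Qed.

Lemma lp_dist_le z : lp_dist p t B <= lp_norm p (lat_pt B z - t).
Proof.
apply: ge_inf; first by exists 0 => _ [x _ <-]; exact: lp_norm_ge0.
by exists (lat_pt B z) => //; exists z.
Qed.

Lemma lp_dist_approx e : lp_dist p t B < e ->
  exists z, lp_norm p (lat_pt B z - t) < e.
Proof.
move=> /inf_lt [|_ [_ [z _ <-] <-] h]; last by exists z.
by exists (lp_norm p (lat_pt B 0 - t)); exists (lat_pt B 0) => //; exists 0.
Qed.

Lemma lp_dist_ub : lp_dist p t B <= m.+1%:R * P.
Proof.
apply: le_trans (lp_dist_le 0) _.
rewrite /lat_pt map_mx0 mul0mx sub0r lp_normE pnorm_powN.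
have mP : 0 <= m.+1%:R * P by rewrite mulr_ge0// ltW.
have -> : m.+1%:R * P = ((m.+1%:R * P) `^ p) `^ p^-1.
  by rewrite -powRrM mulfV ?gt_eqF// powRr1.
rewrite ge0_ler_powR ?nnegrE ?invr_ge0 ?(ltW p0) ?powR_ge0 ?pnorm_pow_ge0//.
apply: (@le_trans _ _ (\sum_(j < m) P `^ p)).
  by apply: ler_sum => j _; rewrite ge0_ler_powR ?nnegrE ?(ltW p0) ?(ltW P0).
rewrite sumr_const card_ord -[leLHS]mulr_natl powRM ?(ltW P0)// ler_wpM2r ?powR_ge0//.
by rewrite (le_trans _ (le1r_powR m1 p1))// ler_nat.
Qed.

(** The least grid point above [lo] exceeds it by at most the ratio of the grid; Bernoulli's
    inequality shows that there is one. *)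
Lemma grid_point (lo : R) : (4 * H)^-1 <= lo ->
  exists k : nat, lo <= (4 * H)^-1 * (4 / 3) ^+ k <= 4 / 3 * lo.
Proof.
move=> hlo; have H0 : 0 < H by apply: lt_le_trans HP; rewrite !mulr_gt0// exprn_gt0.
have a0 : 0 < (4 * H)^-1 by rewrite invr_gt0 mulr_gt0.
have ex : exists k : nat, lo <= (4 * H)^-1 * (4 / 3) ^+ k.
  have bern k : 1 + k%:R / 3 <= (4 / 3) ^+ k :> R.
    elim: k => [|k IH]; first by rewrite mul0r addr0 expr0.
    rewrite exprS -natr1; have k0 : 0 <= k%:R :> R by exact: ler0n.
    by move: IH k0; move: ((4 / 3) ^+ k) (k%:R) => x y; lra.
  have [k hk] : exists k : nat, lo * (4 * H) * 3 < k%:R.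
    by exists (Num.bound (lo * (4 * H) * 3)); rewrite archi_boundP// !mulr_ge0// ?(ltW H0)// (le_trans _ hlo)// ltW.
  exists k; rewrite mulrC ler_pdivlMr ?mulr_gt0//.
  by have := bern k; move: hk; move: (lo * _) (_ ^+ k) => x y; lra.
have [] := ex_minnP ex => k hk kmin; exists k; rewrite hk /=.
case: k hk kmin => [|k] hk kmin.
  rewrite expr0 mulr1; have h := lt_le_trans a0 hlo.
  by apply: (le_trans hlo); move: h; lra.
have : ~~ (lo <= (4 * H)^-1 * (4 / 3) ^+ k) by apply/negP => /kmin; rewrite ltnn.
rewrite -ltNge exprS => h; rewrite mulrCA ler_wpM2l// ltW//; lra.
Qed.

(** With [r = (m + 1/2)^(1/p)] and [d] the distance, when positive, the scale is chosen so that
    [r <= a d g' <= (4/3) r]. The left inequality makes a solution of every point within [r] of the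
    target after scaling; the right one keeps the displacement short. *)
Lemma scale_exists (gamma : R) : 4 <= gamma ->
  exists (k : nat) (z0 : 'rV[int]_n) (eps : R),
  let a := (4 * H)^-1 * (4 / 3) ^+ k in
  [/\ a <= H, 0 <= eps /\ eps < 1,
      (m%:R + 2^-1) * eps + m%:R * eps / (1 - eps) <= m%:R / (gamma / 4) `^ p + 2,
      pnorm_pow p (a *: (lat_pt B z0 - t)) <= (m%:R + 2^-1) * eps &
      forall z, pnorm_pow p (a *: (lat_pt B z - t)) <= m%:R + 2^-1 ->
        lp_norm p (lat_pt B z - t) <= gamma * lp_dist p t B].
Proof.
move=> g4; have H0 : 0 < H by apply: lt_le_trans HP; rewrite !mulr_gt0// exprn_gt0.
have m0 : 0 <= m%:R :> R by exact: ler0n.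
have mS : m.+1%:R = m%:R + 1 :> R by rewrite natr1.
(* Large factors are capped at [4 (m + 1)] to keep the scale in the range of the grid. This costs at
   most [1] in the exponent, since [w <= 1 / (m + 1)] when the cap is active. *)
pose g' := Num.min gamma (4 * m.+1%:R).
have g'4 : 4 <= g' by rewrite le_min g4/= mS; lra.
have g'0 : 0 < g' by move: g'4; lra.
have g'g : g' <= gamma by rewrite ge_min lexx.
have g'm : g' <= 4 * m.+1%:R by rewrite ge_min lexx orbT.
pose w := (4 / g') `^ p.
have w0 : 0 <= w by exact: powR_ge0.
have w01 : 0 < 4 / g' <= 1 by rewrite divr_gt0//= ler_pdivrMr// mul1r.
have w1 : w <= 1.
  by rewrite (le_trans (ge1r_powR w01 p1))//; case/andP: w01.
have mw : m%:R * w <= m%:R / (gamma / 4) `^ p + 1.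
  have gp : 0 < gamma / 4 by move: g4; lra.
  have [gm|gm] := leP gamma (4 * m.+1%:R).
    have e : 4 / gamma = (gamma / 4) `^ (-1) by rewrite powR_inv1 ?(ltW gp)// invf_div.
    by rewrite /w /g' min_l// e -powRrM mulN1r powRN lerDl.
  have h : w <= m.+1%:R^-1.
    rewrite (le_trans (ge1r_powR w01 p1))// /g' min_r ?(ltW gm)//.
    by rewrite invfM mulrA divff// mul1r.
  apply: (@le_trans _ _ 1); last by rewrite lerDr divr_ge0// powR_ge0.
  by apply: (le_trans (ler_wpM2l m0 h)); rewrite ler_pdivrMr ?mul1r// ler_nat.
(* [3/8 = (9/8) (4/3) / 4], where [9/8] comes from an almost closest point and [4/3] from the grid.
   The two losses add up to at most [3/8 + (3/8) / (5/8) = 39/40] times [m w], apart from bounded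
   terms. *)
pose eps := 3 / 8 * w.
have eps0 : 0 <= eps by rewrite mulr_ge0.
have eps38 : eps <= 3 / 8 by rewrite /eps; move: w1; lra.
have eps1 : eps < 1 by move: eps38; lra.
have cost : (m%:R + 2^-1) * eps + m%:R * eps / (1 - eps) <= m%:R / (gamma / 4) `^ p + 2.
  have h : m%:R * eps / (1 - eps) <= 3 / 5 * (m%:R * w).
    rewrite ler_pdivrMr ?subr_gt0//.
    have x0 : 0 <= m%:R * w by rewrite mulr_ge0.
    have -> : m%:R * eps = 3 / 8 * (m%:R * w) by rewrite /eps; ring.
    have e58 : 5 / 8 <= 1 - eps by move: eps38; lra.
    by have := ler_wpM2l x0 e58; move: (m%:R * w) => x; lra.
  have h2 : m%:R * eps = 3 / 8 * (m%:R * w) by rewrite /eps; ring.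
  have x0 : 0 <= m%:R * w by rewrite mulr_ge0.
  rewrite mulrDl; move: h mw eps38 h2 x0.
  move: (m%:R * eps / (1 - eps)) (m%:R * eps) (m%:R * w) (m%:R / (gamma / 4) `^ p).
  by move=> x y z u; lra.
(* At distance zero [t] is a lattice point, and the scale is taken so large that every other lattice
   point violates the norm bound. *)
have [d0|dpos] := leP (lp_dist p t B) 0.
  have dd : lp_dist p t B = 0 by apply/eqP; rewrite eq_le d0 lp_dist_ge0.
  have [z0 hz0] : exists z0, lat_pt B z0 = t.
    have [|z0 hz] := @lp_dist_approx P^-1; first by rewrite dd invr_gt0.
    exists z0; apply/rowP => j; apply/eqP; apply: contraTT isT => /lattice_target_sep h.
    have := le_lp_norm (lat_pt B z0 - t) j; rewrite row_subE => /(le_trans h).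
    by rewrite leNgt hz.
  have [|k /andP[k1 k2]] := @grid_point (m.+1%:R * P).
    apply: (@le_trans _ _ 1); last exact: mulr_ege1.
    rewrite invf_le1 ?mulr_gt0//; apply: (@le_trans _ _ H); last by move: H0; lra.
    apply: le_trans HP; have : 1 <= m.+1%:R ^+ 2 * P by rewrite mulr_ege1// exprn_ege1.
    by rewrite -mulrA; move: (m.+1%:R ^+ 2 * P) => x; lra.
  exists k, z0, eps; split => //.
  - apply: (le_trans k2); apply: le_trans HP.
    have : m.+1%:R * P <= m.+1%:R ^+ 2 * P.
      by rewrite ler_wpM2r ?(ltW P0)// expr2 ler_peMl.
    have : 0 <= m.+1%:R * P by rewrite mulr_ge0// ltW.
    by rewrite -[2 * _ * P]mulrA; move: (_ * P) (_ ^+ 2 * P) => x y; lra.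
  - rewrite hz0 subrr scaler0 /pnorm_pow big1 ?mulr_ge0 ?addr_ge0// => j _.
    by rewrite mxE normr0 powR0// gt_eqF.
  move=> z hz; suff -> : lat_pt B z = t by rewrite subrr lp_norm0 dd mulr0.
  apply/rowP => j; apply/eqP; apply: contraTT isT => /lattice_target_sep h.
  pose a := (4 * H)^-1 * (4 / 3) ^+ k; rewrite -/a in k1 k2 hz.
  have a0 : 0 <= a by apply: le_trans k1; rewrite mulr_ge0// ltW.
  have := le_pnorm_pow (a *: (lat_pt B z - t)) j.
  rewrite [X in `|X|]mxE row_subE => /le_trans/(_ hz).
  have : m.+1%:R <= `|a * (lat_pt B z 0 j - t 0 j)|.
    rewrite normrM (ger0_norm a0).
    have -> : m.+1%:R = (m.+1%:R * P) / P by rewrite mulfK// gt_eqF.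
    by rewrite ler_pM// ?mulr_ge0 ?invr_ge0// ltW.
  move=> q1; have q2 := le1r_powR (le_trans m1 q1) p1.
  move: q1 q2; rewrite mS; move: (`|_|) (`|_| `^ _) => x y; lra.
pose d := lp_dist p t B.
(* The distance is an infimum; a point within the factor [9/8] replaces a closest one. *)
have d98 : d < 9 / 8 * d by rewrite /d; move: dpos; lra.
have [z0 hz0] := lp_dist_approx d98.
pose r := (m%:R + 2^-1) `^ p^-1.
have mh0 : 0 <= m%:R + 2^-1 :> R by move: m0; lra.
have rp : r `^ p = m%:R + 2^-1 by rewrite /r -powRrM mulVf ?gt_eqF// powRr1.
have r0 : 0 <= r by exact: powR_ge0.
have r12 : 2^-1 <= r.
  rewrite leNgt; apply/negP => rlt.
  have : r `^ p < 2^-1 `^ p by rewrite gt0_ltr_powR ?nnegrE// invr_ge0.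
  rewrite rp ltNge => /negP; apply.
  have h : (0 < (2^-1 : R)) && ((2^-1 : R) <= 1).
    by rewrite invr_gt0 ltr0n invf_le1 ?ler1n.
  by rewrite (le_trans (ge1r_powR h p1))// lerDr.
have rm : r <= m.+1%:R.
  have [r1|r1] := leP r 1; first exact: le_trans m1.
  by rewrite (le_trans (le1r_powR (ltW r1) p1))// rp mS; lra.
have dlow : 8 / 9 / P <= d.
  have ne : lat_pt B z0 != t.
    apply: contraTneq dpos => e; rewrite -leNgt.
    by apply: le_trans (lp_dist_le z0) _; rewrite e subrr lp_norm0.
  have [j hj] : exists j, lat_pt B z0 0 j != t 0 j.
    apply: contrapT => no; move/eqP: ne; apply; apply/rowP => j.
    by apply/eqP/negP => /negP h; apply: no; exists j.
  have := le_lp_norm (lat_pt B z0 - t) j; rewrite row_subE => /(le_trans (lattice_target_sep hj)).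
  by move=> /le_lt_trans/(_ hz0); move: (P^-1) => x; lra.
have dup : d <= m.+1%:R * P by exact: lp_dist_ub.
have d0 : 0 < d by [].
have [|k /andP[k1 k2]] := @grid_point (r / (g' * d)).
  rewrite ler_pdivlMr ?mulr_gt0// mulrC ler_pdivrMr ?mulr_gt0//.
  have : g' * d <= 4 * m.+1%:R * (m.+1%:R * P) by rewrite ler_pM// ltW.
  have -> : 4 * m.+1%:R * (m.+1%:R * P) = 4 * (m.+1%:R ^+ 2 * P) by rewrite expr2; ring.
  have := ler_wpM2r (ltW H0) r12; rewrite [r * (4 * H)]mulrCA.
  have : 2 * (m.+1%:R ^+ 2 * P) <= H by rewrite mulrA.
  move: (m.+1%:R ^+ 2 * P) (r * H) (g' * d) => x y z; lra.
pose a := (4 * H)^-1 * (4 / 3) ^+ k; rewrite -/a in k1 k2.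
have ad1 : r <= a * d * g'.
  by move: k1; rewrite ler_pdivrMr ?mulr_gt0// (mulrC g') mulrA.
have ad2 : a * d * g' <= 4 / 3 * r.
  by move: k2; rewrite mulrA ler_pdivlMr ?mulr_gt0// (mulrC g') mulrA.
have a0 : 0 < a.
  by apply: lt_le_trans k1; rewrite divr_gt0 ?mulr_gt0// (lt_le_trans _ r12)// invr_gt0.
exists k, z0, eps; split => //.
- rewrite -/a; apply: le_trans HP.
  have : a * (d * g') <= 4 / 3 * m.+1%:R by rewrite mulrA; move: ad2 rm; lra.
  have dg : 8 / 9 / P * 4 <= d * g' by rewrite ler_pM// divr_ge0// ltW.
  move=> /(le_trans (ler_wpM2l (ltW a0) dg)) h.
  have {h} : a * (32 / 9) <= 4 / 3 * m.+1%:R * P.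
    rewrite -ler_pdivrMr// (le_trans _ h)// le_eqVlt; apply/orP; left; apply/eqP.
    by field; rewrite gt_eqF.
  have : m.+1%:R * P <= m.+1%:R ^+ 2 * P.
    by rewrite ler_wpM2r ?(ltW P0)// expr2 ler_peMl.
  have : 0 <= m.+1%:R * P by rewrite mulr_ge0// ltW.
  rewrite -[2 * _ * P]mulrA -[4 / 3 * _ * P]mulrA.
  by move: (_ * P) (_ ^+ 2 * P) => x y; lra.
- rewrite -/a pnorm_powZ ?(ltW a0)// -lp_norm_powR -powRM ?(ltW a0) ?lp_norm_ge0//.
  have : a * lp_norm p (lat_pt B z0 - t) <= 3 / 8 * (4 / g') * r.
    have -> : 3 / 8 * (4 / g') * r = (3 / 2 * r) / g' by field; rewrite gt_eqF.
    rewrite ler_pdivlMr//.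
    apply: (@le_trans _ _ (9 / 8 * (a * d * g'))); last by move: ad2; lra.
    have -> : 9 / 8 * (a * d * g') = a * (9 / 8 * d) * g' by ring.
    apply: (ler_wpM2r (ltW g'0)); apply: (ler_wpM2l (ltW a0)); exact: ltW.
  move=> h; have := @ge0_ler_powR _ p (ltW p0) _ _ _ _ h; rewrite !nnegrE.
  have y0 : 0 <= 3 / 8 * (4 / g') * r.
    by rewrite !mulr_ge0// invr_ge0 ltW.
  rewrite mulr_ge0 ?(ltW a0) ?lp_norm_ge0// => /(_ isT y0) /le_trans; apply.
  rewrite powRM ?mulr_ge0 ?invr_ge0 ?(ltW g'0)// rp mulrC ler_wpM2l//.
  rewrite powRM ?mulr_ge0 ?invr_ge0 ?(ltW g'0)// /eps ler_wpM2r//.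
  by apply: ge1r_powR => //; apply/andP; split; lra.
move=> z; rewrite -/a pnorm_powZ ?(ltW a0)// -lp_norm_powR -powRM ?(ltW a0) ?lp_norm_ge0//.
rewrite -rp => hz.
have hz' : a * lp_norm p (lat_pt B z - t) <= r.
  rewrite leNgt; apply/negP => rlt; move: hz; rewrite leNgt => /negP; apply.
  apply: gt0_ltr_powR => //; rewrite nnegrE//.
  by rewrite mulr_ge0 ?lp_norm_ge0// ltW.
apply: (@le_trans _ _ (g' * d)); last by rewrite ler_wpM2r// ltW.
by rewrite -(ler_pM2l a0) (le_trans hz')// (mulrC g') mulrA.
Qed.

End ScaleChoice.

(** * The size of integer coordinates *)

Section CoefficientBound.
Variable R : realType.

Lemma det_le k (A : 'M[R]_k) (X : R) : (forall i j, `|A i j| <= X) ->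
  `|\det A| <= k`!%:R * X ^+ k.
Proof.
move=> AX; rewrite /determinant; apply: (le_trans (ler_norm_sum _ _ _)).
rewrite (_ : k`! = #|{: 'S_k}|)%N; last by rewrite card_Sn.
rewrite mulr_natl -sumr_const; apply: ler_sum => s _.
rewrite normrM normrX normrN normr1 expr1n mul1r normr_prod.
apply: (@le_trans _ _ (\prod_(i < k) X)); last by rewrite prodr_const card_ord.
by apply: ler_prod => i _; rewrite normr_ge0 AX.
Qed.

Lemma row_free_gram_det n m (A : 'M[R]_(n, m)) : row_free A -> \det (A *m A^T) != 0.
Proof.
move=> fA; rewrite -unitfE -[_ \is a _]/(_ \in unitmx) -row_free_unit.
apply: inj_row_free => v vG.
have : (v *m A) *m (v *m A)^T = 0 by rewrite trmx_mul mulmxA -(mulmxA v) vG mul0mx.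
move=> /matrixP/(_ 0 0); rewrite !mxE => /eqP; rewrite psumr_eq0 => [/allP h|j _]; last first.
  by rewrite [X in _ * X]mxE -expr2 sqr_ge0.
apply: (row_free_inj fA); rewrite mul0mx; apply/rowP => j.
have := h j (mem_index_enum j); rewrite [X in _ * X]mxE -expr2 sqrf_eq0 => /eqP ->.
by rewrite mxE.
Qed.

(** Cramer's rule for [z G = z A A^T] with the Gram matrix [G]: as [|det G| >= 1], it suffices to
    bound the right-hand side and the cofactors. *)
Lemma coef_le n m (A : 'M[R]_(n, m)) (Y U : R) (z : 'rV[R]_n) :
  1 <= `|\det (A *m A^T)| -> (forall i j, `|A i j| <= Y) -> 0 <= Y -> 0 <= U ->
  (forall j, `|(z *m A) 0 j| <= U) -> forall i,
  `|z 0 i| <= n%:R * ((m%:R * (U * Y)) * (n.-1`!%:R * (m%:R * Y ^+ 2) ^+ n.-1)).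
Proof.
move=> d1 AY Y0 U0 zU i; set G := A *m A^T in d1 *.
have zG : z 0 i * \det G = \sum_k (z *m A *m A^T) 0 k * \adj G k i.
  have : z *m G *m \adj G = \det G *: z by rewrite -mulmxA mul_mx_adj mul_mx_scalar.
  by move=> /rowP/(_ i); rewrite [RHS]mxE mulrC => <-; rewrite [LHS]mxE mulmxA.
have : `|z 0 i| <= `|z 0 i * \det G| by rewrite normrM ler_peMr.
move=> /le_trans; apply; rewrite zG; apply: (le_trans (ler_norm_sum _ _ _)).
rewrite -[X in X%:R * _](card_ord n) mulr_natl -sumr_const; apply: ler_sum => k _.
rewrite normrM; apply: ler_pM => //.
  rewrite mxE; apply: (le_trans (ler_norm_sum _ _ _)).
  rewrite -[X in X%:R * _](card_ord m) mulr_natl -sumr_const; apply: ler_sum => j _.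
  by rewrite normrM [X in _ * `|X|]mxE ler_pM.
rewrite mxE /cofactor normrM normrX normrN normr1 expr1n mul1r.
apply: det_le => i' j'; rewrite !mxE; apply: (le_trans (ler_norm_sum _ _ _)).
rewrite -[X in X%:R * _](card_ord m) mulr_natl -sumr_const; apply: ler_sum => j _.
by rewrite normrM [X in _ * `|X|]mxE expr2 ler_pM.
Qed.

(** Clearing denominators gives an integral matrix with entries at most [P^2], whose Gram
    determinant is a nonzero integer. In the exponent [4 (m + 1)], one factor [H^4] pays for the
    right-hand side and one for each of the [n - 1 <= m] rows of a cofactor. *)
Lemma coef_le_pow n m (B : 'M[R]_(n, m)) (P H Delta : R)
    (Bz : 'M[int]_(n, m)) (z : 'rV[int]_n) : row_free B ->
  1 <= Delta -> Delta <= P -> (forall i j, `|B i j| <= P) ->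
  map_mx intr Bz = Delta *: B -> 2 * m.+1%:R ^+ 2 * P <= H ->
  (forall j, `|lat_pt B z 0 j| <= (4 * m%:R + 3) * H) ->
  forall i, `|(z 0 i)%:~R : R| <= H ^+ (4 * m.+1).
Proof.
move=> fB D1 DP BP DB HP zH i.
have m0 : 0 <= m%:R :> R by exact: ler0n.
have mS : m.+1%:R = m%:R + 1 :> R by rewrite natr1.
have P1 : 1 <= P by exact: le_trans DP.
have P0 : 0 <= P by move: P1; lra.
have D0 : 0 <= Delta by move: D1; lra.
have nm : (n <= m)%N by have := rank_leq_col B; move: fB; rewrite /row_free => /eqP ->.
set q := m.+1%:R : R.
have q1 : 1 <= q by rewrite /q ler1n.
have q0 : 0 <= q by move: q1; lra.
have H0 : 0 <= H by apply: le_trans HP; rewrite !mulr_ge0// exprn_ge0.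
pose A : 'M[R]_(n, m) := map_mx intr Bz.
have AE i' j : `|A i' j| <= P ^+ 2.
  by rewrite /A DB mxE normrM ger0_norm// expr2 ler_pM.
have fA : row_free A.
  rewrite /A DB; apply: inj_row_free => v; rewrite -scalemxAr => /eqP.
  rewrite scaler_eq0 gt_eqF ?(lt_le_trans ltr01)//= => /eqP h.
  by apply: (row_free_inj fB); rewrite mul0mx.
have det1 : 1 <= `|\det (A *m A^T)|.
  have := row_free_gram_det fA; rewrite /A map_trmx -map_mxM det_map_mx.
  by rewrite intr_eq0 -intr_norm -[1]/(1%:~R) ler_int -gtz0_ge1 normr_gt0.
have zA j : `|(map_mx intr z *m A) 0 j| <= P * ((4 * m%:R + 3) * H).
  rewrite /A DB -scalemxAr mxE normrM ger0_norm// ler_pM//; exact: zH.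
have Y0 : 0 <= P ^+ 2 by rewrite exprn_ge0.
have U0 : 0 <= P * ((4 * m%:R + 3) * H) by rewrite !mulr_ge0//; lra.
have := coef_le det1 AE Y0 U0 zA i; rewrite mxE => /le_trans; apply.
have H1 : 1 <= H.
  apply: le_trans HP; have : 1 <= q ^+ 2 * P by rewrite mulr_ege1// exprn_ege1.
  by rewrite -mulrA -/q; move: (_ ^+ 2 * P) => x; lra.
have fact_le k : k`!%:R <= (k%:R : R) ^+ k.
  rewrite -natrX ler_nat; elim: k => // k IH; rewrite factS expnS leq_mul2l /=.
  by apply: (leq_trans IH); case: k {IH} => // k; rewrite leq_exp2r.
have h1 : 4 * (q ^+ 3 * P ^+ 3) * H <= H ^+ 4.
  have e1 : 1 <= 2 * q by move: q1; lra.
  have : 2 * q * P <= H.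
    apply: le_trans HP; rewrite -/q; apply: (ler_wpM2r P0).
    by rewrite expr2; apply: (ler_wpM2l (ler0n _ 2)); rewrite ler_peMl.
  move=> h; rewrite [H ^+ 4]exprSr; apply: (ler_wpM2r H0).
  apply: (@le_trans _ _ ((2 * q * P) ^+ 3)); last by rewrite lerXn2r ?nnegrE ?mulr_ge0.
  have -> : (2 * q * P) ^+ 3 = 8 * (q ^+ 3 * P ^+ 3) by ring.
  have : 0 <= q ^+ 3 * P ^+ 3 by rewrite mulr_ge0 ?exprn_ge0.
  by move: (_ * _ ^+ 3) => x; lra.
have h2 : q ^+ 2 * (P ^+ 2) ^+ 2 <= H ^+ 4.
  have qP : q * P <= H.
    apply: le_trans HP; rewrite -/q -mulrA.
    have : q * P <= q ^+ 2 * P by rewrite ler_wpM2r// expr2 ler_peMl.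
    have : 0 <= q * P by rewrite mulr_ge0.
    by move: (q * P) (_ ^+ 2 * P) => x y; lra.
  have PH : P <= H by apply: le_trans qP; rewrite ler_peMl.
  have -> : q ^+ 2 * (P ^+ 2) ^+ 2 = (q * P) ^+ 2 * P ^+ 2 by ring.
  have -> : H ^+ 4 = H ^+ 2 * H ^+ 2 by ring.
  by rewrite ler_pM ?exprn_ge0 ?mulr_ge0// lerXn2r ?nnegrE ?mulr_ge0.
have n1q : n.-1%:R <= q by rewrite ler_nat; apply: leq_trans (leqW nm); exact: leq_pred.
have nq : n%:R <= q by rewrite ler_nat leqW.
have mq : m%:R <= q by rewrite ler_nat.
have h3 : n.-1`!%:R * (m%:R * (P ^+ 2) ^+ 2) ^+ n.-1 <= H ^+ (4 * m).
  apply: (@le_trans _ _ ((H ^+ 4) ^+ n.-1)); last first.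
    rewrite -exprM; apply: ler_weXn2l => //; rewrite leq_mul2l /=.
    by apply: leq_trans nm; exact: leq_pred.
  apply: (@le_trans _ _ ((q * (q * (P ^+ 2) ^+ 2)) ^+ n.-1)).
    rewrite [leRHS]exprMn; apply: ler_pM; rewrite ?exprn_ge0 ?mulr_ge0 ?exprn_ge0//.
      by apply: le_trans (fact_le _) _; rewrite lerXn2r ?nnegrE.
    rewrite lerXn2r ?nnegrE ?mulr_ge0 ?exprn_ge0//.
    by apply: ler_wpM2r => //; rewrite exprn_ge0.
  rewrite lerXn2r ?nnegrE ?mulr_ge0 ?exprn_ge0//.
  by rewrite mulrA -expr2.
have mP0 : 0 <= m%:R * (P ^+ 2) ^+ 2 by rewrite mulr_ge0 ?exprn_ge0.
rewrite mulnS exprD mulrA; apply: ler_pM; rewrite ?mulr_ge0 ?exprn_ge0//.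
apply: le_trans h1; set V := P * _ * P ^+ 2.
have V0 : 0 <= V by rewrite mulr_ge0.
apply: (@le_trans _ _ (q * (q * V))); first by rewrite ler_pM ?mulr_ge0// ler_wpM2r.
have V1 : V <= 4 * q * (P ^+ 3 * H).
  have -> : V = (4 * m%:R + 3) * (P ^+ 3 * H) by rewrite /V; ring.
  by apply: ler_wpM2r; [rewrite mulr_ge0 ?exprn_ge0 | rewrite /q mS; move: m0; lra].
have -> : 4 * (q ^+ 3 * P ^+ 3) * H = q * (q * (4 * q * (P ^+ 3 * H))) by ring.
by apply: (ler_wpM2l q0); apply: (ler_wpM2l q0).
Qed.

End CoefficientBound.

(** * Program logic *)

(** The bound [e] is evaluated again before every pass, hence the condition in [wp_for] that the
    body leaves its variables alone. *)
Definition for_loop (x : nat) (e : iexp) (body : cmd) : cmd :=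
  CSeq (CISet x (IConst 0))
    (CWhile (TNot (TIle e (IVar x)))
       (CSeq body (CISet x (IAdd (IVar x) (IConst 1))))).

(** Together with [arr_mods], the syntactic footprint from which the frame conditions [agree] are
    obtained. *)
Fixpoint ctr_mods (c : cmd) : seq nat :=
  match c with
  | CSkip | CRSet _ _ _ _ => [::]
  | CISet x _ | CFlip x | CQuery x _ _ _ _ => [:: x]
  | CSeq c1 c2 | CIf _ c1 c2 => ctr_mods c1 ++ ctr_mods c2
  | CWhile _ c1 => ctr_mods c1
  end.

Fixpoint arr_mods (c : cmd) : seq nat :=
  match c with
  | CSkip | CISet _ _ | CFlip _ => [::]
  | CRSet a _ _ _ | CQuery _ a _ _ _ => [:: a]
  | CSeq c1 c2 | CIf _ c1 c2 => arr_mods c1 ++ arr_mods c2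
  | CWhile _ c1 => arr_mods c1
  end.

Section Logic.
Variables (R : realType) (p : R).
Implicit Types (s : store R) (c : cmd) (Phi Psi : store R -> Prop).

Definition agree (X A : seq nat) s s' :=
  (forall x, x \notin X -> ctr s' x = ctr s x) /\
  (forall a, a \notin A -> arr s' a = arr s a).

Lemma agree_refl X A s : agree X A s s. Proof. by []. Qed.

Lemma agree_trans X A s1 s2 s3 : agree X A s1 s2 -> agree X A s2 s3 -> agree X A s1 s3.
Proof.
by move=> [c1 a1] [c2 a2]; split => x h; rewrite ?c2 ?a2// ?c1 ?a1.
Qed.

Lemma agree_sub X A X' A' s s' : {subset X <= X'} -> {subset A <= A'} ->
  agree X A s s' -> agree X' A' s s'.
Proof.
move=> XX AA [h1 h2]; split => x xn; first by apply: h1; apply: contra xn => /XX.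
by apply: h2; apply: contra xn => /AA.
Qed.

Lemma agree_set_cell X A s a i j v : a \in A -> agree X A s (set_cell s a i j v).
Proof.
move=> aA; split => // b bA; apply/funext => i'; apply/funext => j' /=.
by case: eqP => // ba; move: bA; rewrite ba aA.
Qed.

Lemma agree_set_ctr X A s x k : x \in X -> agree X A s (set_ctr s x k).
Proof. by move=> xX; split => // y yX /=; case: eqP => // yx; move: yX; rewrite yx xX. Qed.

(* Query-free runs, with their number of steps. *)
Inductive exec : cmd -> store R -> nat -> store R -> Prop :=
| exec_skip s : exec CSkip s 1 s
| exec_iset x e s : exec (CISet x e) s 1 (set_ctr s x (ieval s e))
| exec_rset a i j e s :
    exec (CRSet a i j e) s 1 (set_cell s a (ieval s i) (ieval s j) (reval p s e))
| exec_seq c1 c2 s k1 s1 k2 s2 : exec c1 s k1 s1 -> exec c2 s1 k2 s2 ->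
    exec (CSeq c1 c2) s (k1 + k2).+1 s2
| exec_if b c1 c2 s k s' : exec (if teval p s b then c1 else c2) s k s' ->
    exec (CIf b c1 c2) s k.+1 s'
| exec_while0 b c s : ~~ teval p s b -> exec (CWhile b c) s 1 s
| exec_while1 b c s k1 s1 k2 s2 : teval p s b -> exec c s k1 s1 ->
    exec (CWhile b c) s1 k2 s2 -> exec (CWhile b c) s (k1 + k2).+1 s2.

Lemma exec_agree c s k s' : exec c s k s' -> agree (ctr_mods c) (arr_mods c) s s'.
Proof.
elim=> {c s k s'} //=.
- by move=> x e s; apply: agree_set_ctr; rewrite inE.
- by move=> a i j e s; apply: agree_set_cell; rewrite inE.
- move=> c1 c2 s k1 s1 k2 s2 _ h1 _ h2; apply: (@agree_trans _ _ _ s1).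
    by apply: agree_sub h1 => x xx; rewrite mem_cat xx.
  by apply: agree_sub h2 => x xx; rewrite mem_cat xx orbT.
- move=> b c1 c2 s k s' _; case: ifP => _ h; apply: agree_sub h => x xx;
  by rewrite mem_cat xx ?orbT.
- by move=> b c s k1 s1 k2 s2 _ _ h1 _ h2; exact: agree_trans h1 h2.
Qed.

Section Adequacy.
Variables (O : oracle R) (M r0 d0 : nat).
Local Notation halts := (halts_within p O M r0 d0).
Local Notation succ := (success_prob p O M).

Lemma exec_halts c s k s' : exec c s k s' ->
  forall k' K, halts k' (K, s') -> halts (k + k') (c :: K, s).
Proof.
elim=> {c s k s'} //=.
- move=> c1 c2 s k1 s1 k2 s2 _ h1 _ h2 k' K h.
  by rewrite -addnA; apply: h1; apply: h2.
- by move=> b c s /negbTE nb k' K h; rewrite nb.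
- move=> b c s k1 s1 k2 s2 tb _ h1 _ h2 k' K h; rewrite tb.
  by rewrite -addnA; apply: h1; apply: h2.
Qed.

Lemma exec_success Q c s k s' : exec c s k s' ->
  forall k' K, succ Q (k + k') (c :: K, s) = succ Q k' (K, s').
Proof.
elim=> {c s k s'} //=.
- by move=> c1 c2 s k1 s1 k2 s2 _ h1 _ h2 k' K; rewrite -addnA h1 h2.
- by move=> b c s /negbTE nb k' K; rewrite nb.
- by move=> b c s k1 s1 k2 s2 tb _ h1 _ h2 k' K; rewrite tb -addnA h1 h2.
Qed.

Hypothesis O0 : forall r d (B : 'M[R]_(r, d)), row_free B -> forall y, 0 <= O B y.

Lemma halts_mono k k' cf : (k <= k')%N -> halts k cf -> halts k' cf.
Proof.
elim: k k' cf => [|k IH] [|k'] cf kk' //=; case: (step p M cf) => //.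
- by move=> cf'; apply: IH.
- by move=> c1 c2 [h1 h2]; split; apply: IH.
- by move=> r d B next [er ed fB h]; split => // y hy; apply: IH => //; exact: h.
Qed.

(** [halts] is silent about answers of probability zero, but these have weight zero in the sum, so
    further steps do not change the value. *)
Lemma success_stable Q k k' cf : (k <= k')%N -> halts k cf ->
  succ Q k' cf = succ Q k cf.
Proof.
elim: k k' cf => [|k IH] [|k'] cf kk' //=; case: (step p M cf) => //.
- by move=> cf'; apply: IH.
- by move=> c1 c2 [h1 h2]; rewrite !(IH k').
move=> r d B next [_ _ fB h]; apply: eq_esum => y _.
have [/forallP hy|] := boolP [forall i, 0 < O B (y i)].
  by rewrite (IH k')//; exact: h.
rewrite negb_forall => /existsP[i]; rewrite -leNgt => yi.
have y0 : O B (y i) = 0 by apply/eqP; rewrite eq_le yi O0.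
by rewrite (bigD1 i)//= y0 mul0r !mul0e.
Qed.

End Adequacy.

Definition wp (T : nat) c Phi s :=
  exists k s', [/\ (k <= T)%N, exec c s k s' & Phi s'].

Lemma wp_post T c Phi Psi s : wp T c Phi s ->
  (forall s', Phi s' -> agree (ctr_mods c) (arr_mods c) s s' -> Psi s') -> wp T c Psi s.
Proof.
by move=> [k [s' [kT e h]]] H; exists k, s'; split => //; apply: H => //; exact: exec_agree e.
Qed.

Lemma wp_le T T' c Phi s : (T <= T')%N -> wp T c Phi s -> wp T' c Phi s.
Proof. by move=> TT [k [s' [kT e h]]]; exists k, s'; split => //; exact: leq_trans TT. Qed.

Lemma wp_iset x e Phi s : Phi (set_ctr s x (ieval s e)) -> wp 1 (CISet x e) Phi s.
Proof. by move=> h; exists 1%N, (set_ctr s x (ieval s e)); split => //; exact: exec_iset. Qed.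

Lemma wp_rset a i j e Phi s :
  Phi (set_cell s a (ieval s i) (ieval s j) (reval p s e)) -> wp 1 (CRSet a i j e) Phi s.
Proof. by move=> h; eexists 1%N, _; split => //; [exact: exec_rset|]. Qed.

Lemma wp_seq T1 T2 c1 c2 Phi Psi s : wp T1 c1 Psi s ->
  (forall s1, Psi s1 -> agree (ctr_mods c1) (arr_mods c1) s s1 -> wp T2 c2 Phi s1) ->
  wp (T1 + T2).+1 (CSeq c1 c2) Phi s.
Proof.
move=> [k1 [s1 [kT1 e1 h1]]] H; have [k2 [s2 [kT2 e2 h2]]] := H _ h1 (exec_agree e1).
by exists (k1 + k2).+1, s2; split; [rewrite ltnS leq_add | apply: exec_seq e1 e2 |].
Qed.

Lemma wp_rset_seq T a i j e c Phi s :
  wp T c Phi (set_cell s a (ieval s i) (ieval s j) (reval p s e)) ->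
  wp T.+2 (CSeq (CRSet a i j e) c) Phi s.
Proof.
move=> [k [s' [kT ex h]]]; exists k.+2, s'; split => //.
by apply: (@exec_seq _ _ _ 1%N) ex; exact: exec_rset.
Qed.

Lemma wp_if T b c1 c2 Phi s : (teval p s b -> wp T c1 Phi s) ->
  (~~ teval p s b -> wp T c2 Phi s) -> wp T.+1 (CIf b c1 c2) Phi s.
Proof.
move=> h1 h2; have [k [s' [kT e h]]] : wp T (if teval p s b then c1 else c2) Phi s.
  by case: ifPn => tb; [exact: h1 | exact: h2].
by exists k.+1, s'; split => //; exact: exec_if.
Qed.

Lemma wp_skip Phi s : Phi s -> wp 1 CSkip Phi s.
Proof. by move=> h; exists 1%N, s; split => //; exact: exec_skip. Qed.

(** The number [N] of passes is fixed beforehand, so that the indexed invariant yields termination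
    and the time bound at once. What the body does not touch is carried along by [agree]. *)
Lemma wp_while (N T : nat) b c (I : nat -> store R -> Prop) s :
  (forall j s', (j < N)%N -> I j s' -> agree (ctr_mods c) (arr_mods c) s s' ->
    teval p s' b /\ wp T c (I j.+1) s') ->
  (forall s', I N s' -> ~~ teval p s' b) -> I 0%N s ->
  wp (N * T.+1).+1 (CWhile b c) (I N) s.
Proof.
move=> step stop I0.
suff H : forall d s', (d <= N)%N -> I (N - d)%N s' ->
    agree (ctr_mods c) (arr_mods c) s s' -> wp (d * T.+1).+1 (CWhile b c) (I N) s'.
  by apply: H; rewrite ?subnn//; exact: agree_refl.
elim=> [|d IH] s' dN Is' ag.
  rewrite subn0 in Is'; exists 1%N, s'; split => //.
  by apply: exec_while0; exact: stop.
have [|tb [k1 [s1 [kT e1 I1]]]] := step _ _ _ Is' ag; first by rewrite subnSK// leq_subr.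
rewrite -subSn ?subSS in I1; last by [].
have [k2 [s2 [kT2 e2 I2]]] := IH s1 (ltnW dN) I1 (agree_trans ag (exec_agree e1)).
exists (k1 + k2).+1, s2; split => //; last exact: exec_while1 e1 e2.
by rewrite mulSn ltnS addSnnS leq_add.
Qed.

Fixpoint iexp_vars (e : iexp) : seq nat :=
  match e with
  | IConst _ => [::]
  | IVar x => [:: x]
  | IAdd e1 e2 | ISub e1 e2 => iexp_vars e1 ++ iexp_vars e2
  end.

Lemma ieval_agree X A s s' e : agree X A s s' -> ~~ has (mem X) (iexp_vars e) ->
  ieval s' e = ieval s e.
Proof.
move=> [h _]; elim: e => //= [x|e1 IH1 e2 IH2|e1 IH1 e2 IH2].
- by rewrite orbF => /h.
- by rewrite has_cat negb_or => /andP[/IH1-> /IH2->].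
- by rewrite has_cat negb_or => /andP[/IH1-> /IH2->].
Qed.

Lemma wp_for (N T x : nat) e body (I : nat -> (nat -> nat -> nat -> R) -> Prop) s :
  x \notin ctr_mods body -> ~~ has (mem (x :: ctr_mods body)) (iexp_vars e) ->
  ieval s e = N -> I 0%N (arr s) ->
  (forall j s', (j < N)%N -> ctr s' x = j -> I j (arr s') ->
    agree (x :: ctr_mods body) (arr_mods body) s s' ->
    wp T body (fun s1 => I j.+1 (arr s1)) s') ->
  wp (N * T.+3 + 3) (for_loop x e body) (fun s' => I N (arr s')) s.
Proof.
move=> xb xe eN I0 H.
pose J j s' := [/\ I j (arr s'), ctr s' x = j &
  agree (x :: ctr_mods body) (arr_mods body) s s'].
rewrite (_ : (N * T.+3 + 3)%N = (1 + (N * T.+3).+1).+1); last by rewrite addnC.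
have ags0 : agree (x :: ctr_mods body) (arr_mods body) s (set_ctr s x 0).
  by apply: agree_set_ctr; rewrite inE eqxx.
apply: (@wp_seq _ _ _ _ _ (fun s1 => J 0%N s1)).
  by apply: wp_iset; split => //=; rewrite eqxx.
move=> s1 J1 _.
apply: (wp_post (Phi := J N)); last by move=> s' [].
apply: wp_while => //.
- move=> j s' jN [Ij sx ag] _; split.
    by rewrite /= (ieval_agree ag xe) eN sx -ltnNge.
  apply: (@wp_le (T + 1).+1); first by rewrite addn1.
  apply: (wp_seq (H j s' jN sx Ij ag)).
  move=> s2 I2 [ag2 ag2'].
  have s2x : ctr s2 x = j by rewrite ag2.
  have ag' : agree (x :: ctr_mods body) (arr_mods body) s' s2.
    by split => // y; rewrite inE negb_or => /andP[_]; exact: ag2.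
  apply: wp_iset; split => //=; rewrite ?eqxx ?s2x ?addn1//.
  apply: agree_trans ag _; apply: agree_trans ag' _.
  by apply: agree_set_ctr; rewrite inE eqxx.
- by move=> s' [_ sx ag]; rewrite /= (ieval_agree ag xe) eN sx negbK leqnn.
Qed.

Section Probabilistic.
Variables (O : oracle R) (M r0 d0 : nat) (Q : store R -> Prop).
Hypothesis O0 : forall r d (B : 'M[R]_(r, d)), row_free B -> forall y, 0 <= O B y.
Local Notation halts := (halts_within p O M r0 d0).
Local Notation succ := (success_prob p O M Q).

(* [v] bounds from below the success probability of any program that runs [c]
   first, once [V s'] does so for the continuation started in [s']. *)
Definition pwp (T : nat) c (I : store R -> Prop) (V : store R -> R) s (v : R) :=
  forall K k', (forall s', I s' -> halts k' (K, s') /\ ((V s')%:E <= succ k' (K, s'))%E) ->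
    halts (T + k') (c :: K, s) /\ (v%:E <= succ (T + k') (c :: K, s))%E.

Lemma pwp_le T T' c I V s v : (T <= T')%N -> pwp T c I V s v -> pwp T' c I V s v.
Proof.
move=> TT h K k' H; have [h1 h2] := h K k' H.
have TTk : (T + k' <= T' + k')%N by rewrite leq_add2r.
by split; [exact: halts_mono TTk h1 | rewrite (success_stable O0 _ TTk h1)].
Qed.

Lemma pwp_det T c (I : store R -> Prop) V s v :
  wp T c (fun s' => I s' /\ v <= V s') s -> pwp T c I V s v.
Proof.
move=> [k [s' [kT e [Is' vV]]]]; apply: (pwp_le kT) => K k' H.
have [h1 h2] := H _ Is'; split; first exact: exec_halts e _ _ h1.
by rewrite (exec_success _ _ _ e); apply: le_trans h2; rewrite lee_fin.
Qed.

Lemma pwp_seq T1 T2 c1 c2 I1 V1 I V s v : pwp T1 c1 I1 V1 s v ->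
  (forall s1, I1 s1 -> pwp T2 c2 I V s1 (V1 s1)) ->
  pwp (T1 + T2).+1 (CSeq c1 c2) I V s v.
Proof.
move=> h1 h2 K k' H /=; rewrite -addnA; apply: h1 => s1 Is1.
exact: h2.
Qed.

(** Each pass guarantees [V j] before it if [V j.+1] is guaranteed after it; chaining backwards from
    [V N] gives the bound for the loop. *)
Lemma pwp_while (N T : nat) b c (I : nat -> store R -> Prop) (V : nat -> store R -> R) s :
  (forall j s', (j < N)%N -> I j s' ->
    teval p s' b /\ pwp T c (I j.+1) (V j.+1) s' (V j s')) ->
  (forall s', I N s' -> ~~ teval p s' b) -> I 0%N s ->
  pwp (N * T.+1).+1 (CWhile b c) (I N) (V N) s (V 0%N s).
Proof.
move=> step stop I0.
suff H : forall d s', (d <= N)%N -> I (N - d)%N s' ->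
    pwp (d * T.+1).+1 (CWhile b c) (I N) (V N) s' (V (N - d)%N s').
  by have := H N s; rewrite subnn; apply.
elim=> [|d IH] s' dN Is' K k' H.
  rewrite subn0 in Is'; rewrite subn0 /= (negbTE (stop _ Is')); exact: H.
have [|tb h] := step _ _ _ Is'; first by rewrite subnSK// leq_subr.
have -> : ((d.+1 * T.+1).+1 + k' = (T + ((d * T.+1).+1 + k')).+1)%N by rewrite mulSn; lia.
rewrite /= tb; apply: h => s1 Is1.
by rewrite -subSn ?subSS// in Is1 *; apply: IH => //; exact: ltnW.
Qed.

Lemma pwp_query cnt ans bas er ed (I : store R -> Prop) V s v :
  ieval s er = r0 -> ieval s ed = d0 -> row_free (read_mx s bas r0 d0) ->
  (forall y : {ffun 'I_M -> 'rV[R]_d0},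
     I (set_ctr (write_mx s ans (\matrix_i y i)) cnt M)) ->
  (forall s', I s' -> 0 <= V s') ->
  (v%:E <= \esum_(y in [set: {ffun 'I_M -> 'rV[R]_d0}])
     (\prod_i O (read_mx s bas r0 d0) (y i) *
      V (set_ctr (write_mx s ans (\matrix_i y i)) cnt M))%:E)%E ->
  pwp 1 (CQuery cnt ans bas er ed) I V s v.
Proof.
move=> er0 ed0 fB Iy V0 hv K k' H /=; rewrite er0 ed0; split.
  by split => // y _; have [] := H _ (Iy y).
apply: (le_trans hv); apply: le_esum => y _; rewrite EFinM.
apply: lee_wpmul2l; first by rewrite lee_fin prodr_ge0// => i _; exact: O0.
by have [] := H _ (Iy y).
Qed.

End Probabilistic.
End Logic.

(** * Gram-Schmidt orthogonalization *)

Section GramSchmidt.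
Variables (R : realType) (m : nat) (b : nat -> nat -> R).
Implicit Types f g : nat -> R.

(** Vectors are functions on [nat], like the rows of the arrays of the machine. *)
Definition dotn f g := \sum_(j < m) f j * g j.

Lemma dotnC f g : dotn f g = dotn g f.
Proof. by apply: eq_bigr => j _; rewrite mulrC. Qed.

Lemma dotnBl f f' g : dotn (fun j => f j - f' j) g = dotn f g - dotn f' g.
Proof. by rewrite /dotn -sumrB; apply: eq_bigr => j _; rewrite mulrBl. Qed.

Lemma dotn_suml k (c : 'I_k -> R) (F : 'I_k -> nat -> R) g :
  dotn (fun j => \sum_l c l * F l j) g = \sum_l c l * dotn (F l) g.
Proof.
rewrite /dotn; under [RHS]eq_bigr do rewrite big_distrr /=.
rewrite [RHS]exchange_big; apply: eq_bigr => j _ /=.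
by rewrite big_distrl; apply: eq_bigr => l _; rewrite /= mulrA.
Qed.

Lemma dotn_eq0 g : dotn g g = 0 -> forall j, (j < m)%N -> g j = 0.
Proof.
move=> /eqP; rewrite /dotn psumr_eq0 => [/allP h j jm|j _]; last by rewrite -expr2 sqr_ge0.
have := h (Ordinal jm) (mem_index_enum _).
by rewrite /= -expr2 sqrf_eq0 => /eqP.
Qed.

(** Each vector depends on all earlier ones; carrying their list along makes the recursion
    structural. *)
Fixpoint gs_seq (i : nat) : seq (nat -> R) :=
  if i is i'.+1 then
    let l := gs_seq i' in let g k := nth (fun=> 0) l k in
    rcons l (fun j => b i' j - \sum_(k < i') dotn (b i') (g k) / dotn (g k) (g k) * g k j)
  else [::].

Definition gs i := nth (fun=> 0) (gs_seq i.+1) i.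

Lemma size_gs_seq i : size (gs_seq i) = i.
Proof. by elim: i => //= i IH; rewrite size_rcons IH. Qed.

Lemma nth_gs_seq i k : (k < i)%N -> nth (fun=> 0) (gs_seq i) k = gs k.
Proof.
elim: i => // i IH ki; rewrite [gs_seq _]/= nth_rcons size_gs_seq.
case: ltngtP => [h|h|->]; first exact: IH.
  by move: ki; rewrite ltnS leqNgt h.
by rewrite /gs /= nth_rcons size_gs_seq ltnn eqxx.
Qed.

Lemma gsE i j : gs i j =
  b i j - \sum_(k < i) dotn (b i) (gs k) / dotn (gs k) (gs k) * gs k j.
Proof.
rewrite {1}/gs /= nth_rcons size_gs_seq ltnn eqxx; congr (_ - _).
by apply: eq_bigr => k _; rewrite nth_gs_seq.
Qed.

Lemma gs_orth i k : (k < i)%N -> dotn (gs i) (gs k) = 0.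
Proof.
elim/ltn_ind: i k => i IH k ki.
have orth l : (l < i)%N -> l != k -> dotn (gs l) (gs k) = 0.
  by move=> li; rewrite neq_ltn => /orP[lk|kl]; [rewrite dotnC; apply: IH | apply: IH].
have -> : dotn (gs i) (gs k) = dotn (fun j => b i j -
   \sum_(l < i) dotn (b i) (gs l) / dotn (gs l) (gs l) * gs l j) (gs k).
  by apply: eq_bigr => j _; rewrite -gsE.
rewrite dotnBl (dotn_suml (fun l : 'I_i => dotn (b i) (gs l) / dotn (gs l) (gs l))
  (fun l : 'I_i => gs l)).
rewrite (bigD1 (Ordinal ki))//= big1 ?addr0 => [|l lk]; last first.
  by rewrite orth ?mulr0//; apply: contra lk => /eqP e; apply/eqP/val_inj.
(* For a vanishing vector the quotient is [0] by convention, and all dot products with it are zero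
   as well. *)
have [z|z] := eqVneq (dotn (gs k) (gs k)) 0; last by rewrite divfK// subrr.
rewrite z mulr0 subr0 /dotn big1// => j _.
by rewrite (dotn_eq0 z) ?mulr0.
Qed.

Lemma basis_gs_orth i k : (k < i)%N -> dotn (b k) (gs i) = 0.
Proof.
move=> ki.
have -> : dotn (b k) (gs i) = dotn (fun j => gs k j +
    \sum_(l < k) dotn (b k) (gs l) / dotn (gs l) (gs l) * gs l j) (gs i).
  by apply: eq_bigr => j _; rewrite (gsE k) subrK.
rewrite (_ : dotn _ _ = dotn (fun j => gs k j - (- \sum_(l < k)
    dotn (b k) (gs l) / dotn (gs l) (gs l) * gs l j)) (gs i)); last first.
  by apply: eq_bigr => j _; rewrite opprK.
rewrite dotnBl dotnC gs_orth// sub0r.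
rewrite (_ : dotn _ _ = - dotn (fun j => \sum_(l < k)
    dotn (b k) (gs l) / dotn (gs l) (gs l) * gs l j) (gs i)); last first.
  by rewrite /dotn -sumrN; apply: eq_bigr => j _; rewrite mulNr.
rewrite (dotn_suml (fun l : 'I_k => dotn (b k) (gs l) / dotn (gs l) (gs l))
  (fun l : 'I_k => gs l)) big1 ?oppr0// => l _.
have li : (l < i)%N := ltn_trans (ltn_ord l) ki.
by rewrite (dotnC (gs l) (gs i)) (gs_orth li) mulr0.
Qed.

Lemma basis_gs i : dotn (b i) (gs i) = dotn (gs i) (gs i).
Proof.
have -> : dotn (gs i) (gs i) = dotn (fun j => b i j -
   \sum_(l < i) dotn (b i) (gs l) / dotn (gs l) (gs l) * gs l j) (gs i).
  by apply: eq_bigr => j _; rewrite -gsE.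
rewrite dotnBl (dotn_suml (fun l : 'I_i => dotn (b i) (gs l) / dotn (gs l) (gs l))
  (fun l : 'I_i => gs l)) big1 ?subr0// => l _.
by rewrite (dotnC (gs l) (gs i)) (gs_orth (ltn_ord l)) mulr0.
Qed.

(** Expressed through the basis instead of the earlier orthogonal vectors, a vanishing [gs i]
    becomes a linear relation excluded by independence. *)
Lemma gs_comb i : exists e : nat -> R, forall j, gs i j = b i j - \sum_(k < i) e k * b k j.
Proof.
elim/ltn_ind: i => i IH.
pose comb k (F : nat -> R) := exists e : nat -> R, forall j, F j = \sum_(l < k) e l * b l j.
have combD k F G : comb k F -> comb k G -> comb k (fun j => F j + G j).
  move=> [e eE] [e' e'E]; exists (fun l => e l + e' l) => j.
  by rewrite eE e'E -big_split; apply: eq_bigr => l _; rewrite /= mulrDl.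
have combZ k c F : comb k F -> comb k (fun j => c * F j).
  move=> [e eE]; exists (fun l => c * e l) => j.
  by rewrite eE big_distrr; apply: eq_bigr => l _; rewrite /= mulrA.
have combS k F : comb k F -> comb k.+1 F.
  move=> [e eE]; exists (fun l => if l == k then 0 else e l) => j.
  rewrite big_ord_recr /= eqxx mul0r addr0 eE; apply: eq_bigr => l _ /=.
  by rewrite ltn_eqF.
have combb k : comb k.+1 (b k).
  exists (fun l => if l == k then 1 else 0) => j.
  rewrite big_ord_recr /= eqxx mul1r big1 ?add0r// => l _.
  by rewrite ltn_eqF ?mul0r.
have combgs k : (k < i)%N -> comb k.+1 (gs k).
  move=> ki; have [e eE] := IH k ki.
  have -> : gs k = fun j => b k j + (-1) * (\sum_(l < k) e l * b l j).
    by apply/funext => j; rewrite eE mulN1r.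
  by apply: combD => //; apply: combZ; apply: combS; exists e.
have [e eE] : comb i (fun j => \sum_(k < i) dotn (b i) (gs k) / dotn (gs k) (gs k) * gs k j).
  suff H k : (k <= i)%N -> comb k (fun j => \sum_(l < k) dotn (b i) (gs l) / dotn (gs l) (gs l) * gs l j).
    exact: H.
  elim: k => [_|k IHk ki]; first by exists (fun=> 0) => j; rewrite !big_ord0.
  have -> : (fun j => \sum_(l < k.+1) dotn (b i) (gs l) / dotn (gs l) (gs l) * gs l j) =
      fun j => \sum_(l < k) dotn (b i) (gs l) / dotn (gs l) (gs l) * gs l j +
        dotn (b i) (gs k) / dotn (gs k) (gs k) * gs k j.
    by apply/funext => j; rewrite big_ord_recr.
  apply: combD; first by apply: combS; apply: IHk; exact: ltnW.
  by apply: combZ; exact: combgs.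
by exists e => j; rewrite gsE eE.
Qed.

Variable n : nat.
Hypothesis indep : forall i (e : nat -> R), (i < n)%N ->
  ~ (forall j, (j < m)%N -> b i j = \sum_(k < i) e k * b k j).

Lemma gs_neq0 i : (i < n)%N -> dotn (gs i) (gs i) != 0.
Proof.
move=> ni; apply/eqP => /dotn_eq0 h; have [e eE] := gs_comb i.
by apply: (indep (e := e) ni) => j /h; rewrite eE => /eqP; rewrite subr_eq0 => /eqP.
Qed.

(** The nearest-plane step: once the coefficients above [i] have been cleared, the projection on
    [gs i] reads off that of [b i]. *)
Lemma dotn_lattice_gs (y : nat -> R) i : (i < n)%N ->
  (forall k, (i < k < n)%N -> y k = 0) ->
  dotn (fun j => \sum_(k < n) y k * b k j) (gs i) = y i * dotn (gs i) (gs i).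
Proof.
move=> ni y0; rewrite (dotn_suml (fun k : 'I_n => y k) (fun k : 'I_n => b k)).
rewrite (bigD1 (Ordinal ni))//= basis_gs big1 ?addr0// => k ki.
have : (k : nat) != i by apply: contra ki => /eqP e; apply/eqP/val_inj.
by rewrite neq_ltn => /orP[h|h]; [rewrite basis_gs_orth ?mulr0 | rewrite y0 ?mul0r// h /=].
Qed.

End GramSchmidt.

(** * The program *)

(* Arrays used below, beside the inputs 0 to 3: 4 the bound P, 5 the power of two
   H, 6 the bound W on coefficients, 7 the scale, 8 and 9 numerator and
   denominator of a projection, 10 to 12 the rounding loop, 13 and 14 two
   distances, 15 the Gram-Schmidt vectors, 16 the queried basis, 17 the samples,
   18 the point to decode, 19 the decoded point, 20 the best point so far. *)
Definition num (k : nat) : rexp := RNat (IConst k).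
Definition scal (a : nat) : rexp := RCell a (IConst 0) (IConst 0).
Definition set_scal (a : nat) (e : rexp) : cmd := CRSet a (IConst 0) (IConst 0) e.

(** Counters admit no multiplication, so a product by a constant is unrolled into additions. *)
Fixpoint iexp_mul (c : nat) (e : iexp) : iexp :=
  if c is c'.+1 then IAdd e (iexp_mul c' e) else IConst 0.

Definition dim1 : iexp := IAdd (IVar 1) (IConst 1).

Definition dot_cmd (X Y : rexp) : cmd :=
  CSeq (set_scal 8 (num 0)) (CSeq (set_scal 9 (num 0))
    (for_loop 3 (IVar 1)
      (CSeq (set_scal 8 (RAdd (scal 8) (RMul X Y)))
            (set_scal 9 (RAdd (scal 9) (RMul Y Y)))))).

Definition ratio_cmd (a a' : nat) (i : iexp) : cmd :=
  let X := RCell a i (IVar 3) in let D := RCell a' i (IVar 3) in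
  for_loop 3 (IVar 1)
    (CSeq (set_scal 4 (RMul (scal 4) (RMul (RAdd (num 1) (RMul X X)) D)))
          (CRSet a i (IVar 3) (RDiv X D))).

(** As [H] is a power of two, so is [W = H^(4 (m + 1))], and halving [W] in the rounding loop
    reaches exactly [1]. *)
Definition bound_cmd : cmd :=
  CSeq (set_scal 5 (num 1))
  (CSeq (CWhile (TNot (TRle
           (RMul (RMul (num 2) (RMul (RNat dim1) (RNat dim1))) (scal 4)) (scal 5)))
           (set_scal 5 (RMul (scal 5) (num 2))))
  (CSeq (set_scal 6 (num 1))
        (for_loop 2 (iexp_mul 4 dim1) (set_scal 6 (RMul (scal 6) (scal 5)))))).

Definition prep_cmd : cmd :=
  CSeq (set_scal 4 (num 1))
  (CSeq (for_loop 2 (IVar 0) (ratio_cmd 0 1 (IVar 2)))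
  (CSeq (ratio_cmd 2 3 (IConst 0)) bound_cmd)).

Definition gs_cmd : cmd :=
  for_loop 2 (IVar 0)
    (CSeq (for_loop 3 (IVar 1) (CRSet 15 (IVar 2) (IVar 3) (RCell 0 (IVar 2) (IVar 3))))
      (for_loop 4 (IVar 2)
        (CSeq (dot_cmd (RCell 0 (IVar 2) (IVar 3)) (RCell 15 (IVar 4) (IVar 3)))
          (for_loop 3 (IVar 1)
            (CRSet 15 (IVar 2) (IVar 3)
              (RSub (RCell 15 (IVar 2) (IVar 3))
                    (RMul (RDiv (scal 8) (scal 9)) (RCell 15 (IVar 4) (IVar 3))))))))).

Definition build_cmd : cmd :=
  CSeq (for_loop 2 (IVar 0)
    (CSeq (CRSet 16 (IVar 2) (IVar 1) (num 0))
      (for_loop 3 (IVar 1)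
        (CRSet 16 (IVar 2) (IVar 3) (RMul (scal 7) (RCell 0 (IVar 2) (IVar 3)))))))
  (CSeq (CRSet 16 (IVar 0) (IVar 1) (RDiv (num 1) (num 2)))
    (for_loop 3 (IVar 1)
      (CRSet 16 (IVar 0) (IVar 3) (RMul (scal 7) (RCell 2 (IConst 0) (IVar 3)))))).

(* Greedy signed binary expansion: array 11 always receives an integer, which is
   the content of array 10 when that is an integer bounded by W. *)
Definition round_cmd : cmd :=
  CSeq (set_scal 11 (num 0))
  (CSeq (set_scal 12 (scal 6))
    (CWhile (TRle (num 1) (scal 12))
      (CSeq (CIf (TRle (scal 12) (scal 10))
               (CSeq (set_scal 10 (RSub (scal 10) (scal 12)))
                     (set_scal 11 (RAdd (scal 11) (scal 12))))
               (CIf (TRle (scal 10) (RSub (num 0) (scal 12)))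
                  (CSeq (set_scal 10 (RAdd (scal 10) (scal 12)))
                        (set_scal 11 (RSub (scal 11) (scal 12))))
                  CSkip))
            (set_scal 12 (RDiv (scal 12) (num 2)))))).

(** Nearest plane goes through the rows from the last to the first, whereas [for_loop] counts
    upwards. *)
Definition row_down : iexp := ISub (ISub (IVar 0) (IConst 1)) (IVar 2).

Definition decode_cmd : cmd :=
  for_loop 2 (IVar 0)
    (CSeq (dot_cmd (RSub (RCell 18 (IConst 0) (IVar 3)) (RCell 19 (IConst 0) (IVar 3)))
                   (RCell 15 row_down (IVar 3)))
    (CSeq (set_scal 10 (RDiv (scal 8) (scal 9)))
    (CSeq round_cmd
      (for_loop 3 (IVar 1)
        (CRSet 19 (IConst 0) (IVar 3)
          (RAdd (RCell 19 (IConst 0) (IVar 3))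
                (RMul (scal 11) (RCell 0 row_down (IVar 3))))))))).

Definition target_cmd : cmd :=
  for_loop 3 (IVar 1)
    (CSeq (CRSet 18 (IConst 0) (IVar 3)
             (RSub (RCell 2 (IConst 0) (IVar 3))
                (RDiv (RMul (RMul (num 2) (RCell 17 (IVar 6) (IVar 1)))
                            (RCell 17 (IVar 6) (IVar 3))) (scal 7))))
          (CRSet 19 (IConst 0) (IVar 3) (num 0))).

Definition keep_best_cmd : cmd :=
  CSeq (set_scal 13 (num 0)) (CSeq (set_scal 14 (num 0))
  (CSeq (for_loop 3 (IVar 1)
    (CSeq (set_scal 13 (RAdd (scal 13)
             (RPow (RSub (RCell 19 (IConst 0) (IVar 3)) (RCell 2 (IConst 0) (IVar 3))))))
          (set_scal 14 (RAdd (scal 14)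
             (RPow (RSub (RCell 20 (IConst 0) (IVar 3)) (RCell 2 (IConst 0) (IVar 3))))))))
  (CIf (TRle (scal 13) (scal 14))
     (for_loop 3 (IVar 1)
        (CRSet 20 (IConst 0) (IVar 3) (RCell 19 (IConst 0) (IVar 3))))
     CSkip))).

Definition sample_cmd : cmd := CSeq target_cmd (CSeq decode_cmd keep_best_cmd).

Definition round_of_queries : cmd :=
  CSeq (CQuery 5 17 16 (IAdd (IVar 0) (IConst 1)) dim1) (for_loop 6 (IVar 5) sample_cmd).

Definition scale_cmd : cmd :=
  CSeq build_cmd
  (CSeq (for_loop 7 (iexp_mul 2560 dim1) round_of_queries)
        (set_scal 7 (RMul (scal 7) (RDiv (num 4) (num 3))))).

(** The scales form the grid of [scale_exists], from [1 / (4 H)] up to [H]. *)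
Definition main_cmd : cmd :=
  CSeq (set_scal 7 (RDiv (num 1) (RMul (num 4) (scal 5))))
       (CWhile (TRle (scal 7) (scal 5)) scale_cmd).

Definition out_cmd : cmd :=
  for_loop 3 (IVar 1) (CRSet 0 (IConst 0) (IVar 3) (RCell 20 (IConst 0) (IVar 3))).

Definition cvp_prog : cmd :=
  CSeq prep_cmd (CSeq gs_cmd (CSeq main_cmd out_cmd)).

Arguments iexp_mul : simpl never.

Section Programs.
Variables (R : realType) (p : R).
Implicit Types (s : store R) (A : nat -> nat -> nat -> R).

Lemma ieval_mul s c e : ieval s (iexp_mul c e) = (c * ieval s e)%N.
Proof. by elim: c => [|c IH] //=; rewrite /iexp_mul /= -/(iexp_mul c e) IH mulSn. Qed.

Lemma arr_cell_same s a i j (v : R) : arr (set_cell s a i j v) a i j = v.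
Proof. by rewrite /= !eqxx. Qed.

Lemma arr_cell_neq s a i j (v : R) a' : a' != a -> arr (set_cell s a i j v) a' = arr s a'.
Proof.
by move=> /negbTE h; apply/funext => i'; apply/funext => j'; rewrite /= h.
Qed.

Lemma arr_cell_other s a i j (v : R) i' : i' != i ->
  arr (set_cell s a i j v) a i' = arr s a i'.
Proof. by move=> /negbTE h; apply/funext => j'; rewrite /= eqxx h. Qed.

(** [Y] is read again after array 8 has been overwritten, so the operands must keep their values in
    every store that differs from [s] only in the loop counter and in arrays 8 and 9. *)
Lemma wp_dot (X Y : rexp) (f g : nat -> R) (m : nat) s : ctr s 1 = m ->
  (forall j s', (j < m)%N -> ctr s' 3 = j -> agree [:: 3%N] [:: 8%N; 9%N] s s' ->
     reval p s' X = f j /\ reval p s' Y = g j) ->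
  wp p (m * 6 + 7) (dot_cmd X Y)
    (fun s' => arr s' 8 0%N 0%N = dotn m f g /\ arr s' 9 0%N 0%N = dotn m g g) s.
Proof.
move=> sm H; apply: (@wp_le _ _ (m * 6 + 3).+4); first by rewrite !addnS addn0.
apply: wp_rset_seq; apply: wp_rset_seq.
set s0 := set_cell _ 9 _ _ _.
have ag0 : agree [:: 3%N] [:: 8%N; 9%N] s s0.
  by apply: (agree_trans (s2 := set_cell s 8 0 0 0)); apply: agree_set_cell.
apply: (wp_for (I := fun j A => A 8%N 0%N 0%N = \sum_(k < j) f k * g k /\
   A 9%N 0%N 0%N = \sum_(k < j) g k * g k)) => //.
- by rewrite !big_ord0.
move=> j s' jm sj [h8 h9] ag.
have {}ag : agree [:: 3%N] [:: 8%N; 9%N] s s'.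
  by apply: (agree_trans ag0); apply: agree_sub ag => x; rewrite !inE.
have [Xf Yg] := H j s' jm sj ag.
apply: wp_rset_seq; apply: wp_rset.
set s1 := set_cell s' 8 _ _ _.
have ag1 : agree [:: 3%N] [:: 8%N; 9%N] s s1.
  by apply: (agree_trans ag); apply: agree_set_cell.
have [_ Yg1] := H j s1 jm sj ag1.
rewrite arr_cell_neq// arr_cell_same arr_cell_same /= Yg1 /= Xf Yg h8 h9.
by rewrite !big_ord_recr.
Qed.

End Programs.

(** * Correctness of the preprocessing *)

Section Preparation.
Variables (R : realType) (p : R).
Implicit Types (s : store R) (A : nat -> nat -> nat -> R).

(* Exceeds both [d] and the absolute value of [x / d] when [d >= 1]. *)
Definition entry_factor (x d : R) : R := (1 + x * x) * d.

Lemma ieval_cell s a i j (v : R) e : ieval (set_cell s a i j v) e = ieval s e.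
Proof. by elim: e => //= [e1 -> e2 ->|e1 -> e2 ->]. Qed.

Lemma wp_ratio a a' ir (i m : nat) (x d : nat -> R) s : a != 4%N -> a' != 4%N -> a != a' ->
  3%N \notin iexp_vars ir -> ieval s ir = i -> ctr s 1 = m ->
  (forall j, (j < m)%N -> arr s a i j = x j) -> (forall j, (j < m)%N -> arr s a' i j = d j) ->
  wp p (m * 6 + 3) (ratio_cmd a a' ir) (fun s' =>
    [/\ arr s' 4 0%N 0%N = arr s 4 0%N 0%N * \prod_(j < m) entry_factor (x j) (d j),
        forall j, (j < m)%N -> arr s' a i j = x j / d j &
        forall i', i' != i -> arr s' a i' = arr s a i']) s.
Proof.
move=> a4 a'4 aa' ir3 iri sm hx hd.
pose I j A := [/\ A 4%N 0%N 0%N = arr s 4 0%N 0%N * \prod_(k < j) entry_factor (x k) (d k),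
   forall k, (k < m)%N -> A a i k = if (k < j)%N then x k / d k else x k &
   forall i', i' != i -> A a i' = arr s a i'].
apply: (wp_post (Phi := fun s' => I m (arr s'))); last first.
  by move=> s' [h1 h2 h3] _; split => // j jm; rewrite h2// jm.
apply: wp_for => //.
  by split; rewrite ?big_ord0 ?mulr1// => k km; rewrite ltn0 hx.
move=> j s' jm sj [h1 h2 h3] ag.
have ir' : ieval s' ir = i.
  rewrite -iri; apply: (ieval_agree ag); apply/hasPn => y yv; rewrite /= inE.
  by apply: contraNneq ir3 => <-.
have d' : arr s' a' i j = d j.
  by have [_ ->] := ag; rewrite ?hd//= !inE negb_or a'4 eq_sym.
apply: wp_rset_seq; apply: wp_rset.
have nlt k : (k == j) = false -> (k < j.+1)%N = (k < j)%N.
  by move=> e; rewrite ltnS leq_eqVlt e.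
split.
- rewrite arr_cell_neq 1?eq_sym// arr_cell_same /= sj ir' d' h1 h2// ltnn.
  by rewrite big_ord_recr [RHS]mulrA.
- move=> k km; rewrite /= !ieval_cell ir' sj !eqxx /= (negbTE a4) (negbTE a'4) /=.
  case: eqP => [->|/eqP/negbTE kj]; first by rewrite ltnSn h2 ?ltnn ?d'//.
  by rewrite h2// nlt.
- move=> i' i'i; rewrite -h3//; apply/funext => k /=.
  by rewrite ieval_cell ir' (negbTE i'i) eqxx /= (negbTE a4).
Qed.

Lemma wp_bound (m Kb : nat) (P : R) s : ctr s 1 = m -> arr s 4 0%N 0%N = P ->
  2 * (m.+1%:R * m.+1%:R) * P <= 2 ^+ Kb ->
  wp p (Kb * 2 + (4 * m.+1) * 4 + 12) bound_cmd (fun s' =>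
    exists2 h : nat, (h <= Kb)%N & [/\ arr s' 5 0%N 0%N = 2 ^+ h,
      2 * (m.+1%:R * m.+1%:R) * P <= 2 ^+ h &
      arr s' 6 0%N 0%N = 2 ^+ (h * (4 * m.+1))]) s.
Proof.
move=> sm sP hK; set X := 2 * _ * P in hK *.
have ex : exists h : nat, X <= 2 ^+ h by exists Kb.
have [] := ex_minnP ex => h hX hmin.
have hKb : (h <= Kb)%N by exact: hmin.
pose s1 := set_cell s 5 0 0 (1%:R : R).
have w2 : wp p (h * 2).+1 (CWhile (TNot (TRle
           (RMul (RMul (num 2) (RMul (RNat dim1) (RNat dim1))) (scal 4)) (scal 5)))
           (set_scal 5 (RMul (scal 5) (num 2))))
    (fun s' => arr s' 5 0%N 0%N = 2 ^+ h /\ arr s' 4 0%N 0%N = P) s1.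
  have testE j s' : agree [::] [:: 5%N] s1 s' -> arr s' 5 0%N 0%N = 2 ^+ j ->
      arr s' 4 0%N 0%N = P -> teval p s' (TNot (TRle
        (RMul (RMul (num 2) (RMul (RNat dim1) (RNat dim1))) (scal 4)) (scal 5))) =
        ~~ (X <= 2 ^+ j).
    by move=> [ag _] /= -> ->; rewrite ag//= sm addn1.
  pose I j s' := [/\ arr s' 5 0%N 0%N = 2 ^+ j, arr s' 4 0%N 0%N = P & agree [::] [:: 5%N] s1 s'].
  apply: (wp_post (Phi := I h)); last by move=> s' [].
  apply: (@wp_while _ _ h 1).
  - move=> j s' jh [e5 e4 ag] _; split.
      by rewrite (testE j)//; apply/negP => /hmin; rewrite leqNgt jh.
    apply: wp_rset; split.
    + by rewrite arr_cell_same /= e5 exprSr.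
    + by rewrite arr_cell_neq.
    + by apply: (agree_trans ag); exact: agree_set_cell.
  - by move=> s' [e5 e4 ag]; rewrite (testE h)// hX.
  - by split; rewrite ?arr_cell_same// arr_cell_neq.
apply: (@wp_le _ _ ((h * 2).+1 + ((4 * m.+1) * 4 + 3).+2).+3); first by lia.
apply: wp_rset_seq; apply: (wp_seq w2) => s2 [e5 e4] [ag2 _].
apply: wp_rset_seq; set s3 := set_cell _ 6 _ _ _.
apply: (wp_post (Phi := fun s' => arr s' 6 0%N 0%N = 2 ^+ (h * (4 * m.+1)) /\
   arr s' 5 0%N 0%N = 2 ^+ h)); last by move=> s' [h6 h5] _; exists h.
apply: (wp_for (I := fun j A => A 6%N 0%N 0%N = 2 ^+ (h * j) /\ A 5%N 0%N 0%N = 2 ^+ h)) => //.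
- by rewrite ieval_mul /= ag2//= sm addn1.
- by rewrite arr_cell_same muln0 expr0 arr_cell_neq.
move=> j s' jm sj [h6 h5] _; apply: wp_rset.
rewrite arr_cell_same arr_cell_neq//= h6 h5; split => //.
by rewrite mulnS exprD mulrC.
Qed.

Lemma wp_prep (n m Kb : nat) (x d : nat -> nat -> R) (y e : nat -> R) (P : R) s :
  ctr s 0 = n -> ctr s 1 = m ->
  (forall i j, (i < n)%N -> (j < m)%N -> arr s 0 i j = x i j /\ arr s 1 i j = d i j) ->
  (forall j, (j < m)%N -> arr s 2 0%N j = y j /\ arr s 3 0%N j = e j) ->
  P = (\prod_(i < n) \prod_(j < m) entry_factor (x i j) (d i j)) *
      \prod_(j < m) entry_factor (y j) (e j) ->
  2 * (m.+1%:R * m.+1%:R) * P <= 2 ^+ Kb ->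
  wp p (n * (m * 6 + 6) + m * 6 + Kb * 2 + (4 * m.+1) * 4 + 30) prep_cmd (fun s' =>
    [/\ forall i j, (i < n)%N -> (j < m)%N -> arr s' 0 i j = x i j / d i j,
        forall j, (j < m)%N -> arr s' 2 0%N j = y j / e j &
        exists2 h : nat, (h <= Kb)%N & [/\ arr s' 5 0%N 0%N = 2 ^+ h,
          2 * (m.+1%:R * m.+1%:R) * P <= 2 ^+ h &
          arr s' 6 0%N 0%N = 2 ^+ (h * (4 * m.+1))]]) s.
Proof.
move=> sn sm hx hy PE hK.
apply: (@wp_le _ _ ((n * (m * 6 + 3).+3 + 3) + ((m * 6 + 3) +
   (Kb * 2 + (4 * m.+1) * 4 + 12)).+1).+3); first by lia.
apply: wp_rset_seq; set s1 := set_cell _ 4 _ _ _.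
pose I i A := A 4%N 0%N 0%N = \prod_(i' < i) \prod_(j < m) entry_factor (x i' j) (d i' j) /\
  forall i' j, (i' < n)%N -> (j < m)%N ->
    A 0%N i' j = if (i' < i)%N then x i' j / d i' j else x i' j.
apply: (wp_seq (Psi := fun s' => I n (arr s'))).
  apply: wp_for => //.
    by split => [|i' j ni mj]; rewrite ?arr_cell_same ?big_ord0// arr_cell_neq//; case: (hx i' j ni mj).
  move=> i s' ni si [h4 h0] [ag agA].
  have h : wp p (m * 6 + 3) (ratio_cmd 0 1 (IVar 2)) _ s' :=
     @wp_ratio 0 1 (IVar 2) i m (x i) (d i) s' isT isT isT isT si _ _ _.
  apply: (wp_post (h _ _ _)).
  - by rewrite ag.
  - by move=> j mj; rewrite h0// ltnn.
  - by move=> j mj; rewrite agA// arr_cell_neq//; case: (hx i j ni mj).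
  move=> s2 [h4' h0' h0''] _; split; first by rewrite h4' h4 big_ord_recr.
  move=> i' j ni' mj; rewrite ltnS leq_eqVlt; case: eqP => [->|/eqP ii]; first exact: h0'.
  by rewrite h0''// h0.
move=> s2 [h4 h0] [ag2 agA2].
have m2 : ctr s2 1 = m by rewrite ag2.
have h2 : wp p (m * 6 + 3) (ratio_cmd 2 3 (IConst 0)) _ s2 :=
   @wp_ratio 2 3 (IConst 0) 0 m y e s2 isT isT isT isT erefl m2 _ _.
apply: (wp_seq (h2 _ _)).
- by move=> j mj; rewrite agA2// arr_cell_neq//; case: (hy j mj).
- by move=> j mj; rewrite agA2// arr_cell_neq//; case: (hy j mj).
move=> s3 [h4' h2' _] [ag3 agA3].
apply: (wp_post (@wp_bound m Kb P s3 _ _ hK)).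
- by rewrite ag3.
- by rewrite h4' h4 PE.
move=> s4 H [_ agA4]; split => //.
- by move=> i j ni mj; rewrite agA4// agA3// h0// ni.
- by move=> j mj; rewrite agA4// h2'.
Qed.

Lemma wp_gs (n m : nat) (b : nat -> nat -> R) s : ctr s 0 = n -> ctr s 1 = m ->
  (forall i j, (i < n)%N -> (j < m)%N -> arr s 0 i j = b i j) ->
  wp p (n * (m * 4 + 3 + (n * (m * 10 + 14) + 3)).+4 + 3) gs_cmd (fun s' =>
    forall i j, (i < n)%N -> (j < m)%N -> arr s' 15 i j = gs m b i j) s.
Proof.
move=> sn sm hb.
apply: (wp_for (I := fun i A => forall i' j, (i' < i)%N -> (j < m)%N -> A 15%N i' j = gs m b i' j)) => //.
move=> i s' ni si h15 [ag agA].
have m' : ctr s' 1 = m by rewrite ag.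
have b' i' j : (i' < n)%N -> (j < m)%N -> arr s' 0 i' j = b i' j.
  by move=> ? ?; rewrite agA// hb.
(* Classical Gram-Schmidt: the coefficients come from the original row [b i] and not from the partly
   reduced one, in agreement with [gsE]. *)
pose c k := dotn m (b i) (gs m b k) / dotn m (gs m b k) (gs m b k).
apply: (@wp_le _ _ ((m * 4 + 3) + (i * ((m * 6 + 7) + (m * 4 + 3)).+4 + 3)).+1).
  by rewrite ltnS leq_add2l leq_add2r; apply: leq_mul; [exact: ltnW | lia].
pose I1 j A := (forall k, (k < j)%N -> A 15%N i k = b i k) /\
  forall i', i' != i -> A 15%N i' = arr s' 15 i'.
apply: (wp_seq (Psi := fun s1 => I1 m (arr s1))).
  apply: wp_for => //.
  move=> j s1 mj sj [h1 h2] [ag1 agA1]; apply: wp_rset.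
  have i1 : ctr s1 2 = i by rewrite ag1.
  rewrite /= i1 sj; split.
    move=> k; rewrite ltnS leq_eqVlt => kj; rewrite /= !eqxx /=.
    case: eqP => [->|/eqP/negbTE kj']; first by rewrite agA1// b'.
    by apply: h1; move: kj; rewrite kj'.
  by move=> i' i'i; rewrite -h2//; apply/funext => k; rewrite /= (negbTE i'i).
move=> s1 [h1 h2] [ag1 agA1].
pose I2 k A := (forall j, (j < m)%N -> A 15%N i j = b i j - \sum_(l < k) c l * gs m b l j) /\
  forall i', i' != i -> A 15%N i' = arr s' 15 i'.
apply: (wp_post (Phi := fun s2 => I2 i (arr s2))); last first.
  move=> s2 [g1 g2] _ i' j; rewrite ltnS leq_eqVlt => /predU1P[->|ii] mj.
    by rewrite g1// gsE.
  by rewrite g2 ?(ltn_eqF ii)// h15.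
apply: wp_for => //.
- by rewrite /= ag1.
- by split => // j mj; rewrite h1// big_ord0 subr0.
move=> k s2 ki sk [g1 g2] [ag2 agA2].
have i2 : ctr s2 2 = i by rewrite ag2//= ag1.
have m2 : ctr s2 1 = m by rewrite ag2//= ag1.
have gk j : (j < m)%N -> arr s2 15 k j = gs m b k j.
  by move=> mj; rewrite g2 ?(ltn_eqF ki)// h15.
apply: (wp_seq (@wp_dot R p _ _ (b i) (gs m b k) m s2 m2 _)).
  move=> j s3 mj sj [ag3 agA3] /=.
  have i3 : ctr s3 2 = i by rewrite ag3.
  have k3 : ctr s3 4 = k by rewrite ag3.
  by rewrite !agA3// i3 k3 sj gk// agA2// agA1// b'.
move=> s3 [e8 e9] [ag3 agA3].
have E15 : arr s3 15 = arr s2 15 by rewrite agA3.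
pose I3 j A := (forall j', (j' < m)%N -> A 15%N i j' =
    if (j' < j)%N then b i j' - \sum_(l < k.+1) c l * gs m b l j'
    else b i j' - \sum_(l < k) c l * gs m b l j') /\
  forall i', i' != i -> A 15%N i' = arr s' 15 i'.
apply: (wp_post (Phi := fun s4 => I3 m (arr s4))); last first.
  by move=> s4 [f1 f2] _; split => // j mj; rewrite f1// mj.
apply: wp_for => //.
- by rewrite /= ag3.
- by split => [j mj|i' ii]; rewrite E15; [exact: g1 | exact: g2].
move=> j s4 mj sj [f1 f2] [ag4 agA4]; apply: wp_rset.
have i4 : ctr s4 2 = i by rewrite ag4//= ag3.
have k4 : ctr s4 4 = k by rewrite ag4//= ag3.
have [E8 E9] : arr s4 8 = arr s3 8 /\ arr s4 9 = arr s3 9 by rewrite !agA4.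
rewrite /= i4 sj k4; split.
  move=> j' mj'; rewrite /= !eqxx /=; case: eqP => [->|/eqP/negbTE jj].
    rewrite ltnSn E8 E9 e8 e9 f1// ltnn big_ord_recr /= opprD addrA -/(c k).
    by rewrite f2 ?(ltn_eqF ki)// h15.
  by rewrite f1// ltnS [in RHS]leq_eqVlt jj.
by move=> i' i'i; rewrite -f2//; apply/funext => j'; rewrite /= (negbTE i'i).
Qed.

End Preparation.

(** * Nearest-plane decoding and the best point so far *)

Section Decoding.
Variables (R : realType) (p : R) (n m h : nat) (b : nat -> nat -> R) (t : nat -> R).
Hypothesis gs0 : forall i, (i < n)%N -> dotn m (gs m b i) (gs m b i) != 0.
Implicit Types (s : store R) (A : nat -> nat -> nat -> R).

Let K := (h * (4 * m.+1))%N.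

(** What all commands between the preprocessing and the final output only read. *)
Record ctx s : Prop := Ctx {
  ctx_n : ctr s 0 = n;
  ctx_m : ctr s 1 = m;
  ctx_b : forall i j, (i < n)%N -> (j < m)%N -> arr s 0 i j = b i j;
  ctx_t : forall j, (j < m)%N -> arr s 2 0%N j = t j;
  ctx_gs : forall i j, (i < n)%N -> (j < m)%N -> arr s 15 i j = gs m b i j;
  ctx_H : arr s 5 0%N 0%N = 2 ^+ h;
  ctx_W : arr s 6 0%N 0%N = 2 ^+ K }.

Lemma ctx_agree (X Y : seq nat) s s' : agree X Y s s' -> ~~ has (mem X) [:: 0%N; 1%N] ->
  ~~ has (mem Y) [:: 0%N; 2%N; 15%N; 5%N; 6%N] -> ctx s -> ctx s'.
Proof.
move=> [aX aA] /=; rewrite !negb_or /= => /and3P[x0 x1 _] /and5P[a0 a2 a15 a5 /andP[a6 _]].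
by case=> *; split => *; rewrite ?aX// ?aA//; auto.
Qed.

(** For an integer target of size at most [2^K], the expansion is within [2 E j] of it before pass
    [j], where [E j = 2^(K - j)], and each pass halves this. After [K + 1] passes two integers
    differ by less than [1]. For any other [c] the result is still an integer. *)
Lemma wp_round (c : R) s : arr s 6 0%N 0%N = 2 ^+ K -> arr s 10 0%N 0%N = c ->
  wp p (K.+1 * 8 + 5) round_cmd (fun s' => exists2 y : int, arr s' 11 0%N 0%N = y%:~R &
    forall z : int, c = z%:~R -> `|z%:~R : R| <= 2 ^+ K -> y = z) s.
Proof.
move=> s6 s10; apply: (@wp_le _ _ (K.+1 * 8).+1.+4); first by lia.
apply: wp_rset_seq; apply: wp_rset_seq; set s0 := set_cell _ 12 _ _ _.
pose E j : R := 2 ^+ K / 2 ^+ j.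
have E0 j : 0 < E j by rewrite divr_gt0// exprn_gt0.
have ES j : E j.+1 = E j / 2 by rewrite /E exprSr invfM mulrA.
have Eint j : (j <= K)%N -> E j = (2 ^+ (K - j) : int)%:~R.
  move=> jK; rewrite /E rmorphXn /= -{1}(subnK jK) exprD mulfK// expf_neq0.
pose I j s' := arr s' 12 0%N 0%N = E j /\ exists y : int,
  [/\ arr s' 11 0%N 0%N = y%:~R, arr s' 10 0%N 0%N = c - y%:~R &
  forall z : int, c = z%:~R -> `|z%:~R : R| <= 2 ^+ K -> `|z%:~R - y%:~R : R| < 2 * E j].
apply: (wp_post (Phi := I K.+1)); last first.
  move=> s' [_ [y [e11 _ hy]]] _; exists y => // z cz zK.
  have := hy z cz zK; rewrite ES mulrCA mulfV// mulr1 /E divff ?expf_neq0//.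
  rewrite -intrB -intr_norm -[1]/(1%:~R) ltr_int ltr_norml => h1.
  by lia.
apply: (@wp_while _ _ K.+1 7); last 2 first.
- move=> s' [e12 _] /=; rewrite e12 -ltNge ES /E divff ?expf_neq0//.
  by rewrite div1r invf_lt1// ltr1n.
- split; first by rewrite /= s6 /E expr0 divr1.
  exists 0; rewrite /= s10 subr0; split => // z _ zK.
  rewrite subr0 (le_lt_trans zK)// /E expr0 divr1 ltr_pMl ?exprn_gt0//.
  by rewrite ltr1n.
move=> j s' jK [e12 [y [e11 e10 hy]]] _; split.
  by rewrite /= e12 /E ler_pdivlMr ?exprn_gt0// mul1r ler_eXn2l// ltr1n.
have jK' : (j <= K)%N by rewrite -ltnS.
pose e : int := 2 ^+ (K - j).
have eE : E j = e%:~R by exact: Eint.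
have last_step s1 (y1 : int) : arr s1 12 0%N 0%N = E j -> arr s1 11 0%N 0%N = y1%:~R ->
    arr s1 10 0%N 0%N = c - y1%:~R ->
    (forall z : int, c = z%:~R -> `|z%:~R : R| <= 2 ^+ K -> `|z%:~R - y1%:~R : R| < E j) ->
    wp p 1 (set_scal 12 (RDiv (scal 12) (num 2))) (I j.+1) s1.
  move=> f12 f11 f10 hy1; apply: wp_rset; split.
    by rewrite arr_cell_same /= f12 ES.
  exists y1; rewrite !arr_cell_neq//; split => // z cz zK.
  by rewrite ES mulrCA mulfV// mulr1 hy1.
pose J s1 := arr s1 12 0%N 0%N = E j /\ exists y1 : int,
  [/\ arr s1 11 0%N 0%N = y1%:~R, arr s1 10 0%N 0%N = c - y1%:~R &
  forall z : int, c = z%:~R -> `|z%:~R : R| <= 2 ^+ K -> `|z%:~R - y1%:~R : R| < E j].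
apply: (@wp_le _ _ (5 + 1).+1) => //.
apply: (wp_seq (Psi := J)); last first.
  by move=> s1 [f12 [y1 [f11 f10 hy1]]] _; exact: last_step f12 f11 f10 hy1.
apply: (@wp_if _ _ 4) => /=; rewrite e12 e10 => test.
  apply: (@wp_le _ _ 3) => //; apply: wp_rset_seq; apply: wp_rset; split.
    by rewrite !arr_cell_neq.
  exists (y + e); rewrite arr_cell_same arr_cell_neq// arr_cell_same /=.
  rewrite e12 e11 e10 intrD -eE; split => //; first by rewrite opprD addrA.
  move=> z cz zK; have := hy z cz zK; rewrite cz in test; move: test (E0 j).
  move: (E j) (z%:~R) (y%:~R) => E1 z1 y1 test E1p.
  by rewrite !ltr_norml => /andP[g1 g2]; apply/andP; split; lra.
apply: (@wp_if _ _ 3) => /=; rewrite e12 e10 => test2.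
  apply: wp_rset_seq; apply: wp_rset; split.
    by rewrite !arr_cell_neq.
  exists (y - e); rewrite arr_cell_same arr_cell_neq// arr_cell_same /=.
  rewrite e12 e11 e10 intrB -eE; split => //; first by rewrite opprB addrA addrAC.
  move=> z cz zK; have := hy z cz zK; rewrite cz in test2; move: test2 (E0 j).
  move: (E j) (z%:~R) (y%:~R) => E1 z1 y1 test2' E1p.
  by rewrite !ltr_norml => /andP[g1 g2]; apply/andP; split; lra.
apply: (@wp_le _ _ 1) => //; apply: wp_skip; split => //; exists y; split => // z cz zK.
rewrite cz in test test2; move: test test2; rewrite -!ltNge ltr_norml.
by move=> g1 g2; apply/andP; split; lra.
Qed.

(** After [i] rows the coefficients of index below [n - i] are still zero; the others are those of
    [u] if [u] is a lattice point with bounded coefficients. For any input whatsoever the output is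
    a lattice point. *)
Lemma wp_decode (u : nat -> R) s : ctx s -> (forall j, (j < m)%N -> arr s 18 0%N j = u j) ->
  (forall j, (j < m)%N -> arr s 19 0%N j = 0) ->
  wp p (n * (m * 10 + K.+1 * 8 + 24) + 3) decode_cmd (fun s' => exists y : nat -> int,
    (forall j, (j < m)%N -> arr s' 19 0%N j = \sum_(k < n) (y k)%:~R * b k j) /\
    forall z : nat -> int, (forall j, (j < m)%N -> u j = \sum_(k < n) (z k)%:~R * b k j) ->
      (forall k, (k < n)%N -> `|(z k)%:~R : R| <= 2 ^+ K) ->
      forall k, (k < n)%N -> y k = z k) s.
Proof.
move=> cs su s19.
pose I i A := exists y : nat -> int,
    [/\ forall j, (j < m)%N -> A 19%N 0%N j = \sum_(k < n) (y k)%:~R * b k j,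
    forall k, (k < n - i)%N -> y k = 0 &
    forall z : nat -> int, (forall j, (j < m)%N -> u j = \sum_(k < n) (z k)%:~R * b k j) ->
      (forall k, (k < n)%N -> `|(z k)%:~R : R| <= 2 ^+ K) ->
      forall k, (n - i <= k < n)%N -> y k = z k].
apply: (wp_post (Phi := fun s' => I n (arr s'))); last first.
  move=> s' [y [h1 _ h3]] _; exists y; split => // z hz zK k kn.
  by apply: h3 => //; rewrite subnn.
apply: (@wp_le _ _ (n * (m * 10 + K.+1 * 8 + 21).+3 + 3)); first by lia.
apply: wp_for => //.
- exact: ctx_n.
- exists (fun=> 0); split => //.
    by move=> j mj; rewrite s19// big1// => k _; rewrite mul0r.
  by move=> z _ _ k; rewrite subn0 => /andP[a c]; have := leq_trans c a; rewrite ltnn.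
move=> i s' ni si [y [hv hy0 hyz]] ag.
have cs' : ctx s' by apply: ctx_agree ag _ _ cs.
have u' j : (j < m)%N -> arr s' 18 0%N j = u j by move=> mj; case: ag => _ ->; rewrite ?su.
pose r := (n - 1 - i)%N.
have rn : (r < n)%N by rewrite /r; lia.
have rE s1 : ctr s1 0 = n -> ctr s1 2 = i -> ieval s1 row_down = r by move=> /= -> ->.
pose w j := \sum_(k < n) (y k)%:~R * b k j.
apply: (@wp_le _ _ ((m * 6 + 7) + ((K.+1 * 8 + 5) + (m * 4 + 3)).+3).+1); first by lia.
apply: (wp_seq (@wp_dot R p _ _ (fun j => u j - w j) (gs m b r) m s' (ctx_m cs') _)).
  move=> j s1 mj sj ag1 /=; have cs1 : ctx s1 by apply: ctx_agree ag1 _ _ cs'.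
  have i1 : ctr s1 2 = i by case: ag1 => ->.
  have r1 : (ctr s1 0 - 1 - ctr s1 2)%N = r by rewrite (ctx_n cs1) i1.
  rewrite r1 sj (ctx_gs cs1)//; case: ag1 => _ aA1.
  by rewrite !aA1// u'// hv.
move=> s1 [e8 e9] ag1; have cs1 : ctx s1 by apply: ctx_agree ag1 _ _ cs'.
have V1 : arr s1 19 = arr s' 19 by case: ag1 => _ ->.
have i1 : ctr s1 2 = i by case: ag1 => ->.
pose c := dotn m (fun j => u j - w j) (gs m b r) / dotn m (gs m b r) (gs m b r).
apply: wp_rset_seq; set s2 := set_cell _ 10 _ _ _.
have ag2 : agree [::] [:: 10%N] s1 s2 by exact: agree_set_cell.
have cs2 : ctx s2 by apply: ctx_agree ag2 _ _ cs1.
have c10 : arr s2 10 0%N 0%N = c by rewrite arr_cell_same /= e8 e9.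
apply: (wp_seq (wp_round (ctx_W cs2) c10)) => s3 [yr y11 yrz] ag3.
have cs3 : ctx s3 by apply: ctx_agree ag3 _ _ cs2.
have V3 : arr s3 19 = arr s' 19 by case: ag3 => _ ->; rewrite // -V1; case: ag2 => _ ->.
have i3 : ctr s3 2 = i by case: ag3 => ->; rewrite //=.
pose J j A := forall j', (j' < m)%N -> A 19%N 0%N j' =
  if (j' < j)%N then w j' + yr%:~R * b r j' else w j'.
apply: (wp_post (Phi := fun s4 => J m (arr s4))).
  apply: wp_for => //; first exact: ctx_m.
    by move=> j mj; rewrite V3 hv.
  move=> j s4 mj sj h4 ag4; apply: wp_rset.
  have cs4 : ctx s4 by apply: ctx_agree ag4 _ _ cs3.
  have i4 : ctr s4 2 = i by case: ag4 => ->.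
  have y4 : arr s4 11 0%N 0%N = yr%:~R by case: ag4 => _ ->.
  move=> j' mj'; rewrite /= (ctx_n cs4) i4 sj -/r; case: eqP => [->|/eqP/negbTE jj].
    by rewrite ltnSn h4// ltnn y4 (ctx_b cs4).
  by rewrite h4// ltnS [in RHS]leq_eqVlt jj.
move=> s4 h4 _.
pose y' k := y k + (if k == r then yr else 0).
have yr0 : y r = 0 by apply: hy0; rewrite /r; lia.
exists y'; split.
- move=> j mj; rewrite h4// mj /w (bigD1 (Ordinal rn))//= [RHS](bigD1 (Ordinal rn))//=.
  rewrite /y' eqxx yr0 mul0r !add0r addrC; congr (_ + _); apply: eq_bigr => k kr.
  rewrite (_ : (k : nat) == r = false) ?addr0//; apply/negbTE; apply: contra kr => /eqP e.
  by apply/eqP/val_inj.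
- move=> k kn; rewrite /y' hy0; last by lia.
  by rewrite (_ : k == r = false) ?addr0//; apply/negbTE; rewrite /r; lia.
move=> z hz zK k kn; rewrite /y'; case: eqP => [->|kr]; last first.
  by rewrite addr0 (hyz z hz zK)//; move: kn kr; rewrite /r; lia.
rewrite yr0 add0r; apply: yrz; last exact: zK.
rewrite /c; have -> : dotn m (fun j => u j - w j) (gs m b r) =
    dotn m (fun j => \sum_(k < n) ((z k)%:~R - (y k)%:~R) * b k j) (gs m b r).
  apply: eq_bigr => j _; congr (_ * _); rewrite hz// /w -sumrB.
  by apply: eq_bigr => k' _; rewrite mulrBl.
(* In the remainder the coefficients above [r] cancel, so that the quotient is exactly the
   coefficient [z r]. *)
have zy0 k' : (r < k' < n)%N -> (z k')%:~R - (y k')%:~R = 0 :> R.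
  by move=> rk; rewrite (hyz z hz zK) ?subrr//; move: rk; rewrite /r; lia.
rewrite (@dotn_lattice_gs R m b n (fun k => (z k)%:~R - (y k)%:~R) r rn zy0).
by rewrite yr0 subr0 mulfK// gs0.
Qed.

Definition dist_to_t (f : nat -> R) : R := \sum_(j < m) `|f j - t j| `^ p.

Lemma wp_target (al : R) (y : nat -> R) s : ctx s -> arr s 7 0%N 0%N = al ->
  (forall j, (j <= m)%N -> arr s 17 (ctr s 6) j = y j) ->
  wp p (m * 6 + 3) target_cmd (fun s' => forall j, (j < m)%N ->
    arr s' 18 0%N j = t j - 2 * y m * y j / al /\ arr s' 19 0%N j = 0) s.
Proof.
move=> cs s7 sy.
apply: (wp_for (I := fun j A => forall j', (j' < j)%N ->
  A 18%N 0%N j' = t j' - 2 * y m * y j' / al /\ A 19%N 0%N j' = 0)) => //.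
  exact: ctx_m.
move=> j s' mj sj h' ag; have cs' : ctx s' by apply: ctx_agree ag _ _ cs.
have [aX aA] := ag; have s6 : ctr s' 6 = ctr s 6 by rewrite aX.
have s7' : arr s' 7 0%N 0%N = al by rewrite aA.
have s17' : arr s' 17 = arr s 17 by rewrite aA.
apply: wp_rset_seq; apply: wp_rset => j'; rewrite ltnS leq_eqVlt /= (ctx_m cs') sj s6.
move=> /predU1P[->|jj]; last by rewrite (ltn_eqF jj) /=; exact: h'.
by rewrite !eqxx /= s7' s17' (ctx_t cs')// !sy// ltnW.
Qed.

Lemma wp_keep_best (v w : nat -> R) s : ctx s ->
  (forall j, (j < m)%N -> arr s 19 0%N j = v j) ->
  (forall j, (j < m)%N -> arr s 20 0%N j = w j) ->
  wp p (m * 10 + 12) keep_best_cmd (fun s' => forall j, (j < m)%N ->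
    arr s' 20 0%N j = if dist_to_t v <= dist_to_t w then v j else w j) s.
Proof.
move=> cs sv sw; apply: (@wp_le _ _ ((m * 6 + 3) + (m * 4 + 3).+1).+1.+4); first by lia.
apply: wp_rset_seq; apply: wp_rset_seq; set s0 := set_cell _ 14 _ _ _.
have ag0 : agree [::] [:: 13%N; 14%N] s s0.
  by apply: (agree_trans (s2 := set_cell s 13 0 0 0)); apply: agree_set_cell.
have cs0 : ctx s0 by apply: ctx_agree ag0 _ _ cs.
pose I j A := A 13%N 0%N 0%N = \sum_(k < j) `|v k - t k| `^ p /\
   A 14%N 0%N 0%N = \sum_(k < j) `|w k - t k| `^ p.
apply: (wp_seq (Psi := fun s1 => I m (arr s1))).
  apply: wp_for => //; first exact: ctx_m.
    by split; rewrite big_ord0 ?arr_cell_same// arr_cell_neq// arr_cell_same.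
  move=> j s1 mj sj [h13 h14] ag1; have cs1 : ctx s1 by apply: ctx_agree ag1 _ _ cs0.
  have v1 : arr s1 19 = arr s 19 by case: ag1 => _ ->//; case: ag0 => _ ->.
  have w1 : arr s1 20 = arr s 20 by case: ag1 => _ ->//; case: ag0 => _ ->.
  apply: wp_rset_seq; apply: wp_rset; rewrite /I arr_cell_neq// !arr_cell_same /=.
  by rewrite sj h13 h14 v1 w1 sv// sw// (ctx_t cs1)// !big_ord_recr.
move=> s1 [h13 h14] ag1; have cs1 : ctx s1 by apply: ctx_agree ag1 _ _ cs0.
have v1 : arr s1 19 = arr s 19 by case: ag1 => _ ->//; case: ag0 => _ ->.
have w1 : arr s1 20 = arr s 20 by case: ag1 => _ ->//; case: ag0 => _ ->.
apply: (@wp_if _ _ (m * 4 + 3)) => /=; rewrite h13 h14 -/(dist_to_t v) -/(dist_to_t w) => test.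
  rewrite test.
  pose J j A := forall j', (j' < m)%N -> A 20%N 0%N j' = if (j' < j)%N then v j' else w j'.
  apply: (wp_post (Phi := fun s2 => J m (arr s2))); last by move=> s2 h2 _ j mj; rewrite h2// mj.
  apply: wp_for => //; first exact: ctx_m.
    by move=> j mj; rewrite w1 sw.
  move=> j s2 mj sj h2 [_ aA2]; apply: wp_rset => j' mj' /=; rewrite sj.
  case: eqP => [->|/eqP/negbTE e]; first by rewrite ltnSn aA2// v1 sv.
  by rewrite h2// ltnS [in RHS]leq_eqVlt e.
apply: (@wp_le _ _ 1); first by lia.
by apply: wp_skip => j mj; rewrite (negbTE test) w1 sw.
Qed.

Definition in_lattice (w : nat -> R) := exists y : nat -> int,
  forall j, (j < m)%N -> w j = \sum_(k < n) (y k)%:~R * b k j.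

Definition decodable (u : nat -> R) := exists2 z : nat -> int,
  forall j, (j < m)%N -> u j = \sum_(k < n) (z k)%:~R * b k j &
  forall k, (k < n)%N -> `|(z k)%:~R : R| <= 2 ^+ K.

Definition time_sample := (n * (m * 10 + K.+1 * 8 + 24) + m * 16 + 20)%N.

Lemma wp_sample (al : R) (y w : nat -> R) s : ctx s -> arr s 7 0%N 0%N = al ->
  (forall j, (j <= m)%N -> arr s 17 (ctr s 6) j = y j) ->
  (forall j, (j < m)%N -> arr s 20 0%N j = w j) -> in_lattice w ->
  wp p time_sample sample_cmd (fun s' => exists w' : nat -> R,
    [/\ forall j, (j < m)%N -> arr s' 20 0%N j = w' j, in_lattice w',
        dist_to_t w' <= dist_to_t w &
        let u j := t j - 2 * y m * y j / al in
        decodable u -> dist_to_t w' <= dist_to_t u]) s.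
Proof.
move=> cs s7 sy sw lw; pose u j := t j - 2 * y m * y j / al.
apply: (@wp_le _ _ ((m * 6 + 3) + ((n * (m * 10 + K.+1 * 8 + 24) + 3) + (m * 10 + 12)).+1).+1).
  by rewrite /time_sample; lia.
apply: (wp_seq (wp_target cs s7 sy)) => s1 h1 ag1.
have cs1 : ctx s1 by apply: ctx_agree ag1 _ _ cs.
have u1 j : (j < m)%N -> arr s1 18 0%N j = u j by move=> /h1[].
have v1 j : (j < m)%N -> arr s1 19 0%N j = 0 by move=> /h1[].
apply: (wp_seq (wp_decode cs1 u1 v1)) => s2 [z [z1 z2]] ag2.
have cs2 : ctx s2 by apply: ctx_agree ag2 _ _ cs1.
have w2 j : (j < m)%N -> arr s2 20 0%N j = w j.
  by move=> mj; case: ag2 => _ ->//; case: ag1 => _ ->//; rewrite sw.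
apply: (wp_post (wp_keep_best cs2 z1 w2)) => s3 h3 _.
set v := (fun j => \sum_(k < n) _) in h3.
exists (if dist_to_t v <= dist_to_t w then v else w); split => //.
- by move=> j mj; rewrite h3//; case: ifP.
- by case: ifP => _ //; exists z.
- by case: ifP.
move=> ud [z' uz' zK]; have -> : dist_to_t ud = dist_to_t v.
  apply: eq_bigr => j _; congr (`|_ - _| `^ _); rewrite uz'// /v.
  by apply: eq_bigr => k _; rewrite (z2 z' uz' zK).
by case: ifPn => //; rewrite -ltNge => /ltW.
Qed.

Lemma wp_samples (M : nat) (al : R) (y : nat -> nat -> R) (w : nat -> R) s :
  ctx s -> ctr s 5 = M -> arr s 7 0%N 0%N = al ->
  (forall q j, (q < M)%N -> (j <= m)%N -> arr s 17 q j = y q j) ->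
  (forall j, (j < m)%N -> arr s 20 0%N j = w j) -> in_lattice w ->
  wp p (M * time_sample.+3 + 3) (for_loop 6 (IVar 5) sample_cmd) (fun s' =>
    exists w' : nat -> R,
    [/\ forall j, (j < m)%N -> arr s' 20 0%N j = w' j, in_lattice w',
        dist_to_t w' <= dist_to_t w &
        forall q, (q < M)%N -> let u j := t j - 2 * y q m * y q j / al in
        decodable u -> dist_to_t w' <= dist_to_t u]) s.
Proof.
move=> cs s5 s7 sy sw lw.
apply: (wp_for (I := fun q A => exists w' : nat -> R,
    [/\ forall j, (j < m)%N -> A 20%N 0%N j = w' j, in_lattice w',
        dist_to_t w' <= dist_to_t w &
        forall q', (q' < q)%N -> let u j := t j - 2 * y q' m * y q' j / al in
        decodable u -> dist_to_t w' <= dist_to_t u])) => //.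
  by exists w.
move=> q s' qM sq [w1 [h1 lw1 ww1 hq]] ag.
have cs' : ctx s' by apply: ctx_agree ag _ _ cs.
have [aX aA] := ag.
have y' j : (j <= m)%N -> arr s' 17 (ctr s' 6) j = y q j by move=> jm; rewrite sq aA// sy.
have s7' : arr s' 7 0%N 0%N = al by rewrite aA.
apply: (wp_post (wp_sample cs' s7' y' h1 lw1)).
move=> s2 [w2 [g1 g2 g3 g4]] _; exists w2; split => //; first exact: le_trans ww1.
move=> q'; rewrite ltnS leq_eqVlt => /predU1P[->//|qq'] u hu.
exact: le_trans (hq _ qq' hu).
Qed.

Lemma wp_build (al : R) s : ctx s -> arr s 7 0%N 0%N = al ->
  wp p (n * (m * 4 + 8) + m * 4 + 10) build_cmd (fun s' =>
    [/\ forall i j, (i < n)%N -> (j < m)%N -> arr s' 16 i j = al * b i j,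
        forall i, (i < n)%N -> arr s' 16 i m = 0,
        forall j, (j < m)%N -> arr s' 16 n j = al * t j &
        arr s' 16 n m = 2^-1]) s.
Proof.
move=> cs s7.
apply: (@wp_le _ _ ((n * (m * 4 + 3).+2.+3 + 3) + (m * 4 + 3).+2).+1); first by lia.
pose I i A := forall i', (i' < i)%N -> A 16%N i' m = 0 /\
  forall j, (j < m)%N -> A 16%N i' j = al * b i' j.
apply: (wp_seq (Psi := fun s1 => I n (arr s1))).
  apply: wp_for => //; first exact: ctx_n.
  move=> i s1 ni si hI ag; have cs1 : ctx s1 by apply: ctx_agree ag _ _ cs.
  apply: wp_rset_seq; set s2 := set_cell _ 16 _ _ _.
  have ag2 : agree [::] [:: 16%N] s1 s2 by exact: agree_set_cell.
  have cs2 : ctx s2 by apply: ctx_agree ag2 _ _ cs1.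
  pose J j A := [/\ forall i', (i' < i)%N -> A 16%N i' = arr s1 16 i', A 16%N i m = 0 &
     forall j', (j' < j)%N -> A 16%N i j' = al * b i j'].
  apply: (wp_post (Phi := fun s3 => J m (arr s3))); last first.
    move=> s3 [g1 g2 g3] _ i'; rewrite ltnS leq_eqVlt => /predU1P[->//|ii].
    by rewrite g1//; exact: hI.
  apply: wp_for => //; first exact: ctx_m.
    split => //; last by rewrite /= si (ctx_m cs1) !eqxx.
    by move=> i' ii; rewrite arr_cell_other//= si ltn_eqF.
  move=> j s3 mj sj [g1 g2 g3] ag3; have cs3 : ctx s3 by apply: ctx_agree ag3 _ _ cs2.
  have i3 : ctr s3 2 = i by case: ag3 => ->.
  have a3 : arr s3 7 0%N 0%N = al.
    by case: ag3 => _ ->//; case: ag2 => _ ->//; case: ag => _ ->.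
  apply: wp_rset; split.
  - by move=> i' ii; rewrite arr_cell_other ?g1//= i3 ltn_eqF.
  - by rewrite /= i3 sj !eqxx /= gtn_eqF.
  move=> j'; rewrite ltnS leq_eqVlt /= i3 sj !eqxx /= => /predU1P[->|jj].
    by rewrite eqxx a3 (ctx_b cs3).
  by rewrite ltn_eqF// g3.
move=> s1 h1 ag1; have cs1 : ctx s1 by apply: ctx_agree ag1 _ _ cs.
apply: wp_rset_seq; set s2 := set_cell _ 16 _ _ _.
have ag2 : agree [::] [:: 16%N] s1 s2 by exact: agree_set_cell.
have cs2 : ctx s2 by apply: ctx_agree ag2 _ _ cs1.
pose J j A := [/\ forall i, (i < n)%N -> A 16%N i = arr s1 16 i, A 16%N n m = 2^-1 &
     forall j', (j' < j)%N -> A 16%N n j' = al * t j'].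
apply: (wp_post (Phi := fun s3 => J m (arr s3))); last first.
  move=> s3 [g1 g2 g3] _; split => // [i j ni mj|i ni]; rewrite g1//.
    by case: (h1 i ni) => _; apply.
  by case: (h1 i ni).
apply: wp_for => //; first exact: ctx_m.
  split => //; last by rewrite /= (ctx_n cs1) (ctx_m cs1) !eqxx div1r.
  by move=> i ni; rewrite arr_cell_other//= (ctx_n cs1) ltn_eqF.
move=> j s3 mj sj [g1 g2 g3] ag3; have cs3 : ctx s3 by apply: ctx_agree ag3 _ _ cs2.
have a3 : arr s3 7 0%N 0%N = al.
  by case: ag3 => _ ->//; case: ag2 => _ ->//; case: ag1 => _ ->.
apply: wp_rset; split.
- by move=> i ni; rewrite arr_cell_other ?g1//= (ctx_n cs3) ltn_eqF.
- by rewrite /= (ctx_n cs3) sj !eqxx /= gtn_eqF.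
move=> j'; rewrite ltnS leq_eqVlt /= (ctx_n cs3) sj !eqxx /= => /predU1P[->|jj].
  by rewrite eqxx a3 (ctx_t cs3).
by rewrite ltn_eqF// g3.
Qed.

Lemma wp_out (w : nat -> R) s : ctr s 1 = m ->
  (forall j, (j < m)%N -> arr s 20 0%N j = w j) ->
  wp p (m * 4 + 3) out_cmd (fun s' => forall j, (j < m)%N -> arr s' 0 0%N j = w j) s.
Proof.
move=> sm sw.
apply: (wp_for (I := fun j A => forall j', (j' < j)%N -> A 0%N 0%N j' = w j')) => //.
move=> j s' mj sj h' [_ aA]; apply: wp_rset => j'; rewrite ltnS leq_eqVlt /= sj.
move=> /predU1P[->|jj]; first by rewrite eqxx aA// sw.
by rewrite ltn_eqF// h'.
Qed.

End Decoding.

(** * The success probability *)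

Definition mxfun (R : realType) n m (A : 'M[R]_(n, m)) (i j : nat) : R :=
  match insub i, insub j with Some i', Some j' => A i' j' | _, _ => 0 end.

Lemma mxfunE (R : realType) n m (A : 'M[R]_(n, m)) (i : 'I_n) (j : 'I_m) : mxfun A i j = A i j.
Proof. by rewrite /mxfun !valK. Qed.

Lemma mxfun_row (R : realType) m (t : 'rV[R]_m) (j : 'I_m) : mxfun t 0 j = t 0 j.
Proof. exact: mxfunE t ord0 j. Qed.

Section Solver.
Variables (R : realType) (p : R).
Hypotheses (p1 : 1 <= p) (p2 : p <= 2).
Variables (n m h : nat) (B : 'M[R]_(n, m)) (t : 'rV[R]_m) (rad : R).
Hypothesis fB : row_free B.
Hypothesis tH : forall j, `|t 0 j| <= 2 ^+ h.
Hypothesis coefW : forall z, (forall j, `|lat_pt B z 0 j| <= (4 * m%:R + 3) * 2 ^+ h) ->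
  forall i, `|(z 0 i)%:~R : R| <= 2 ^+ (h * (4 * m.+1)).
Implicit Types (s : store R) (z : 'rV[int]_n).

Local Notation bf := (mxfun B).
Local Notation tf := (mxfun t 0).
Local Notation context := (ctx n m h bf tf).

Lemma mxfun_indep i (e : nat -> R) : (i < n)%N ->
  ~ (forall j, (j < m)%N -> bf i j = \sum_(k < i) e k * bf k j).
Proof.
move=> ni H; pose v : 'rV[R]_n := \row_k (if (k : nat) == i then 1 else if (k < i)%N then - e k else 0).
have /rowP/(_ (Ordinal ni)) : v = 0.
  apply: (row_free_inj fB); rewrite mul0mx; apply/rowP => j; rewrite mxE [RHS]mxE.
  rewrite (bigD1 (Ordinal ni))//= mxE eqxx mul1r -[B _ _]mxfunE/= H//.
  rewrite (big_ord_widen n (fun k => e k * bf k j) (ltnW ni)) [X in _ + X]big_mkcond.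
  rewrite [X in X + _]big_mkcond -big_split big1//= => k _; rewrite mxE mxfunE.
  rewrite -(inj_eq val_inj) /=; case: ltngtP => //=; rewrite ?mul0r ?addr0//.
  by rewrite mulNr subrr.
by rewrite !mxE eqxx => /eqP; rewrite oner_eq0.
Qed.

Lemma lat_pt_coef z j : lat_pt B z 0 j = \sum_k (z 0 k)%:~R * B k j.
Proof. by rewrite [LHS]mxE; apply: eq_bigr => k _; rewrite [X in X * _]mxE. Qed.

Lemma in_lattice_row (w : nat -> R) : in_lattice n m bf w ->
  exists z, forall j : 'I_m, w j = lat_pt B z 0 j.
Proof.
move=> [y hy]; exists (\row_k y k) => j; rewrite hy// lat_pt_coef.
by apply: eq_bigr => k _; rewrite mxfunE [in RHS]mxE.
Qed.

Lemma row_in_lattice (w : nat -> R) z : (forall j : 'I_m, w j = lat_pt B z 0 j) ->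
  in_lattice n m bf w.
Proof.
move=> hw; exists (fun k => if insub k is Some k' then z 0 k' else 0) => j mj.
rewrite (hw (Ordinal mj)) lat_pt_coef; apply: eq_bigr => k _.
by rewrite valK -[j in RHS]/(nat_of_ord (Ordinal mj)) mxfunE.
Qed.

Lemma dist_to_tE (w : nat -> R) : dist_to_t p m tf w = pnorm_pow p (\row_(j < m) w j - t).
Proof.
by apply: eq_bigr => j _; rewrite row_subE mxfun_row; congr (`|_ - _| `^ _); rewrite mxE.
Qed.

(** The origin of [(4 m + 3) 2^h]: a coordinate of the difference is at most
    [(m + 1/2) / a <= (4 m + 2) 2^h], and one of [t] at most [2^h]. Since [p >= 1], a [p]-th power
    bounded by [m + 1/2 >= 1] has a base with the same bound. *)
Lemma lat_pt_bound (a : R) z : 0 < a -> a^-1 <= 4 * 2 ^+ h ->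
  pnorm_pow p (a *: (lat_pt B z - t)) <= m%:R + 2^-1 ->
  forall j, `|lat_pt B z 0 j| <= (4 * m%:R + 3) * 2 ^+ h.
Proof.
move=> a0 aH hz j; have m1 : 1 <= m%:R :> R by rewrite ler1n (leq_ltn_trans _ (ltn_ord j)).
have := le_trans (le_pnorm_pow p _ j) hz.
have -> : (a *: (lat_pt B z - t)) 0 j = a * (lat_pt B z 0 j - t 0 j) by rewrite [LHS]mxE row_subE.
rewrite normrM (gtr0_norm a0).
set r := `|_ - _| => hr; have r0 : 0 <= r by exact: normr_ge0.
have ar : a * r <= m%:R + 2^-1.
  rewrite leNgt; apply/negP => lt; move: hr; rewrite leNgt => /negP; apply.
  apply: (lt_le_trans lt); have ar1 : 1 <= a * r by move: lt m1; lra.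
  by rewrite -[leLHS]powRr1 ?mulr_ge0 ?(ltW a0)// ler_powR.
have rH : r <= (4 * m%:R + 2) * 2 ^+ h.
  have -> : r = a^-1 * (a * r) by rewrite mulKf// gt_eqF.
  apply: (@le_trans _ _ (4 * 2 ^+ h * (m%:R + 2^-1))).
    by apply: ler_pM => //; [rewrite invr_ge0 ltW | rewrite mulr_ge0// ltW].
  by move: (2 ^+ h) => H; lra.
have -> : lat_pt B z 0 j = (lat_pt B z 0 j - t 0 j) + t 0 j by rewrite subrK.
apply: (le_trans (ler_normD _ _)); move: (tH j) rH; rewrite -/r.
by move: (2 ^+ h) => H; lra.
Qed.

(** A good sample that also solves the problem. At the right scale the last condition follows from
    the second; stating it separately makes the analysis uniform in the scale. *)
Definition winning (a : R) (y : 'rV[R]_m.+1) := exists z,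
  [/\ decode_target t a y = lat_pt B z, pnorm_pow p (a *: (lat_pt B z - t)) <= m%:R + 2^-1 &
      pnorm_pow p (lat_pt B z - t) <= rad].

Lemma winning_decodable (a : R) (y : 'rV[R]_m.+1) (f : nat -> R) : 0 < a -> a^-1 <= 4 * 2 ^+ h ->
  (forall j : 'I_m.+1, f j = y 0 j) -> winning a y ->
  let u j := tf j - 2 * f m * f j / a in
  decodable n m h bf u /\ dist_to_t p m tf u <= rad.
Proof.
move=> a0 aH fy [z [yz hz zr]] u.
have uz (j : 'I_m) : u j = lat_pt B z 0 j.
  rewrite -yz [RHS]mxE /u mxfun_row -(lift_max j) fy.
  by rewrite (fy ord_max).
split; last first.
  rewrite dist_to_tE (_ : \row_j u j = lat_pt B z)//.
  by apply/rowP => j; rewrite [LHS]mxE uz.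
have [zi hzi] := row_in_lattice uz.
exists (fun k => if insub k is Some k' then z 0 k' else 0).
  move=> j mj; rewrite (uz (Ordinal mj)) lat_pt_coef; apply: eq_bigr => k _.
  by rewrite valK -[j in RHS]/(nat_of_ord (Ordinal mj)) mxfunE.
move=> k kn; rewrite -[k]/(nat_of_ord (Ordinal kn)) valK.
by apply: coefW; exact: lat_pt_bound hz.
Qed.

Definition basis_ready (a : R) s := forall (i : 'I_n.+1) (j : 'I_m.+1), arr s 16 i j = embed_mx B t a i j.

Definition has_best s := exists z, forall j : 'I_m, arr s 20 0%N j = lat_pt B z 0 j.

Definition solved s := `[< pnorm_pow p (\row_(j < m) arr s 20 0%N j - t) <= rad >].

(** A lower bound for the success probability as a function of the store: [1] once a solution is
    kept, since array 20 never gets worse, and [v] before. *)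
Definition value (v : R) s : R := if solved s then 1 else v.

Variables (O : oracle R) (M : nat) (Q : store R -> Prop).
Hypothesis OD : forall r d (A : 'M[R]_(r, d)), row_free A -> is_distribution (O A).

Let O0 r d (A : 'M[R]_(r, d)) : row_free A -> forall y, 0 <= O A y.
Proof. by move=> /OD[]. Qed.

Local Notation pwpO := (pwp p O M n.+1 m.+1 Q).

Definition round_inv (a : R) r s :=
  [/\ context s, arr s 7 0%N 0%N = a, basis_ready a s, has_best s & ctr s 7 = r].

Definition time_round := (M * (time_sample n m h).+3 + 5)%N.

(** Between the query and the decoding, [V1] also gives the value [1] to stores that hold a winning
    sample not yet decoded. *)
Lemma pwp_round (a : R) r (rho v : R) s : 0 < a -> a^-1 <= 4 * 2 ^+ h ->
  (rho%:E <= \esum_(y in winning a) (O (embed_mx B t a) y)%:E)%E -> 0 <= v -> v <= 1 ->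
  round_inv a r s ->
  pwpO time_round round_of_queries (round_inv a r) (value v) s
    (value (1 - (1 - v) * (1 - rho) ^+ M) s).
Proof.
move=> a0 aH hrho v0 v1 [cs s7 s16 s20 sr].
have fE : row_free (embed_mx B t a) by exact: embed_mx_free.
have [D0 D1] := OD fE.
pose yrow s1 q : 'rV[R]_m.+1 := \row_j arr s1 17 q j.
pose won s1 := `[< exists2 q, (q < M)%N & winning a (yrow s1 q) >].
pose V1 s1 : R := if solved s1 || won s1 then 1 else v.
have -> : time_round = (1 + (M * (time_sample n m h).+3 + 3)).+1 by rewrite /time_round; lia.
have sE : read_mx s 16 n.+1 m.+1 = embed_mx B t a by apply/matrixP => i j; rewrite mxE s16.
apply: (pwp_seq (I1 := fun s1 => round_inv a r s1 /\ ctr s1 5 = M) (V1 := V1)).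
  have key y : solved (set_ctr (write_mx s 17 (\matrix_i y i)) 5 M) = solved s by [].
  have keyrow (y : {ffun 'I_M -> 'rV[R]_m.+1}) (i : 'I_M) :
      yrow (set_ctr (write_mx s 17 (\matrix_i y i)) 5 M) i = y i.
    by apply/rowP => j; rewrite mxE /= !valK mxE.
  have Vv s1 : v <= V1 s1 by rewrite /V1; case: ifP.
  apply: (pwp_query O0) => /=.
  - by rewrite (ctx_n cs) addn1.
  - by rewrite (ctx_m cs) addn1.
  - by rewrite sE.
  - move=> y; split => //; split => //.
    by apply: (ctx_agree (X := [:: 5%N]) (Y := [:: 17%N]) _ _ _ cs) => //; split => x;
      rewrite inE => /negbTE xx /=; rewrite ?xx.
  - by move=> s1 _; exact: le_trans (Vv s1).
  rewrite sE /value; case: ifPn => sv.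
    (* If a solution is already kept, no sample is declared good and the value without one is
       [1]. *)
    have := @esum_tuple_success R _ M (O (embed_mx B t a)) set0 0 1
      (fun y => V1 (set_ctr (write_mx s 17 (\matrix_i y i)) 5 M)) D0 D1.
    rewrite subrr mul0r subr0; apply => //; first by rewrite esum_set0.
    by move=> y; rewrite /V1 key sv.
  apply: (esum_tuple_success (good := winning a)) => // y i wi.
  rewrite /V1 (_ : won _) ?orbT//; apply/asboolP; exists i => //.
  by rewrite keyrow.
move=> s1 [[cs1 s17 s116 [z hz] s1r] s15]; apply: (pwp_det O0).
have lw : in_lattice n m bf (fun j => arr s1 20 0%N j) by exact: row_in_lattice hz.
apply: (wp_post (wp_samples p (gs_neq0 mxfun_indep) cs1 s15 s17 (y := fun q j => arr s1 17 q j) _ (w := arr s1 20 0%N) _ lw)) => //.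
move=> s2 [w [w20 lw2 ww hq]] ag2.
have cs2 : context s2 by apply: ctx_agree ag2 _ _ cs1.
have [agX agA] := ag2.
have row2 : \row_(j < m) arr s2 20 0%N j = \row_(j < m) w j.
  by apply/rowP => j; rewrite !mxE w20.
split.
  split => //.
  - by rewrite agA.
  - by move=> i j; rewrite agA.
  - have [z2 hz2] := in_lattice_row lw2; exists z2 => j; by rewrite w20.
  - by rewrite agX.
rewrite /V1 /value; case: ifPn => [/orP[|/asboolP[q qM wq]]|_]; last by case: ifP.
  move=> sv; suff -> : solved s2 by [].
  apply/asboolP; rewrite row2 -dist_to_tE; apply: (le_trans ww).
  by rewrite dist_to_tE; exact/asboolP.
suff -> : solved s2 by [].
apply/asboolP; rewrite row2 -dist_to_tE.
have [|ud hd] := winning_decodable (f := arr s1 17 q) a0 aH _ wq; first by move=> j; rewrite mxE.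
exact: le_trans (hq _ qM ud) hd.
Qed.

Lemma solved_agree s s' : arr s' 20 = arr s 20 -> solved s' = solved s.
Proof. by rewrite /solved => ->. Qed.

Lemma ler_values v v' s : v <= v' -> value v s <= value v' s.
Proof. by rewrite /value; case: ifP. Qed.

Lemma pwp_weaken T c I V s v v' : v' <= v -> pwpO T c I V s v -> pwpO T c I V s v'.
Proof.
move=> vv hc K k' H; have [h1 h2] := hc K k' H; split => //.
by apply: le_trans h2; rewrite lee_fin.
Qed.

Lemma teval_lt e x s : teval p s (TNot (TIle e (IVar x))) = (ctr s x < ieval s e)%N.
Proof. by rewrite /= ltnNge. Qed.

(* At the right scale a query returns [1 / (1280 (m + 1))] good samples on average,
   so that all queries fail with probability at most [exp (- 2) < 1 / 3]. *)
Definition repeats := (2560 * m.+1)%N.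

Lemma pwp_repeats (a rho v : R) s : 0 < a -> a^-1 <= 4 * 2 ^+ h -> 0 <= rho -> rho <= 1 ->
  (rho%:E <= \esum_(y in winning a) (O (embed_mx B t a) y)%:E)%E -> 0 <= v -> v <= 1 ->
  context s -> arr s 7 0%N 0%N = a -> basis_ready a s -> has_best s ->
  pwpO (repeats * time_round.+3 + 3) (for_loop 7 (iexp_mul 2560 dim1) round_of_queries)
    (round_inv a repeats) (value v) s (value (1 - (1 - v) * (1 - rho) ^+ (M * repeats)) s).
Proof.
move=> a0 aH rho0 rho1 hrho v0 v1 cs s7 s16 s20.
have repE s1 : context s1 -> ieval s1 (iexp_mul 2560 dim1) = repeats.
  by move=> cs1; rewrite /repeats -(ctx_m cs1) -[(ctr s1 1).+1]addn1; exact: (ieval_mul s1 2560 dim1).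
(* The value when [repeats - r] queries are still to come. *)
pose vr r := 1 - (1 - v) * (1 - rho) ^+ (M * (repeats - r)).
have [q0 q1] : 0 <= 1 - rho /\ 1 - rho <= 1 by split; move: rho0 rho1; lra.
have vr0 r : 0 <= vr r.
  rewrite subr_ge0 mulr_ile1//; [by rewrite subr_ge0 | exact: exprn_ge0 | | exact: exprn_ile1].
  by move: v0; lra.
have vr1 r : vr r <= 1 by rewrite gerBl mulr_ge0// ?exprn_ge0// subr_ge0.
apply: (pwp_le O0 (T := (1 + (repeats * (time_round + 1).+2).+1).+1)).
  by move: repeats time_round => N T; clear; lia.
have -> : 1 - (1 - v) * (1 - rho) ^+ (M * repeats) = vr 0%N by rewrite /vr subn0.
rewrite (_ : value v = value (vr repeats)); last by rewrite /vr subnn muln0 expr0 mulr1 subKr.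
apply: (pwp_seq (I1 := round_inv a 0) (V1 := value (vr 0%N))).
  apply: (pwp_det O0); apply: wp_iset; split => //; split => //.
  by apply: (ctx_agree (X := [:: 7%N]) (Y := [::]) _ _ _ cs) => //; exact: agree_set_ctr.
move=> s1 I1.
apply: (pwp_while (I := round_inv a) (V := fun r => value (vr r))) => //; last first.
  by move=> s2 [cs2 _ _ _ s27]; rewrite teval_lt repE// s27 ltnn.
move=> r s2 rN I2; split.
  have [cs2 _ _ _ s27] := I2; by rewrite teval_lt repE// s27.
have -> : vr r = 1 - (1 - vr r.+1) * (1 - rho) ^+ M.
  rewrite /vr [1 - (1 - _)]subKr -mulrA -exprD; congr (1 - _ * _ ^+ _).
  by rewrite -mulnSr -subSn// subSS.
apply: (pwp_seq (pwp_round a0 aH hrho (vr0 r.+1) (vr1 r.+1) I2)) => s3 [cs3 s37 s316 s320 s3r].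
apply: (pwp_det O0); apply: wp_iset; split => //; split => //.
  by apply: (ctx_agree (X := [:: 7%N]) (Y := [::]) _ _ _ cs3) => //; exact: agree_set_ctr.
by rewrite /= s3r addn1.
Qed.

Definition scale_inv (a : R) s := [/\ context s, arr s 7 0%N 0%N = a & has_best s].

Definition time_scale := (n * (m * 4 + 8) + m * 4 + repeats * time_round.+3 + 16)%N.

Lemma pwp_scale (a rho v : R) s : 0 < a -> a^-1 <= 4 * 2 ^+ h -> 0 <= rho -> rho <= 1 ->
  (rho%:E <= \esum_(y in winning a) (O (embed_mx B t a) y)%:E)%E -> 0 <= v -> v <= 1 ->
  scale_inv a s ->
  pwpO time_scale scale_cmd (scale_inv (a * (4 / 3))) (value v) s
    (value (1 - (1 - v) * (1 - rho) ^+ (M * repeats)) s).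
Proof.
move=> a0 aH rho0 rho1 hrho v0 v1 [cs s7 s20].
apply: (pwp_le O0 (T := ((n * (m * 4 + 8) + m * 4 + 10) + ((repeats * time_round.+3 + 3) + 1).+1).+1)).
  by rewrite /time_scale; move: repeats time_round => N T; clear; lia.
set v' := 1 - _.
apply: (pwp_seq (I1 := fun s1 => scale_inv a s1 /\ basis_ready a s1) (V1 := value v')).
  apply: (pwp_det O0); apply: (wp_post (wp_build p cs s7)) => s1 [g1 g2 g3 g4] ag.
  have cs1 : context s1 by apply: ctx_agree ag _ _ cs.
  have [_ agA] := ag; split; last by rewrite /value (@solved_agree s) ?agA.
  split; first by split; rewrite /has_best ?agA.
  move=> i j; rewrite mxE; case: (unliftP ord_max i) => [i'|] ->; rewrite mxE;
  case: (unliftP ord_max j) => [j'|] ->; rewrite ?lift_max ?g4 ?g2 ?g3 ?g1//= ?mxE ?mxE.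
  - by rewrite mxfunE.
  - by rewrite mxfun_row.
move=> s1 [[cs1 s17 s120] s116].
apply: (pwp_seq (pwp_repeats a0 aH rho0 rho1 hrho v0 v1 cs1 s17 s116 s120)).
move=> s2 [cs2 s27 _ s220 _]; apply: (pwp_det O0); apply: wp_rset.
split => //; split; first by apply: (ctx_agree (X := [::]) (Y := [:: 7%N]) _ _ _ cs2) => //; exact: agree_set_cell.
  by rewrite arr_cell_same /= s27.
by rewrite /has_best arr_cell_neq.
Qed.

Definition alpha j : R := (4 * 2 ^+ h)^-1 * (4 / 3) ^+ j.

Lemma alpha_gt0 j : 0 < alpha j.
Proof. by rewrite mulr_gt0 ?invr_gt0 ?mulr_gt0 ?exprn_gt0// divr_gt0. Qed.

Lemma alpha_inv_le j : (alpha j)^-1 <= 4 * 2 ^+ h.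
Proof.
have e0 : 0 < (4 / 3) ^+ j :> R by rewrite exprn_gt0// divr_gt0.
rewrite /alpha invfM invrK ler_pdivrMr// ler_peMr ?mulr_ge0 ?exprn_ge0//.
by apply: exprn_ege1; lra.
Qed.

Variables (J jstar : nat) (rho : R).
Hypotheses (alphaJ : 2 ^+ h < alpha J) (alphaj : forall j, (j < J)%N -> alpha j <= 2 ^+ h).
Hypotheses (jstarJ : (jstar < J)%N) (rho0 : 0 <= rho) (rho1 : rho <= 1).
Hypothesis hrho : (rho%:E <= \esum_(y in winning (alpha jstar)) (O (embed_mx B t (alpha jstar)) y)%:E)%E.
Hypothesis rho_large : (1 - rho) ^+ (M * repeats) <= 3^-1.

(** Only the pass at [jstar] is credited. At every other scale [rho] is taken to be [0], and what
    has been found is not lost. *)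
Lemma pwp_main s : context s -> has_best s ->
  pwpO (J * time_scale.+1 + 3) main_cmd (fun s' => context s' /\ has_best s') (value 0) s (2 / 3).
Proof.
move=> cs s20.
apply: (pwp_le O0 (T := (1 + (J * time_scale.+1).+1).+1)); first by move: time_scale => T; clear; lia.
pose V j := value (if (j <= jstar)%N then 2 / 3 else 0).
have V0 s' : 2 / 3 <= V 0%N s' by rewrite /V /value; case: ifP => // _; lra.
apply: (pwp_seq (I1 := scale_inv (alpha 0)) (V1 := V 0%N)).
  apply: (pwp_det O0); apply: wp_rset; split => //; split.
  - by apply: (ctx_agree (X := [::]) (Y := [:: 7%N]) _ _ _ cs) => //; exact: agree_set_cell.
  - by rewrite arr_cell_same /= (ctx_H cs) /alpha expr0 mulr1 div1r.
  - by rewrite /has_best arr_cell_neq.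
move=> s1 I1; rewrite (_ : value 0 = V J); last by rewrite /V leqNgt jstarJ.
have hw K k' : (forall s', context s' /\ has_best s' ->
   halts_within p O M n.+1 m.+1 k' (K, s') /\ ((V J s')%:E <= success_prob p O M Q k' (K, s'))%E) ->
   forall s', scale_inv (alpha J) s' ->
   halts_within p O M n.+1 m.+1 k' (K, s') /\ ((V J s')%:E <= success_prob p O M Q k' (K, s'))%E.
  by move=> H s' [cs' _ s'20]; apply: H.
move=> K k' /hw; move: K k'.
apply: (pwp_while (I := fun j => scale_inv (alpha j)) (V := V)) => //; last first.
  by move=> s2 [cs2 s27 _]; rewrite /= s27 (ctx_H cs2) -ltNge.
move=> j s2 jJ I2; split.
  by have [cs2 s27 _] := I2; rewrite /= s27 (ctx_H cs2); exact: alphaj.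
have -> : alpha j.+1 = alpha j * (4 / 3) by rewrite /alpha exprSr mulrA.
have z0 : (0%:E <= \esum_(y in winning (alpha j)) (O (embed_mx B t (alpha j)) y)%:E)%E.
  apply: esum_ge0 => y _; rewrite lee_fin; apply: O0; apply: embed_mx_free => //.
  exact: alpha_gt0.
have scale0 v : 0 <= v -> v <= 1 ->
    pwpO time_scale scale_cmd (scale_inv (alpha j * (4 / 3))) (value v) s2 (value v s2).
  move=> v0 v1; have := @pwp_scale _ 0 _ _ (alpha_gt0 j) (alpha_inv_le j) _ _ z0 v0 v1 I2.
  by rewrite subr0 expr1n mulr1 subKr; apply.
have [jj|jj|jj] := ltngtP j jstar; rewrite /V.
- by rewrite (ltnW jj) jj; apply: scale0; lra.
- by rewrite (leqNgt j jstar) jj (ltnNge j jstar) (ltnW jj) /=; apply: scale0.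
rewrite jj leqnn ltnn.
have z1 : 0 <= 0 :> R by [].
rewrite jj in I2.
apply: pwp_weaken (pwp_scale (alpha_gt0 jstar) (alpha_inv_le jstar) rho0 rho1 hrho z1 ler01 I2).
apply: ler_values; rewrite subr0 mul1r; move: rho_large.
by move: (_ ^+ (M * repeats)) => q; lra.
Qed.

Lemma pwp_solve s : context s -> has_best s ->
  (forall s' z, (forall j : 'I_m, arr s' 0 0%N j = lat_pt B z 0 j) ->
     pnorm_pow p (lat_pt B z - t) <= rad -> Q s') ->
  pwpO (J * time_scale.+1 + m * 4 + 7) (CSeq main_cmd out_cmd) (fun=> True)
    (fun s' => if `[< Q s' >] then 1 else 0) s (2 / 3).
Proof.
move=> cs s20 hQ.
apply: (pwp_le O0 (T := ((J * time_scale.+1 + 3) + (m * 4 + 3)).+1)).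
  by move: time_scale => T; clear; lia.
apply: (pwp_seq (pwp_main cs s20)) => s1 [cs1 [z hz]]; apply: (pwp_det O0).
apply: (wp_post (wp_out p (ctx_m cs1) (w := arr s1 20 0%N) _)) => // s2 h2 _; split => //.
rewrite /value; case: ifPn => [/asboolP sv|_]; last by case: ifP.
rewrite (_ : `[< Q s2 >])//; apply/asboolP; apply: (hQ _ z); first by move=> j; rewrite h2.
by rewrite (_ : lat_pt B z = \row_(j < m) arr s1 20 0%N j)//; apply/rowP => j; rewrite [RHS]mxE hz.
Qed.

End Solver.

(** * Parameters and running time *)

Section InputSize.
Variable R : realType.
Implicit Types (x : rat) (s : seq rat).

Definition num_of x : R := (numq x)%:~R.
Definition den_of x : R := (denq x)%:~R.
Definition size_factor x : R := entry_factor (num_of x) (den_of x).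

Lemma ratrE x : ratr x = num_of x / den_of x :> R. Proof. by []. Qed.

Lemma den_of_ge1 x : 1 <= den_of x.
Proof. by rewrite /den_of -[1]/(1%:~R) ler_int; have := denq_gt0 x; lia. Qed.

Lemma den_le_size x : den_of x <= size_factor x.
Proof.
have d1 := den_of_ge1 x; rewrite /size_factor /entry_factor ler_peMl//; first by lra.
by rewrite lerDl -expr2 sqr_ge0.
Qed.

Lemma size_factor_ge1 x : 1 <= size_factor x.
Proof. exact: le_trans (den_of_ge1 x) (den_le_size x). Qed.

Lemma ratr_le_size x : `|ratr x : R| <= size_factor x.
Proof.
have d1 := den_of_ge1 x; have d0 : 0 < den_of x by lra.
rewrite ratrE normrM normfV (gtr0_norm d0) ler_pdivrMr// /size_factor /entry_factor.
have n0 : 0 <= `|num_of x| by [].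
rewrite -[num_of x * num_of x]expr2 -real_normK ?num_real//.
move: (`|_|) n0 d1 => q n0 d1; have q1 : q <= 1 + q ^+ 2 by nra.
apply: (le_trans q1); rewrite -mulrA ler_peMr//; first by rewrite addr_ge0// sqr_ge0.
by rewrite mulr_ege1.
Qed.

Lemma int_lt_bits (z : int) : `|z%:~R : R| + 1 <= 2 ^+ int_bits z.
Proof.
rewrite /int_bits -intr_norm -natr_absz -[1]/(1%:R) -natrD -natrX ler_nat addn1.
have [->|z0] := posnP `|z|%N; first by rewrite expn_gt0.
exact: trunc_log_ltn.
Qed.

Lemma size_factor_le x : size_factor x <= 2 ^+ (2 * rat_bits x).
Proof.
have := int_lt_bits (numq x); have := int_lt_bits (denq x); rewrite -/(num_of x) -/(den_of x).
have d1 := den_of_ge1 x; have d0 : 0 < den_of x by lra.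
rewrite (gtr0_norm d0) /rat_bits mulnDr exprD.
set e := int_bits (denq x); set f := int_bits (numq x) => hd hn.
rewrite /size_factor /entry_factor -[num_of x * num_of x]expr2 -real_normK ?num_real//.
apply: ler_pM; [by rewrite addr_ge0// sqr_ge0 | exact: ltW | | ].
  rewrite mulnC exprM; apply: (@le_trans _ _ ((`|num_of x| + 1) ^+ 2)).
    by move: (normr_ge0 (num_of x)) => q0; nra.
  by rewrite lerXn2r ?nnegrE ?addr_ge0// exprn_ge0.
apply: (@le_trans _ _ (2 ^+ e)); first by move: hd; lra.
by apply: ler_weXn2l; [lra | rewrite leq_pmull].
Qed.

Lemma prod_size_le s : \prod_(x <- s) size_factor x <= 2 ^+ (2 * \sum_(x <- s) rat_bits x).
Proof.
elim: s => [|x s IH]; first by rewrite !big_nil muln0 expr0.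
rewrite !big_cons mulnDr exprD ler_pM ?size_factor_le//.
  by apply: le_trans (size_factor_ge1 x).
by apply: prodr_ge0 => y _; apply: le_trans (size_factor_ge1 y).
Qed.

Lemma prod_den_ge1 s : 1 <= \prod_(x <- s) den_of x.
Proof.
elim: s => [|x s IH]; first by rewrite big_nil.
by rewrite big_cons mulr_ege1// den_of_ge1.
Qed.

Lemma prod_size_ge1 s : 1 <= \prod_(x <- s) size_factor x.
Proof.
elim: s => [|x s IH]; first by rewrite big_nil.
by rewrite big_cons mulr_ege1// size_factor_ge1.
Qed.

Lemma prod_den_le_size s : \prod_(x <- s) den_of x <= \prod_(x <- s) size_factor x.
Proof.
elim: s => [|x s IH]; first by rewrite !big_nil.
rewrite !big_cons ler_pM ?den_le_size//; first by apply: le_trans (den_of_ge1 x).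
by apply: le_trans (prod_den_ge1 s).
Qed.

Lemma ratr_le_prod_size s x : x \in s -> `|ratr x : R| <= \prod_(y <- s) size_factor y.
Proof.
move=> xs; rewrite (big_rem x)//=; apply: (le_trans (ratr_le_size x)).
by rewrite ler_peMr ?prod_size_ge1//; apply: le_trans (size_factor_ge1 x).
Qed.

Lemma prod_den_ratr s x : x \in s ->
  (numq x * \prod_(y <- rem x s) denq y)%:~R = (\prod_(y <- s) den_of y) * ratr x :> R.
Proof.
move=> xs; rewrite (big_rem x xs)/= ratrE intrM rmorph_prod /=.
have d0 : den_of x != 0 by rewrite gt_eqF// (lt_le_trans _ (den_of_ge1 x)).
move: d0; rewrite -/(num_of x) /den_of.
by move: (\prod_(_ <- _) _) (num_of x) (denq x)%:~R => P N d d0; field.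
Qed.

End InputSize.

(** * Numerical estimates *)

Section Numerics.
Variable R : realType.

Lemma expRN2_ge : expR (- 2 : R) >= 16^-1.
Proof.
have h : 2^-1 <= expR (- 2^-1 : R) by apply: le_trans (expR_ge1Dx _); lra.
have -> : (- 2 : R) = 4%:R * (- 2^-1) by lra.
rewrite expRM_natl (_ : 16^-1 = 2^-1 ^+ 4); last by rewrite exprVn; congr (_^-1); lra.
by rewrite lerXn2r// nnegrE ?expR_ge0// invr_ge0.
Qed.

Lemma pow_le_expR (q : R) k : q <= 1 -> (1 - q) ^+ k <= expR (- (q * k%:R)).
Proof.
move=> q1; rewrite -mulNr mulrC expRM_natl lerXn2r ?nnegrE ?expR_ge0 ?subr_ge0//.
exact: expR_ge1Dx.
Qed.

(** Rounding down keeps the constant in the bound on [M] equal to [1]; for a nonnegative exponent it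
    loses at most a factor [2]. *)
Definition sample_count (X : R) : nat := Num.truncn (expR X).

Lemma sample_count_le (X : R) : (sample_count X)%:R <= expR X.
Proof. by rewrite /sample_count truncn_le// expR_ge0. Qed.

Lemma sample_count_ge (X : R) : 0 <= X -> (0 < sample_count X)%N /\ expR X <= 2 * (sample_count X)%:R.
Proof.
move=> X0; have e1 : 1 <= expR X by rewrite -expR0 ler_expR.
have M0 : (0 < sample_count X)%N by rewrite truncn_gt0.
split => //; have := truncnS_gt (expR X); rewrite -/(sample_count X) -natr1.
have : 1 <= (sample_count X)%:R :> R by rewrite ler1n.
by lra.
Qed.

(** The [2] is the additive slack in [scale_exists], the denominator that of [hit_prob]. *)
Definition hit_rate (X : R) m : R := expR (- X - 2) / (20 * (2 * m%:R + 1)).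

Lemma hit_rate_bounds (X : R) m : 0 <= X -> 0 <= hit_rate X m /\ hit_rate X m <= 1.
Proof.
move=> X0; have m0 : 0 <= m%:R :> R by [].
have d1 : 1 <= 20 * (2 * m%:R + 1) :> R by lra.
split; first by rewrite divr_ge0 ?expR_ge0//; lra.
rewrite ler_pdivrMr ?mul1r; last by lra.
by apply: le_trans d1; rewrite -[leRHS]expR0 ler_expR; lra.
Qed.

(** The rate times the number of samples is at least [(1/16) (1/2) (2560 / 20) (1/2) = 2]; the
    factors come from [exp (- 2)], from rounding [M] down, from the constants and from
    [(m + 1) / (2 m + 1)]. Finally [exp (- 2) <= 1/3]. *)
Lemma repeats_enough (X : R) m : 0 <= X ->
  (1 - hit_rate X m) ^+ (sample_count X * repeats m) <= 3^-1.
Proof.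
move=> X0; have [q0 q1] := hit_rate_bounds m X0; have [M0 hM] := sample_count_ge X0.
apply: (le_trans (pow_le_expR _ q1)).
apply: (@le_trans _ _ (expR (- 2))); last first.
  rewrite expRN lef_pV2 ?posrE ?expR_gt0//.
  by apply: le_trans (expR_ge1Dx _); lra.
rewrite ler_expR lerN2 natrM /repeats natrM /hit_rate.
have e2 := expRN2_ge.
have eX : expR (- X - 2) = expR (- 2) / expR X :> R by rewrite addrC expRD expRN.
have eX0 : 0 < expR X by exact: expR_gt0.
have m1 : m.+1%:R = m%:R + 1 :> R by rewrite natr1.
rewrite eX m1; move: (sample_count X)%:R (expR (- 2)) (expR X) (m%:R) hM e2 eX0 (ler0n R m).
move=> S E Y r hM e2 Y0 r0.
have -> : E / Y / (20 * (2 * r + 1)) * (S * (2560 * (r + 1))) =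
    E * (S / Y) * (128 * ((r + 1) / (2 * r + 1))).
  by field; do ?[apply/andP; split]; rewrite gt_eqF//; lra.
have SY : 2^-1 <= S / Y by rewrite ler_pdivlMr//; lra.
have rr : 2^-1 <= (r + 1) / (2 * r + 1) by rewrite ler_pdivlMr; lra.
apply: (@le_trans _ _ (16^-1 * 2^-1 * (128 * 2^-1))); first by lra.
by rewrite !ler_pM// ?mulr_ge0//; lra.
Qed.

(** Three steps more than double the scale, as [(4/3)^3 = 64/27]. From [1 / (4 H)] to beyond [H] the
    factor [4 H^2 = 2^(2 h + 2)] has to be exceeded, and [6 h + 9 = 3 (2 h + 3)]. *)
Lemma scale_steps h : exists J, [/\ 2 ^+ h < alpha R h J,
  forall j, (j < J)%N -> alpha R h j <= 2 ^+ h & (J <= 6 * h + 9)%N].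
Proof.
have big k : 2 ^+ k <= (4 / 3 : R) ^+ (3 * k).
  by rewrite exprM lerXn2r ?nnegrE ?exprn_ge0//; lra.
have H0 : 0 < 2 ^+ h :> R by rewrite exprn_gt0.
have large : 2 ^+ h < alpha R h (6 * h + 9).
  rewrite /alpha mulrC ltr_pdivlMr ?mulr_gt0//.
  rewrite (_ : (6 * h + 9)%N = (3 * (h + (h + 3)))%N); last by lia.
  apply: lt_le_trans (big _); rewrite !exprD ltr_pM2l// mulrC ltr_pM2l//; lra.
have ex : exists J, 2 ^+ h < alpha R h J by exists (6 * h + 9)%N.
have [] := ex_minnP ex => J hJ Jmin; exists J; split => //; last exact: Jmin.
by move=> j jJ; rewrite leNgt; apply/negP => /Jmin; rewrite leqNgt jJ.
Qed.

Lemma alpha_mono h j k : (j <= k)%N -> alpha R h j <= alpha R h k.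
Proof.
move=> jk; rewrite ler_pM2l ?invr_gt0 ?mulr_gt0 ?exprn_gt0//.
by apply: ler_weXn2l => //; lra.
Qed.

End Numerics.

(** One constant serves as factor and as exponent, as in the statement of the theorem. *)
Definition polynomial_bound (f : nat -> nat) := exists c, forall N, (0 < N)%N -> (f N <= c * N ^ c)%N.

Lemma polynomial_bound_const k : polynomial_bound (fun=> k).
Proof. by exists k => N N0; rewrite leq_pmulr// expn_gt0 N0. Qed.

Lemma polynomial_bound_id : polynomial_bound id.
Proof. by exists 1%N => N N0; rewrite mul1n expn1. Qed.

Lemma polynomial_boundD f g : polynomial_bound f -> polynomial_bound g ->
  polynomial_bound (fun N => f N + g N)%N.
Proof.
move=> [c hc] [d hd]; exists (c + d)%N => N N0; rewrite mulnDl leq_add//.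
  by apply: (leq_trans (hc N N0)); rewrite leq_mul2l leq_pexp2l ?orbT// leq_addr.
by apply: (leq_trans (hd N N0)); rewrite leq_mul2l leq_pexp2l ?orbT// leq_addl.
Qed.

Lemma polynomial_boundM f g : polynomial_bound f -> polynomial_bound g ->
  polynomial_bound (fun N => f N * g N)%N.
Proof.
move=> [c hc] [d hd]; exists (c * d + c + d)%N => N N0.
apply: (leq_trans (leq_mul (hc N N0) (hd N N0))); rewrite mulnACA -expnD.
by apply: leq_mul; rewrite ?leq_pexp2l// -?addnA ?leq_addr ?leq_addl.
Qed.

Lemma polynomial_boundS f : polynomial_bound f -> polynomial_bound (fun N => (f N).+1).
Proof.
move=> hf; have [c hc] := polynomial_boundD hf (polynomial_bound_const 1).
by exists c => N N0; rewrite -addn1; exact: hc.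
Qed.

Definition total_time (n m h Kb J M : nat) : nat :=
  ((n * (m * 6 + 6) + m * 6 + Kb * 2 + (4 * m.+1) * 4 + 30) +
   ((n * (m * 4 + 3 + (n * (m * 10 + 14) + 3)).+4 + 3) +
    (J * (time_scale n m h M).+1 + m * 4 + 7)).+1).+1.


Lemma repeats_mono m m' : (m <= m')%N -> (repeats m <= repeats m')%N.
Proof. by move=> mm; rewrite leq_mul2l ltnS mm orbT. Qed.

Ltac solve_mono := repeat match goal with
  | |- is_true (leq ?x ?x) => exact: leqnn
  | |- is_true (leq (addn _ _) _) => apply: leq_add
  | |- is_true (leq (muln _ _) _) => apply: leq_mul
  | |- is_true (leq (S _) (S _)) => rewrite ltnS
  | |- _ => assumption
  end.

Lemma time_scale_mono n m h M n' m' h' : (n <= n')%N -> (m <= m')%N -> (h <= h')%N ->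
  (time_scale n m h M <= time_scale n' m' h' M)%N.
Proof.
move=> nn mm hh; have rr := repeats_mono mm.
by rewrite /time_scale /time_round /time_sample; solve_mono.
Qed.

Lemma total_time_mono n m h Kb J M n' m' h' Kb' J' : (n <= n')%N -> (m <= m')%N -> (h <= h')%N ->
  (Kb <= Kb')%N -> (J <= J')%N -> (total_time n m h Kb J M <= total_time n' m' h' Kb' J' M)%N.
Proof.
move=> nn mm hh KK JJ.
have ss : (time_scale n m h M <= time_scale n' m' h' M)%N by exact: time_scale_mono.
by rewrite /total_time; solve_mono.
Qed.

(** [M] occurs linearly, through the time of one round, and [M >= 1] absorbs the remaining terms. *)
Lemma total_time_samples n m h Kb J M : (0 < M)%N ->
  (total_time n m h Kb J M <= M * total_time n m h Kb J 1)%N.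
Proof.
move=> M0; have S x y : (x <= M * y)%N -> (x.+1 <= M * y.+1)%N.
  by move=> xy; rewrite mulnS -addn1 addnC leq_add.
have A x y x' y' : (x <= M * x')%N -> (y <= M * y')%N -> (x + y <= M * (x' + y'))%N.
  by move=> hx hy; rewrite mulnDr leq_add.
have C x : (x <= M * x)%N by rewrite leq_pmull.
have P x y y' : (y <= M * y')%N -> (x * y <= M * (x * y'))%N.
  by move=> hy; rewrite mulnCA leq_mul2l hy orbT.
rewrite /total_time /time_scale /time_round.
repeat match goal with
| |- is_true (leq ?x (muln _ ?x)) => exact: C
| |- is_true (leq (addn _ _) _) => apply A
| |- is_true (leq (muln M ?x) (muln M (muln 1 ?x))) => by rewrite mul1n
| |- is_true (leq (muln _ _) _) => apply P
| |- is_true (leq (Datatypes.S _) _) => apply S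
end.
Qed.

(** For [N = m + l + 1] with [l] the input length, the bound on the exponent of [H] is
    [Kb = 2 N + 1 <= 3 N], and the number of scales is at most [6 Kb + 9 <= 27 N]. *)
Lemma total_time_polynomial : polynomial_bound (fun N => total_time N N (3 * N) (3 * N) (27 * N) 1).
Proof.
have rr : polynomial_bound (fun N => repeats N).
  apply: (@polynomial_boundM (fun=> 2560%N) S); first exact: polynomial_bound_const.
  exact: (polynomial_boundS polynomial_bound_id).
rewrite /total_time /time_scale /time_round /time_sample.
repeat match goal with
| |- polynomial_bound (fun N => repeats N) => exact: rr
| |- polynomial_bound (fun N => addn (@?f N) (@?g N)) => apply: (@polynomial_boundD f g)
| |- polynomial_bound (fun N => muln (@?f N) (@?g N)) => apply: (@polynomial_boundM f g)
| |- polynomial_bound (fun N => Datatypes.S (@?f N)) => apply: (@polynomial_boundS f)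
| |- polynomial_bound (fun N => N) => exact: polynomial_bound_id
| |- polynomial_bound (fun N => ?k) => exact: (polynomial_bound_const k)
end.
Qed.

(** * Assembly of the reduction *)

Section Reduction.
Variables (R : realType) (p gamma delta : R).
Hypotheses (p1 : 1 <= p) (p2 : p <= 2) (gamma4 : 4 <= gamma) (delta0 : 0 < delta).
Variables (n m : nat) (B : 'M[rat]_(n, m)) (t : 'rV[rat]_m) (O : oracle R).

Local Notation BR := (map_mx ratr B : 'M[R]_(n, m)).
Local Notation tR := (map_mx ratr t : 'rV[R]_m).
Local Notation X := (m%:R / (gamma / 4) `^ p + delta).
Local Notation M := (sample_count X).

Hypothesis fB : row_free BR.
Hypothesis hO : dss_oracle p delta O.

Definition entries : seq rat :=
  [seq B i j | i <- index_enum 'I_n, j <- index_enum 'I_m] ++ [seq t 0 j | j <- index_enum 'I_m].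

Lemma big_entries (T : Type) (idx : T) (op : Monoid.law idx) (F : rat -> T) :
  \big[op/idx]_(x <- entries) F x =
  op (\big[op/idx]_i \big[op/idx]_j F (B i j)) (\big[op/idx]_j F (t 0 j)).
Proof. by rewrite big_cat big_allpairs_dep big_map. Qed.

Lemma mem_entries_basis i j : B i j \in entries.
Proof. by rewrite mem_cat allpairs_f// mem_index_enum. Qed.

Lemma mem_entries_target j : t 0 j \in entries.
Proof. by rewrite mem_cat (map_f (fun j => t 0 j)) ?orbT// mem_index_enum. Qed.

(** [P] is the product accumulated in array 4, [Delta] a common denominator of the whole input. *)
Let P : R := \prod_(x <- entries) size_factor R x.
Let Delta : R := \prod_(x <- entries) den_of R x.
Let Bz : 'M[int]_(n, m) := \matrix_(i, j) (numq (B i j) * \prod_(y <- rem (B i j) entries) denq y).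
Let tz : 'rV[int]_m := \row_j (numq (t 0 j) * \prod_(y <- rem (t 0 j) entries) denq y).

Lemma basis_integral : map_mx intr Bz = Delta *: BR.
Proof.
by apply/matrixP => i j; rewrite !mxE prod_den_ratr// mem_entries_basis.
Qed.

Lemma target_integral : map_mx intr tz = Delta *: tR.
Proof.
by apply/rowP => j; rewrite !mxE prod_den_ratr// mem_entries_target.
Qed.

Lemma basis_entry_le i j : `|BR i j| <= P.
Proof. by rewrite mxE; apply: ratr_le_prod_size; exact: mem_entries_basis. Qed.

Lemma target_entry_le j : `|tR 0 j| <= P.
Proof. by rewrite mxE; apply: ratr_le_prod_size; exact: mem_entries_target. Qed.

Lemma exponent_ge0 : 0 <= X.
Proof. by rewrite addr_ge0 ?(ltW delta0)// divr_ge0// powR_ge0. Qed.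

Let Q (s : store R) := cvp_solution p gamma BR tR (output m s).
Let rad : R := (gamma * lp_dist p tR BR) `^ p.

Let g0 : 0 <= gamma * lp_dist p tR BR.
Proof. by rewrite mulr_ge0 ?lp_dist_ge0//; move: gamma4; lra. Qed.

Let OD r d (A : 'M[R]_(r, d)) : row_free A -> is_distribution (O A).
Proof. by move=> /hO[]. Qed.

Let O0 r d (A : 'M[R]_(r, d)) : row_free A -> forall y, 0 <= O A y.
Proof. by move=> /OD[]. Qed.

(** [hit_prob] is applied at the scale of [scale_exists], where every good sample is winning. *)
Lemma good_scale h : 2 * m.+1%:R ^+ 2 * P <= 2 ^+ h -> exists2 k, alpha R h k <= 2 ^+ h &
  ((hit_rate X m)%:E <= \esum_(y in winning p BR tR rad (alpha R h k))
     (O (embed_mx BR tR (alpha R h k)) y)%:E)%E.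
Proof.
move=> HP; have [k [z0 [eps [aH [e0 e1] cost near good]]]] := scale_exists p1 (prod_den_ge1 R entries)
  (prod_den_le_size R entries) target_entry_le basis_integral target_integral HP gamma4.
exists k => //; set a := alpha R h k; have a0 : 0 < a by exact: alpha_gt0.
have faB : row_free (a *: BR) by move: fB; rewrite /row_free mxrank_scale_nz// gt_eqF.
pose F := fine (\esum_(z in [set: 'rV[int]_n]) (expR (- pnorm_pow p (lat_pt (a *: BR) z)))%:E).
have FE : \esum_(z in [set: 'rV[int]_n]) (expR (- pnorm_pow p (lat_pt (a *: BR) z)))%:E = F%:E.
  rewrite fineK// ge0_fin_numE; first exact: theta_summable.
  by apply: esum_ge0 => z _; rewrite lee_fin expR_ge0.
have := hit_prob p1 p2 fB a0 FE e0 e1 (hO (embed_mx_free tR fB a0)) near.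
move=> hS; apply: (@le_trans _ _
  (expR (- delta - (m%:R + 2^-1) * eps - m%:R * eps / (1 - eps)) / (20 * (2 * m%:R + 1)))%:E).
  rewrite lee_fin ler_pM2r; last by rewrite invr_gt0; have : 0 <= m%:R :> R by []; lra.
  by rewrite ler_expR; move: cost; lra.
apply: (le_trans hS); rewrite esum_mkcond [leRHS]esum_mkcond.
apply: le_esum => y _; case: ifPn => [|_]; last first.
  by case: ifP => // _; rewrite lee_fin; apply: O0; exact: embed_mx_free.
rewrite inE => -[z yz hz]; rewrite ifT// inE; exists z; split => //.
rewrite -(lp_norm_powR p1); apply: ge0_ler_powR; first by move: p1; lra.
- by rewrite nnegrE; exact: lp_norm_ge0.
- by rewrite nnegrE; exact: g0.
exact: good.
Qed.

Lemma solve_from h s : 2 * m.+1%:R ^+ 2 * P <= 2 ^+ h ->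
  ctx n m h (mxfun BR) (mxfun tR 0) s -> has_best BR s -> 
  pwp p O M n.+1 m.+1 Q ((6 * h + 9) * (time_scale n m h M).+1 + m * 4 + 7)
    (CSeq main_cmd out_cmd) (fun=> True) (fun s' => if `[< Q s' >] then 1 else 0) s (2 / 3).
Proof.
move=> HP cs s20; have [k ak hk] := good_scale HP.
have [J [aJ aj JJ]] := scale_steps R h.
have kJ : (k < J)%N.
  by rewrite ltnNge; apply/negP => /(alpha_mono R h) /(lt_le_trans aJ); rewrite ltNge ak.
have [q0 q1] := hit_rate_bounds m exponent_ge0.
apply: (pwp_le O0 (T := (J * (time_scale n m h M).+1 + m * 4 + 7))).
  by rewrite !leq_add2r leq_mul2r JJ orbT.
apply: (pwp_solve p1 p2 fB (rad := rad) _ _ OD aJ aj kJ q0 q1 hk (repeats_enough m exponent_ge0) cs s20).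
- move=> j; apply: le_trans HP; apply: (le_trans (target_entry_le j)).
  rewrite ler_peMl//; first by apply: (le_trans ler01); exact: prod_size_ge1.
  have m1 : 1 <= m.+1%:R :> R by rewrite ler1n.
  by rewrite expr2; nra.
- move=> z hz i; rewrite exprM.
  exact: (coef_le_pow fB (prod_den_ge1 R entries) (prod_den_le_size R entries)
    basis_entry_le basis_integral HP hz).
move=> s' z hz zr; have outE : output m s' = lat_pt BR z.
  by apply/rowP => j; rewrite [LHS]mxE -[RHS]hz.
rewrite /Q outE; split; first by exists z.
have -> : gamma * lp_dist p tR BR = rad `^ p^-1.
  by rewrite /rad -powRrM mulfV ?powRr1// gt_eqF//; move: p1; lra.
by rewrite (lp_norm_le p1)// powR_ge0.
Qed.

(** One bit for the factor [2], [2 (m + 1)] for the square of [m + 1 <= 2^(m + 1)], and twice the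
    input length for [P]. *)
Let Kb := (1 + 2 * m.+1 + 2 * input_bits B t)%N.

Lemma size_le : 2 * (m.+1%:R * m.+1%:R) * P <= 2 ^+ Kb.
Proof.
have Pl : P <= 2 ^+ (2 * input_bits B t).
  by have := prod_size_le R entries; rewrite -/P [X in (2 * X)%N]big_entries.
have ml : m.+1%:R <= 2 ^+ m.+1 :> R by rewrite -natrX ler_nat ltnW// ltn_expl.
rewrite /Kb; move: (input_bits B t) Pl => l Pl.
rewrite exprD [_ ^+ (1 + _)]exprD expr1 [(2 * m.+1)%N]mulnC exprM expr2.
have m0 : 0 <= m.+1%:R :> R by [].
have P0 : 0 <= P by apply: (le_trans ler01); exact: prod_size_ge1.
apply: ler_pM => //.
by rewrite ler_pM2l// ler_pM.
Qed.

Lemma cvp_prog_solves :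
  pwp p O M n.+1 m.+1 Q (total_time n m Kb Kb (6 * Kb + 9) M) cvp_prog (fun=> True)
    (fun s' => if `[< Q s' >] then 1 else 0) (init_store R B t) (2 / 3).
Proof.
set s0 := init_store R B t.
have A0' (i : 'I_n) (j : 'I_m) : arr s0 0 i j = num_of R (B i j) /\ arr s0 1 i j = den_of R (B i j).
  by rewrite /s0 /= !valK !mxE.
have A2' (j : 'I_m) : arr s0 2 0%N j = num_of R (t 0 j) /\ arr s0 3 0%N j = den_of R (t 0 j).
  by rewrite /s0 /= !valK !(valK (ord0 : 'I_1)) !mxE.
have A0 i j : (i < n)%N -> (j < m)%N -> arr s0 0 i j = mxfun (map_mx (num_of R) B) i j /\
    arr s0 1 i j = mxfun (map_mx (den_of R) B) i j.
  move=> ni mj; rewrite -[i]/(nat_of_ord (Ordinal ni)) -[j]/(nat_of_ord (Ordinal mj)) !mxfunE.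
  by rewrite !mxE; exact: A0'.
have A2 j : (j < m)%N -> arr s0 2 0%N j = mxfun (map_mx (num_of R) t) 0 j /\
    arr s0 3 0%N j = mxfun (map_mx (den_of R) t) 0 j.
  move=> mj; rewrite -[j]/(nat_of_ord (Ordinal mj)) !mxfun_row.
  by rewrite !mxE; exact: A2'.
apply: (pwp_seq (I1 := fun s1 => [/\ ctr s1 0 = n, ctr s1 1 = m,
    forall i j, (i < n)%N -> (j < m)%N -> arr s1 0 i j = mxfun BR i j,
    forall j, (j < m)%N -> arr s1 2 0%N j = mxfun tR 0 j &
    arr s1 20 = (fun _ _ => 0) /\ exists2 h : nat, (h <= Kb)%N &
      [/\ arr s1 5 0%N 0%N = 2 ^+ h, 2 * (m.+1%:R * m.+1%:R) * P <= 2 ^+ h &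
          arr s1 6 0%N 0%N = 2 ^+ (h * (4 * m.+1))]]) (V1 := fun=> 2 / 3)).
  apply: (pwp_det O0); apply: (wp_post (@wp_prep R p n m Kb _ _ _ _ P s0 _ _ A0 A2 _ size_le)) => //.
    rewrite /P big_entries; congr (_ * _).
      by apply: eq_bigr => i _; apply: eq_bigr => j _; rewrite !mxfunE !mxE.
    by apply: eq_bigr => j _; rewrite !mxfun_row !mxE.
  move=> s1 [h0 h2 h5] [agX agA]; split => //; split.
  - by rewrite agX.
  - by rewrite agX.
  - move=> i j ni mj; rewrite h0//.
    by rewrite -[i]/(nat_of_ord (Ordinal ni)) -[j]/(nat_of_ord (Ordinal mj)) !mxfunE !mxE ratrE.
  - by move=> j mj; rewrite h2// -[j]/(nat_of_ord (Ordinal mj)) !mxfun_row !mxE ratrE.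
  - by split => //; rewrite agA.
move=> s1 [sn sm s10 s12 [s120 [h hK [s15 HP s16]]]].
have HP' : 2 * m.+1%:R ^+ 2 * P <= 2 ^+ h by rewrite expr2.
apply: (pwp_seq (I1 := fun s2 => ctx n m h (mxfun BR) (mxfun tR 0) s2 /\ has_best BR s2)
   (V1 := fun=> 2 / 3)).
  apply: (pwp_det O0); apply: (wp_post (wp_gs p sn sm s10)) => s2 h15 [agX agA].
  split => //; split; first by split=> //; rewrite ?agX ?agA.
  (* Array 20 is blank at the start and thus holds the zero vector, a lattice point. *)
  exists 0 => j; rewrite agA// s120.
  by rewrite -[0 in RHS](subrr 0) lat_ptB subrr mxE.
move=> s2 [cs2 s220].
(* The exponent [h] is replaced by [Kb], which makes the time a function of the sizes of the
   input. *)
apply: (pwp_le O0 _ (solve_from HP' cs2 s220)).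
rewrite !leq_add2r; apply: leq_mul; first by rewrite leq_add2r leq_mul2l hK orbT.
by rewrite ltnS time_scale_mono.
Qed.

End Reduction.

Theorem theorem5p2 (R : realType) :
  exists2 C : R, 0 < C &
  forall (p : R) (gamma : nat -> nat -> R) (delta : R),
    1 <= p -> p <= 2 -> (forall n m : nat, 4 <= gamma n m) -> 0 < delta ->
  exists (M : nat -> nat -> nat) (a : nat) (prog : cmd),
    (forall n m : nat,
       (M n m)%:R <= C * expR (m%:R / (gamma n m / 4) `^ p + delta)) /\
    cvp_to_dss_reduction p gamma delta M
      (fun n m l : nat => (M n m * (a * (m + l).+1 ^ a))%N) prog.
Proof.
exists 1 => // p gamma delta p1 p2 gamma4 delta0.
have [a time_le] := total_time_polynomial.
pose X n m : R := m%:R / (gamma n m / 4) `^ p + delta.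
exists (fun n m => sample_count (X n m)), a, cvp_prog; split.
  by move=> n m; rewrite mul1r; exact: sample_count_le.
move=> n m B t O BR tR c0 k fB hO.
(* The rank is at most the dimension, so a polynomial in [m] and [l] also covers [n]. *)
have nm : (n <= m)%N by move: fB => /eqP <-; exact: rank_leq_col.
have O0 r d (A : 'M[R]_(r, d)) : row_free A -> forall y, 0 <= O r d A y by move=> /hO[[]].
set Q := fun s => cvp_solution _ _ _ _ _.
have [M0 _] := sample_count_ge (exponent_ge0 p (gamma n m) delta0 m : 0 <= X n m).
have sol := cvp_prog_solves p1 p2 (gamma4 n m) delta0 (t := t) fB hO.
set Kb := (1 + _ + _)%N in sol; set T := total_time _ _ _ _ _ _ in sol.
have Tk : (T + 0 <= k)%N.
  rewrite addn0 /k; set N := (m + input_bits B t).+1.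
  apply: (@leq_trans (sample_count (X n m) * total_time N N (3 * N) (3 * N) (27 * N) 1)); last first.
    by rewrite leq_mul2l time_le ?orbT.
  apply: leq_trans (total_time_samples _ _ _ _ _ M0).
  by apply: total_time_mono; rewrite /N /Kb; move: (input_bits B t) nm => l; clear; lia.
(* With no command left the value is the indicator of success. *)
have [|h1 h2] := sol [::] 0%N; first by move=> s _; split => //=; case: ifP.
split; first exact: halts_mono Tk h1.
by rewrite (success_stable O0 _ Tk h1).
Qed.
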